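(* Let $M$ be a PTR-submanifold of a Sasakian manifold with totally real distribution $\mathcal D^\perp$ and ambiguous distribution $\widetilde{\mathcal D}$. The distribution $\widetilde{\mathcal D}$ is integrable and its leaves are totally geodesic in $M$ if and only if, for all $X,Y\in\Gamma(\widetilde{\mathcal D})$ and $Z\in\Gamma(\mathcal D^{\perp})$, $$g\bigl(h(X,PY)+\nabla_X^\perp(FY),\phi Z\bigr)=0\qquad\text{and}\qquad g(PX,Y)=0.$$
   Context: A Sasakian manifold $(\overline M^{2m+1},\phi,\xi,\eta,g)$ consists of a Riemannian metric $g$ with Levi-Civita connection $\widetilde\nabla$, a $(1,1)$-tensor field $\phi$, a vector field $\xi$ (the Reeb field) and a 1-form $\eta$ with $\phi^2X=-X+\eta(X)\xi$, $\eta(\xi)=1$, $\phi\xi=0$, $g(\phi X,\phi Y)=g(X,Y)-\eta(X)\eta(Y)$ and $(\widetilde\nabla_X\phi)Y=g(X,Y)\xi-\eta(Y)X$; in particular $\widetilde\nabla_X\xi=-\phi X$. Let $M$ be an immersed submanifold with $\xi\in\Gamma(TM)$, with the induced metric, second fundamental form $h$ and normal connection $\nabla^\perp$. For $X\in TM$ write $\phi X=PX+FX$ with $PX$ tangent and $FX$ normal. A PTR (partially totally real) submanifold is such an $M$ with a chosen nonzero constant-rank distribution $\mathcal D^{\perp}\subset TM\cap\ker\eta$ satisfying $\phi\mathcal D^{\perp}\subset T^{\perp}M$. The ambiguous distribution $\widetilde{\mathcal D}$ is the orthogonal complement of $\mathcal D^{\perp}\oplus\langle\xi\rangle$ in $TM$.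 *)

(* Defs.v *)
From HB Require Import structures.
From mathcomp Require Import all_boot all_order all_algebra.
From mathcomp Require Import all_classical all_reals all_analysis.
Import Order.TTheory GRing.Theory Num.Theory.
Import numFieldNormedType.Exports.

Set Implicit Arguments.
Unset Strict Implicit.
Unset Printing Implicit Defensive.

Local Open Scope classical_set_scope.
Local Open Scope ring_scope.

(* C^oo on an open set A: every iterated directional derivative of f is
   (Frechet) differentiable at every point of A. *)
Definition smooth_on (R : realType) (V W : normedModType R)
    (A : set V) (f : V -> W) : Prop :=
  forall (s : seq V) (x : V), A x ->
    differentiable (foldr (fun v h => fun y => 'D_v h y) f s) x.

(* An atlas in which one chart around each point has been singled out:
   [chart p] is defined on the open neighbourhood [dom p] of p and [chart_inv p]
   is its inverse.  Tangent vectors at p are represented by their components in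
   [chart p], so that T_p M is 'rV[R]_n for every p. *)
Record smoothManifold (R : realType) (n : nat) := SmoothManifold {
  points :> topologicalType ;
  dom : points -> set points ;
  chart : points -> points -> 'rV[R]_n ;
  chart_inv : points -> 'rV[R]_n -> points ;
  points_hausdorff : hausdorff_space points ;
  points_second_countable : @second_countable points ;
  dom_open : forall p, open (dom p) ;
  dom_center : forall p, dom p p ;
  chart_image_open : forall p, open (chart p @` dom p) ;
  chartK : forall p x, dom p x -> chart_inv p (chart p x) = x ;
  chart_continuous : forall p x, dom p x -> {for x, continuous (chart p)} ;
  chart_inv_continuous : forall p y, (chart p @` dom p) y ->
    {for y, continuous (chart_inv p)} ;
  transition_smooth : forall p q,
    smooth_on (chart p @` (dom p `&` dom q)) (chart q \o chart_inv p) }.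

(* Components in chart b of the vector, tangent at x, whose components in
   chart a are v. *)
Definition tchange (R : realType) (n : nat) (M : smoothManifold R n)
    (a b x : M) (v : 'rV[R]_n) : 'rV[R]_n :=
  'D_v (chart b \o chart_inv a) (chart a x).

Section Maps.
Context {R : realType} {n m : nat}.
Context {N : smoothManifold R n} {M : smoothManifold R m}.

Definition smooth_map (f : N -> M) : Prop :=
  continuous f /\
  forall q p, smooth_on (chart q @` (dom q `&` f @^-1` dom p))
                        (chart p \o f \o chart_inv q).

Definition tmap (f : N -> M) (q : N) (u : 'rV[R]_n) : 'rV[R]_m :=
  'D_u (chart (f q) \o f \o chart_inv q) (chart q q).

Definition immersion (f : N -> M) : Prop :=
  smooth_map f /\ forall q, injective (tmap f q).

(* Vector fields along f, i.e. V x is tangent to M at f x: components of V in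
   chart p of M, as functions of the coordinates given by chart q of N. *)
Definition field_rep (f : N -> M) (V : N -> 'rV[R]_m) (q : N) (p : M)
    (y : 'rV[R]_n) : 'rV[R]_m :=
  let x := chart_inv q y in tchange (f x) p (f x) (V x).

Definition smooth_field_on (U : set N) (f : N -> M) (V : N -> 'rV[R]_m) : Prop :=
  forall q p, smooth_on (chart q @` (U `&` dom q `&` f @^-1` dom p))
                        (field_rep f V q p).

End Maps.

Section Manifold.
Context {R : realType} {n : nat} {M : smoothManifold R n}.

Definition vector_field (X : M -> 'rV[R]_n) : Prop :=
  smooth_field_on [set: M] idfun X.

Definition distribution (k : nat) (D : M -> set 'rV[R]_n) : Prop :=
  forall p, exists (U : set M) (E : 'I_k -> M -> 'rV[R]_n),
    [/\ open U, U p, forall i, smooth_field_on U idfun (E i) &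
        forall q, U q -> row_free (\matrix_i E i q) /\
          D q = [set v | (v <= \matrix_i E i q)%MS]].

Definition section_of (D : M -> set 'rV[R]_n) (X : M -> 'rV[R]_n) : Prop :=
  vector_field X /\ forall p, D p (X p).

Definition metric_rep (g : M -> 'rV[R]_n -> 'rV[R]_n -> R) (p : M)
    (v w y : 'rV[R]_n) : R :=
  let x := chart_inv p y in g x (tchange p x x v) (tchange p x x w).

Definition riemannian (g : M -> 'rV[R]_n -> 'rV[R]_n -> R) : Prop :=
  [/\ forall p w, scalar (g p ^~ w),
      forall p v w, g p v w = g p w v,
      forall p v, v != 0 -> 0 < g p v v &
      forall p v w, smooth_on (chart p @` dom p) (metric_rep g p v w)].

(* Christoffel symbols at p of the Levi-Civita connection, in chart p:
   Gamma_p(u, v) = u^i v^j Gamma_ij^k, given by Koszul's formula for the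
   (commuting) vector fields with constant components u, v, w. *)
Definition christoffel (g : M -> 'rV[R]_n -> 'rV[R]_n -> R) (p : M)
    (u v : 'rV[R]_n) : 'rV[R]_n :=
  xget 0 [set c | forall w : 'rV[R]_n,
    2 * g p c w = 'D_u (metric_rep g p v w) (chart p p)
                + 'D_v (metric_rep g p u w) (chart p p)
                - 'D_w (metric_rep g p u v) (chart p p)].

End Manifold.

Section Submanifold.
Context {R : realType} {n m : nat}.
Context {N : smoothManifold R n} {M : smoothManifold R m}.
Variables (g : M -> 'rV[R]_m -> 'rV[R]_m -> R) (f : N -> M).

(* Covariant derivative at q, in the direction u, of a vector field V along f,
   for the Levi-Civita connection of g (pulled back by f):
   u(V^k) + Gamma_ij^k(f q) (df u)^i V^j, computed in chart (f q) at f q.  For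
   f = idfun this is the Levi-Civita connection of g itself. *)
Definition cov (V : N -> 'rV[R]_m) (q : N) (u : 'rV[R]_n) : 'rV[R]_m :=
  'D_u (field_rep f V q (f q)) (chart q q)
  + christoffel g (f q) (tmap f q u) (V q).

Definition induced_metric (q : N) (u v : 'rV[R]_n) : R :=
  g (f q) (tmap f q u) (tmap f q v).

(* orthogonal decomposition v = df (tangent_part v) + normal_part v at f q *)
Definition tangent_part (q : N) (v : 'rV[R]_m) : 'rV[R]_n :=
  xget 0 [set u | forall w : 'rV[R]_n,
    g (f q) (tmap f q u) (tmap f q w) = g (f q) v (tmap f q w)].

Definition normal_part (q : N) (v : 'rV[R]_m) : 'rV[R]_m :=
  v - tmap f q (tangent_part q v).

(* h(X, Y) *)
Definition second_fundamental_form (X Y : N -> 'rV[R]_n) (q : N) : 'rV[R]_m :=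
  normal_part q (cov (fun x => tmap f x (Y x)) q (X q)).

(* nabla^perp_X V, for a normal field V *)
Definition normal_connection (X : N -> 'rV[R]_n) (V : N -> 'rV[R]_m) (q : N)
    : 'rV[R]_m :=
  normal_part q (cov V q (X q)).

Definition totally_geodesic : Prop :=
  forall X Y : N -> 'rV[R]_n, vector_field X -> vector_field Y ->
  forall q, second_fundamental_form X Y q = 0.

End Submanifold.

Section Integrability.
Context {R : realType} {n : nat} {M : smoothManifold R n}.

Definition integral_manifold (D : M -> set 'rV[R]_n)
    (k : nat) (L : smoothManifold R k) (i : L -> M) : Prop :=
  [/\ immersion i, injective i & forall q, range (tmap i q) = D (i q)].

Definition integrable_distribution (D : M -> set 'rV[R]_n) : Prop :=
  forall p : M, exists (k : nat) (L : smoothManifold R k) (i : L -> M),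
    integral_manifold D i /\ range i p.

(* The leaves are the maximal connected integral manifolds.  As every integral
   manifold of an integrable distribution is a union of open pieces of leaves
   and being totally geodesic is a local property, maximality and connectedness
   are not imposed. *)
Definition leaves_totally_geodesic (g : M -> 'rV[R]_n -> 'rV[R]_n -> R)
    (D : M -> set 'rV[R]_n) : Prop :=
  forall (k : nat) (L : smoothManifold R k) (i : L -> M),
    integral_manifold D i -> totally_geodesic g i.

End Integrability.

Definition sasakian (R : realType) (m : nat) (M : smoothManifold R (2 * m + 1))
    (g : M -> 'rV[R]_(2 * m + 1) -> 'rV[R]_(2 * m + 1) -> R)
    (phi : M -> 'rV[R]_(2 * m + 1) -> 'rV[R]_(2 * m + 1))
    (xi : M -> 'rV[R]_(2 * m + 1))
    (eta : M -> 'rV[R]_(2 * m + 1) -> R) : Prop :=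
  [/\ riemannian g,
      (forall p, linear (phi p)) /\
      (forall p v, smooth_on (chart p @` dom p)
         (fun y => let x := chart_inv p y in
                   tchange x p x (phi x (tchange p x x v)))),
      vector_field xi &
      (forall p, scalar (eta p)) /\
      (forall p v, smooth_on (chart p @` dom p)
         (fun y => let x := chart_inv p y in eta x (tchange p x x v)))] /\
  [/\ forall p v, phi p (phi p v) = - v + eta p v *: xi p,
      forall p, eta p (xi p) = 1,
      forall p, phi p (xi p) = 0,
      forall p v w, g p (phi p v) (phi p w) = g p v w - eta p v * eta p w &
      forall X Y, vector_field X -> vector_field Y -> forall p,
        cov g idfun (fun x => phi x (Y x)) p (X p)
          - phi p (cov g idfun Y p (X p))
        = g p (X p) (Y p) *: xi p - eta p (Y p) *: X p].

Section PTR.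
Context {R : realType} {m n : nat}.
Context {Mbar : smoothManifold R m} {M : smoothManifold R n}.
Variables (g : Mbar -> 'rV[R]_m -> 'rV[R]_m -> R)
  (phi : Mbar -> 'rV[R]_m -> 'rV[R]_m) (xi : Mbar -> 'rV[R]_m)
  (eta : Mbar -> 'rV[R]_m -> R) (f : M -> Mbar).

(* phi X = df (P X) + F X *)
Definition tensorP (X : M -> 'rV[R]_n) (p : M) : 'rV[R]_n :=
  tangent_part g f p (phi (f p) (tmap f p (X p))).

Definition tensorF (X : M -> 'rV[R]_n) (p : M) : 'rV[R]_m :=
  normal_part g f p (phi (f p) (tmap f p (X p))).

Definition ptr_submanifold (D : M -> set 'rV[R]_n) : Prop :=
  [/\ immersion f,
      forall p, range (tmap f p) (xi (f p)),
      exists2 r, (0 < r)%N & distribution r D,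
      forall p u, D p u -> eta (f p) (tmap f p u) = 0 &
      forall p u v, D p u -> g (f p) (phi (f p) (tmap f p u)) (tmap f p v) = 0].

Definition ambiguous_distribution (D : M -> set 'rV[R]_n) (p : M)
    : set 'rV[R]_n :=
  [set v | (forall u, D p u -> induced_metric g f p v u = 0) /\
           g (f p) (tmap f p v) (xi (f p)) = 0].

End PTR.

(* Main.v *)
Require Import Defs.
From HB Require Import structures.
From mathcomp Require Import all_boot all_order all_algebra.
From mathcomp Require Import all_classical all_reals all_analysis.
From mathcomp Require Import ring lra.
Import Order.TTheory GRing.Theory Num.Theory.
Import numFieldNormedType.Exports.

Set Implicit Arguments.
Unset Strict Implicit.
Unset Printing Implicit Defensive.

Local Open Scope classical_set_scope.
Local Open Scope ring_scope.

(** Let nabla be the connection of the ambient metric g along f, and let X, Y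
    be sections of the ambiguous distribution and Z one of the totally real
    distribution. Since phi Z is normal to M, the tangential corrections in h
    and in the normal connection are invisible to it, and the pairing in the
    first condition is g (nabla_X (phi Y), phi Z). The Sasakian identity turns
    this into g (phi (nabla_X Y), phi Z), hence into g (nabla_X Y, Z), because
    eta vanishes on Z and phi is an isometry off xi; as g (Y, Z) = 0, it is
    also - g (Y, nabla_X Z) (first_condition_eq). On the other side g (nabla_X
    Y, xi) = - g (Y, nabla_X xi) = g (Y, phi X), so the second condition says
    that nabla_X Y has no component along xi. The two conditions thus say that
    the projection of nabla_X Y to M stays in the ambiguous distribution. As
    they are tensorial, sections may be replaced by vectors at a point: the
    conditions become perp_parallel and phi_isotropic. The passage uses
    cut-off functions, built from exp (- 1 / t).

    Suppose that the distribution has totally geodesic integral manifolds. By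
    the Gauss formula the derivative of a field of tangent vectors of such a
    leaf, taken in M, stays tangent to the leaf, that is in the distribution;
    since there is a leaf through every point, both conditions follow
    (geodesic_isotropic and geodesic_parallel).

    Conversely, the ambiguous distribution is the common kernel of the
    one-forms dual to xi and to the members W of a local frame of the totally
    real distribution. The exterior derivative of the form dual to W maps (v,
    w) to g (w, nabla_v W) - g (v, nabla_w W), which vanishes on the
    distribution under the two conditions (conormal_closed). The Frobenius
    theorem gives the integral manifolds, and the Gauss formula once more
    shows that their second fundamental form in M is zero (leaves_geodesic).

    The proof of the Frobenius theorem starts in coordinates adapted to a
    complement of the distribution, where the integral manifold is the graph
    of a solution of a total differential equation whose commutation condition
    is the closedness above (total_differential_equation); it is obtained by
    solving an ordinary differential equation along each ray, and
    differentiability follows from a Gronwall estimate of the remainder. All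
    connections are handled through covariant derivatives along maps: they are
    metric (cov_metric), torsion-free (cov_torsion_free), compatible with
    pull-back (cov_pullback) and with isometric immersions (gauss). The
    smoothness of phi, needed to differentiate phi Y, comes from the fact that
    d eta (v, w) = - 2 g (phi v, w) (dform_xi). *)

(** * Smooth maps *)

Section Smooth.
Context {R : realType}.

Lemma near_eq_differentiable (V W : normedModType R) (f g : V -> W) (x : V) :
  {near x, f =1 g} -> differentiable f x -> differentiable g x.
Proof.
move=> fg /diff_locallyP [dc df]; have fgx := nbhs_singleton fg.
have dg : g \o shift x = cst (g x) + 'd f x +o_ 0 id.
  apply/eqaddoP => e e0; move/eqaddoP: df => /(_ e e0).
  have /= fg0 : \forall h \near (0:V), f (h + x) = g (h + x).
    by move: fg; rewrite (near_shift 0) subr0.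
  apply: filter_app; near=> h.
  by rewrite /= !fctE /= -fgx (near fg0 h).
apply/diff_locallyP; rewrite (diff_unique dc dg).
by split.
Unshelve. all: by end_near. Qed.

(** Iterated derivatives are local: this is what makes smoothness on an open
    set independent of the values outside it. *)
Lemma foldr_derive_eq (V W : normedModType R) (A : set V) (f g : V -> W) s :
  open A -> (forall x, A x -> f x = g x) -> forall x, A x ->
  foldr (fun v h => fun y => 'D_v h y) f s x =
  foldr (fun v h => fun y => 'D_v h y) g s x.
Proof.
move=> oA fg; elim: s => [//|v s IH] x Ax /=.
apply: near_eq_derive; near=> y; apply: IH; near: y; exact: open_nbhs_nbhs.
Unshelve. all: by end_near. Qed.

Lemma smooth_on_eq (V W : normedModType R) (A : set V) (f g : V -> W) :
  open A -> (forall x, A x -> f x = g x) -> smooth_on A f -> smooth_on A g.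
Proof.
move=> oA fg sf s x Ax; apply: near_eq_differentiable (sf s x Ax).
near=> y; apply: (foldr_derive_eq _ oA fg); near: y; exact: open_nbhs_nbhs.
Unshelve. all: by end_near. Qed.

Lemma smooth_onW (V W : normedModType R) (A B : set V) (f : V -> W) :
  A `<=` B -> smooth_on B f -> smooth_on A f.
Proof. by move=> AB sf s x /AB; apply: sf. Qed.

Lemma smooth_on_diff (V W : normedModType R) (A : set V) (f : V -> W) x :
  smooth_on A f -> A x -> differentiable f x.
Proof. by move=> sf; exact: (sf [::]). Qed.

Lemma smooth_on_derive (V W : normedModType R) (A : set V) (f : V -> W) v :
  smooth_on A f -> smooth_on A (fun y => 'D_v f y).
Proof. by move=> sf s x Ax; have := sf (rcons s v) x Ax; rewrite foldr_rcons. Qed.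

Lemma smooth_on_loc (V W : normedModType R) (A : set V) (f : V -> W) :
  (forall x, A x -> exists2 B, B x & smooth_on B f) -> smooth_on A f.
Proof. by move=> H s x /H [B Bx sf]; exact: sf. Qed.

(** Smoothness by coinduction: a class of differentiable functions that is
    stable, on an open set, under directional derivatives consists of smooth
    functions. All closure properties below are obtained by exhibiting such a
    class, which avoids formulas for iterated derivatives. *)
Lemma smooth_on_coind (V W : normedModType R) (A : set V)
    (P : (V -> W) -> Prop) : open A ->
  (forall f, P f -> (forall x, A x -> differentiable f x) /\
     forall v, exists2 g, P g & forall x, A x -> 'D_v f x = g x) ->
  forall f, P f -> smooth_on A f.
Proof.
move=> oA HP f Pf s; elim/last_ind: s f Pf => [|s v IH] f /HP [df dP] x Ax.
  exact: df.
rewrite foldr_rcons; have [g Pg dg] := dP v.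
apply: near_eq_differentiable (IH g Pg x Ax).
near=> y; apply/esym/(foldr_derive_eq _ oA dg); near: y; exact: open_nbhs_nbhs.
Unshelve. all: by end_near. Qed.

Lemma derive_linear (V W : normedModType R) (f : V -> W) x a u v :
  differentiable f x -> 'D_(a *: u + v) f x = a *: 'D_u f x + 'D_v f x.
Proof. by move=> df; rewrite !deriveE// linearP. Qed.

Lemma derive_comp (U V W : normedModType R) (f : U -> V) (g : V -> W) x v :
  differentiable f x -> differentiable g (f x) ->
  'D_v (g \o f) x = 'D_('D_v f x) g (f x).
Proof.
move=> df dg; have dgf := differentiable_comp df dg.
by rewrite (deriveE _ dgf) (deriveE _ dg) (deriveE _ df) diff_comp.
Qed.

Lemma derive_rV_sum n (W : normedModType R) (f : 'rV[R]_n -> W) x v :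
  differentiable f x ->
  'D_v f x = \sum_i v 0 i *: 'D_(delta_mx 0 i) f x.
Proof.
move=> df; rewrite deriveE// {1}(row_sum_delta v) linear_sum.
by apply: eq_bigr => i _; rewrite linearZ deriveE.
Qed.

Lemma differentiable_rVP (V : normedModType R) n (f : V -> 'rV[R]_n) x :
  differentiable f x <-> forall i, differentiable (fun y => f y 0 i) x.
Proof.
split=> [df i|df].
  apply: (@differentiable_comp _ _ _ _ f (fun v : 'rV[R]_n => v 0 i)) => //.
  exact: differentiable_coord.
have -> : f = \sum_i (fun y => f y 0 i *: (delta_mx 0 i : 'rV[R]_n)).
  by apply/funext => y; rewrite fct_sumE {1}(row_sum_delta (f y)).
by apply: differentiable_sum => i; apply: differentiableZl.
Qed.

Lemma derive_rV (V : normedModType R) n (f : V -> 'rV[R]_n) x v i :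
  differentiable f x -> ('D_v f x) 0 i = 'D_v (fun y => f y 0 i) x.
Proof. by move=> df; rewrite derive_mx ?mxE//; exact: diff_derivable. Qed.

(** Both directions are by coinduction, since directional derivatives commute
    with taking components. *)
Lemma smooth_on_rVP (V : normedModType R) n (A : set V) (f : V -> 'rV[R]_n) :
  open A ->
  smooth_on A f <-> forall i, smooth_on A (fun y => f y 0 i).
Proof.
move=> oA; split=> [sf i|]; last first.
  pose P (f : V -> 'rV[R]_n) := forall i, smooth_on A (fun y => f y 0 i).
  apply: (@smooth_on_coind _ _ _ P) => // {}f sf; have df x : A x -> differentiable f x.
    by move=> Ax; apply/differentiable_rVP => i; exact: smooth_on_diff (sf i) Ax.
  split => // v; exists (fun y => 'D_v f y) => // i.
  apply: smooth_on_eq oA _ (smooth_on_derive v (sf i)) => y Ay.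
  by rewrite derive_rV//; exact: df.
pose P g := exists2 f : V -> 'rV[R]_n, smooth_on A f & g = fun y => f y 0 i.
apply: (@smooth_on_coind _ _ _ P) => //; last by exists f.
move=> _ [{sf}f sf ->]; split => [x Ax|v].
  by move/differentiable_rVP : (smooth_on_diff sf Ax); apply.
exists (fun y => ('D_v f y) 0 i); first by exists (fun y => 'D_v f y) => //; exact: smooth_on_derive.
by move=> x Ax; rewrite derive_rV//; exact: smooth_on_diff sf Ax.
Qed.

Lemma smooth_on_cst (V W : normedModType R) (A : set V) (c : W) :
  open A -> smooth_on A (fun _ : V => c).
Proof.
move=> oA; pose P g := exists c : W, g = fun _ : V => c.
apply: (@smooth_on_coind _ _ _ P) => //; last by exists c.
move=> _ [{}c ->]; split => [x _|v]; first exact: differentiable_cst.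
by exists (fun=> 0); [exists 0 | move=> x _; exact: derive_cst].
Qed.

(** The point of this class is that it is stable under directional
    derivatives: the derivative of each generator is again built from
    generators. In particular the chain rule for a composite with g only
    involves partial derivatives of g, which are smooth on the same set B. *)
Inductive smooth_gen n (A : set 'rV[R]_n) : ('rV[R]_n -> R) -> Prop :=
| Gen_smooth f of smooth_on A f : smooth_gen A f
| Gen_add f g of smooth_gen A f & smooth_gen A g :
    smooth_gen A (fun x => f x + g x)
| Gen_mul f g of smooth_gen A f & smooth_gen A g :
    smooth_gen A (fun x => f x * g x)
| Gen_inv f of smooth_gen A f & (forall x, A x -> f x != 0) :
    smooth_gen A (fun x => (f x)^-1)
| Gen_comp k (B : set 'rV[R]_k) g (f : 'rV[R]_n -> 'rV[R]_k)
    of smooth_on B g & (forall i, smooth_gen A (fun x => f x 0 i))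
    & (forall x, A x -> B (f x)) : smooth_gen A (fun x => g (f x)).

Lemma smooth_gen_sum n (A : set 'rV[R]_n) I (r : seq I) F : open A ->
  (forall i, smooth_gen A (F i)) -> smooth_gen A (fun x => \sum_(i <- r) F i x).
Proof.
move=> oA HF; elim: r => [|i r IH].
  under eq_fun do rewrite big_nil; apply: Gen_smooth; exact: smooth_on_cst.
by under eq_fun do rewrite big_cons; exact: Gen_add.
Qed.

Lemma smooth_genP n (A : set 'rV[R]_n) f : open A ->
  smooth_gen A f -> smooth_on A f.
Proof.
move=> oA; apply: (@smooth_on_coind _ _ _ (@smooth_gen n A)) => // {}f.
elim=> {f} [f sf|f g _ [df Df] _ [dg Dg]|f g Gf [df Df] Gg [dg Dg]|f Gf [df Df] f0|k B g f sg Gf IH AB].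
- split=> [x|v]; first exact: smooth_on_diff.
  by exists (fun y => 'D_v f y) => //; apply: Gen_smooth; exact: smooth_on_derive.
- split=> [x Ax|v].
    by apply: (@differentiableD _ _ _ f g); [exact: df|exact: dg].
  have [f' Gf' Ef] := Df v; have [g' Gg' Eg] := Dg v.
  exists (fun x => f' x + g' x); first exact: Gen_add.
  move=> x Ax; rewrite (@deriveD _ _ _ f g) ?Ef ?Eg//.
    by apply: diff_derivable; exact: df.
  by apply: diff_derivable; exact: dg.
- split=> [x Ax|v].
    by apply: (@differentiableM _ _ f g); [exact: df|exact: dg].
  have [f' Gf' Ef] := Df v; have [g' Gg' Eg] := Dg v.
  exists (fun x => f x * g' x + g x * f' x).
    by apply: Gen_add; apply: Gen_mul.
  move=> x Ax; rewrite (@deriveM _ _ f g) ?Ef ?Eg//.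
    by apply: diff_derivable; exact: df.
  by apply: diff_derivable; exact: dg.
- split=> [x Ax|v].
    by apply: (@differentiableV _ _ f); [exact: df|exact: f0].
  have [f' Gf' Ef] := Df v.
  exists (fun x => - 1 * ((f x)^-1 * (f x)^-1) * f' x).
    apply: Gen_mul => //; apply: Gen_mul; last by apply: Gen_mul; apply: Gen_inv.
    by apply: Gen_smooth; exact: smooth_on_cst.
  move=> x Ax; rewrite (@deriveV _ _ f) ?Ef ?f0//.
    by rewrite expr2 invfM mulN1r.
  by apply: diff_derivable; exact: df.
- have df x : A x -> differentiable f x.
    by move=> Ax; apply/differentiable_rVP => i; have [+ _] := IH i; exact.
  split=> [x Ax|v].
    apply: (@differentiable_comp _ _ _ _ f g); first exact: df.
    by apply: smooth_on_diff sg _; exact: AB.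
  have /choice[f' f'P] : forall i, exists f' : 'rV[R]_n -> R, smooth_gen A f' /\
      (forall x, A x -> 'D_v (fun y => f y 0 i) x = f' x).
    by move=> i; have [_ /(_ v) [f' ? ?]] := IH i; exists f'.
  (* the chain rule in terms of the partial derivatives of g *)
  exists (fun x => \sum_i f' i x * 'D_(delta_mx 0 i) g (f x)).
    apply: smooth_gen_sum => // i; apply: Gen_mul; first by have [] := f'P i.
    by apply: (@Gen_comp _ A _ B ('D_(delta_mx 0 i) g) f) => //; exact: smooth_on_derive.
  move=> x Ax; have dg : differentiable g (f x).
    by apply: smooth_on_diff sg _; exact: AB.
  rewrite (derive_comp (f := f)) //; last exact: df.
  rewrite (derive_rV_sum ('D_v f x) dg).
  apply: eq_bigr => i _; rewrite derive_rV; last exact: df.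
  by have [_ ->] := f'P i.
Qed.

End Smooth.

Section Closure.
Context {R : realType} {n : nat}.
Variable A : set 'rV[R]_n.
Hypothesis oA : open A.

Lemma smooth_onD (f g : 'rV[R]_n -> R) : smooth_on A f -> smooth_on A g ->
  smooth_on A (fun x => f x + g x).
Proof. by move=> sf sg; apply: smooth_genP => //; apply: Gen_add; exact: Gen_smooth. Qed.

Lemma smooth_onM (f g : 'rV[R]_n -> R) : smooth_on A f -> smooth_on A g ->
  smooth_on A (fun x => f x * g x).
Proof. by move=> sf sg; apply: smooth_genP => //; apply: Gen_mul; exact: Gen_smooth. Qed.

Lemma smooth_onV (f : 'rV[R]_n -> R) : smooth_on A f ->
  (forall x, A x -> f x != 0) -> smooth_on A (fun x => (f x)^-1).
Proof. by move=> sf f0; apply: smooth_genP => //; apply: Gen_inv => //; exact: Gen_smooth. Qed.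

Lemma smooth_on_sum I (r : seq I) (P : pred I) (F : I -> 'rV[R]_n -> R) :
  (forall i, P i -> smooth_on A (F i)) ->
  smooth_on A (fun x => \sum_(i <- r | P i) F i x).
Proof.
move=> sF; elim: r => [|i r IH].
  by under eq_fun do rewrite big_nil; exact: smooth_on_cst.
under eq_fun do rewrite big_cons.
by case: (boolP (P i)) => Pi //; apply: smooth_onD => //; exact: sF.
Qed.

Lemma smooth_on_prod I (r : seq I) (P : pred I) (F : I -> 'rV[R]_n -> R) :
  (forall i, P i -> smooth_on A (F i)) ->
  smooth_on A (fun x => \prod_(i <- r | P i) F i x).
Proof.
move=> sF; elim: r => [|i r IH].
  by under eq_fun do rewrite big_nil; exact: smooth_on_cst.
under eq_fun do rewrite big_cons.
by case: (boolP (P i)) => Pi //; apply: smooth_onM => //; exact: sF.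
Qed.

Lemma smooth_on_comp k (B : set 'rV[R]_k) (f : 'rV[R]_n -> 'rV[R]_k)
    (g : 'rV[R]_k -> R) :
  smooth_on A f -> smooth_on B g -> (forall x, A x -> B (f x)) ->
  smooth_on A (fun x => g (f x)).
Proof.
move=> sf sg AB; apply: smooth_genP => //; apply: (@Gen_comp _ _ _ _ B) => // i.
by apply: Gen_smooth; exact: (smooth_on_rVP _ oA).1.
Qed.

Lemma smooth_on_comp_rV k m (B : set 'rV[R]_k) (f : 'rV[R]_n -> 'rV[R]_k)
    (g : 'rV[R]_k -> 'rV[R]_m) : open B ->
  smooth_on A f -> smooth_on B g -> (forall x, A x -> B (f x)) ->
  smooth_on A (fun x => g (f x)).
Proof.
move=> oB sf sg AB; apply/smooth_on_rVP => // i.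
apply: (@smooth_on_comp _ B f (fun z => g z 0 i)) => //.
exact: (smooth_on_rVP _ oB).1.
Qed.

Lemma smooth_on_id : smooth_on A id.
Proof.
pose P (f : 'rV[R]_n -> 'rV[R]_n) := f = id \/ exists c, f = fun=> c.
apply: (@smooth_on_coind _ _ _ _ P) => //; last by left.
move=> f [->|[c ->]]; split.
- by move=> x _; exact: (ex_diff (f := id)).
- move=> v; exists (fun=> v); first by right; exists v.
  by move=> x _; exact: derive_id.
- by move=> x _; exact: differentiable_cst.
- by move=> v; exists (fun=> 0); [right; exists 0|move=> x _; exact: derive_cst].
Qed.

Lemma smooth_on_coord i : smooth_on A (fun x => x 0 i).
Proof. exact: (smooth_on_rVP _ oA).1 smooth_on_id i. Qed.

Lemma smooth_on_det k (K : 'rV[R]_n -> 'M[R]_k) :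
  (forall i j, smooth_on A (fun y => K y i j)) ->
  smooth_on A (fun y => \det (K y)).
Proof.
move=> sK; apply: smooth_on_sum => s _; apply: smooth_onM.
  exact: smooth_on_cst.
by apply: smooth_on_prod.
Qed.

Lemma smooth_on_invmx k (K : 'rV[R]_n -> 'M[R]_k) :
  (forall i j, smooth_on A (fun y => K y i j)) ->
  (forall y, A y -> K y \in unitmx) ->
  forall i j, smooth_on A (fun y => invmx (K y) i j).
Proof.
move=> sK uK i j.
apply: (@smooth_on_eq _ _ _ _ (fun y => (\det (K y))^-1 * cofactor (K y) j i)) => //.
  by move=> y Ay; rewrite /invmx uK// !mxE.
apply: smooth_onM.
  by apply: smooth_onV; [exact: smooth_on_det|move=> y /uK; rewrite unitmxE unitfE].
apply: smooth_onM; first exact: smooth_on_cst.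
by apply: smooth_on_det => a b; under eq_fun do rewrite !mxE; exact: sK.
Qed.

Lemma smooth_on_mulmx a b c (K : 'rV[R]_n -> 'M[R]_(a, b)) (L : 'rV[R]_n -> 'M[R]_(b, c)) :
  (forall i j, smooth_on A (fun y => K y i j)) ->
  (forall i j, smooth_on A (fun y => L y i j)) ->
  forall i j, smooth_on A (fun y => (K y *m L y) i j).
Proof.
move=> sK sL i j; under eq_fun do rewrite mxE.
by apply: smooth_on_sum => l _; exact: smooth_onM.
Qed.

End Closure.

(** * Mean values, mixed derivatives and local bounds *)

Section MeanValue.
Context {R : realType} {V : normedModType R}.

Lemma is_derive_along_line (W : normedModType R) (f : V -> W) (x u : V) (s : R) :
  derivable f (x + s *: u) u ->
  is_derive s 1 (fun t => f (x + t *: u)) ('D_u f (x + s *: u)).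
Proof.
move=> df.
have E : (fun h : R => h^-1 *: (((fun t => f (x + t *: u)) \o shift s) (h *: (1 : R)) -
      f (x + s *: u))) =
    (fun h => h^-1 *: ((f \o shift (x + s *: u)) (h *: u) - f (x + s *: u))).
  apply/funext => h /=; congr (_ *: (f _ - _)).
  have -> : h *: (1 : R) = h by exact: mulr1.
  by rewrite scalerDl addrCA.
by apply: DeriveDef; rewrite /derivable /derive E.
Qed.

Lemma derive_translate (W : normedModType R) (f : V -> W) (c x u : V) :
  derivable f (x + c) u ->
  is_derive x u (fun y => f (y + c)) ('D_u f (x + c)).
Proof.
move=> df.
have E : (fun h : R => h^-1 *: (((fun y => f (y + c)) \o shift x) (h *: u) - f (x + c))) =
    (fun h => h^-1 *: ((f \o shift (x + c)) (h *: u) - f (x + c))).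
  by apply/funext => h /=; rewrite addrA.
by apply: DeriveDef; rewrite /derivable /derive E.
Qed.

Lemma mvt_line (f : V -> R) (x u : V) (t : R) : 0 <= t ->
  (forall s, 0 <= s <= t -> derivable f (x + s *: u) u) ->
  exists2 s, 0 <= s <= t & f (x + t *: u) - f x = t * 'D_u f (x + s *: u).
Proof.
move=> t0 df.
have dF s : 0 <= s <= t -> is_derive s 1 (fun t => f (x + t *: u)) ('D_u f (x + s *: u)).
  by move=> /df; exact: is_derive_along_line.
have [s||s sb] := @MVT_segment R (fun t => f (x + t *: u)) (fun s => 'D_u f (x + s *: u)) 0 t t0.
- by rewrite in_itv /= => /andP[a b]; apply: dF; rewrite !ltW.
- apply: derivable_within_continuous => s; rewrite in_itv /= => sb.
  by have [] := dF s sb.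
- by move: sb; rewrite in_itv /= => sb; rewrite subr0 scale0r addr0 mulrC; exists s.
Qed.

(** The mean value theorem applied first to the increment of f in the
    direction v, as a function along u, and then to its derivative. *)
Lemma second_difference (A : set V) (f : V -> R) x u v t : 0 <= t ->
  smooth_on A f ->
  (forall a b, 0 <= a <= t -> 0 <= b <= t -> A (x + a *: u + b *: v)) ->
  exists a b, [/\ 0 <= a <= t, 0 <= b <= t &
    f (x + t *: u + t *: v) - f (x + t *: u) - f (x + t *: v) + f x
    = t * (t * 'D_v ('D_u f) (x + a *: u + b *: v))].
Proof.
move=> t0 sf At.
have tt : 0 <= t <= t by rewrite lexx t0.
have z0 : (0:R) <= 0 <= t by rewrite lexx t0.
have dA g y w : smooth_on A g -> A y -> derivable g y w.
  by move=> sg Ay; apply: diff_derivable; exact: smooth_on_diff sg Ay.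
have dF s : 0 <= s <= t -> is_derive (x + s *: u) u (fun y => f (y + t *: v) - f y)
    ('D_u f (x + s *: u + t *: v) - 'D_u f (x + s *: u)).
  move=> hs.
  have := At s 0 hs z0; rewrite scale0r addr0 => As.
  have h1 := derive_translate (dA _ _ _ u sf (At s t hs tt)).
  have h2 := derivableP (dA _ _ _ u sf As).
  exact: is_deriveB.
have [s|s hs Es] := @mvt_line (fun y => f (y + t *: v) - f y) x u t t0.
  by case/dF.
have [b|b hb Eb] := @mvt_line ('D_u f) (x + s *: u) v t t0.
  by move=> hb; apply: (dA _ _ _ _ (smooth_on_derive u sf)); exact: At.
exists s, b; split=> //; rewrite -Eb.
have [_ <-] := dF s hs; rewrite -Es !opprB !addrA.
by rewrite (addrAC _ (- f (x + t *: v)) _) addrAC.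
Qed.

Lemma dist_halves (e p q s : R) :
  `|p - s| < e / 2 -> `|q - s| < e / 2 -> `|p - q| <= e.
Proof.
move=> ps qs; apply: le_trans (ler_distD s _ _) _.
by rewrite (splitr e) lerD// ltW// distrC.
Qed.

(** Exchanging u and v in the second difference leaves it unchanged and
    expresses it by either mixed derivative at a point close to x; both
    derivatives are continuous. *)
Lemma clairaut_scalar (A : set V) (f : V -> R) x u v : open A -> smooth_on A f -> A x ->
  'D_u ('D_v f) x = 'D_v ('D_u f) x.
Proof.
move=> oA sf Ax.
apply/eqP; rewrite -subr_eq0 -normr_le0; apply/ler_addgt0Pl => e e0; rewrite addr0.
have e2 : 0 < e / 2 by rewrite divr_gt0.
have c1 := differentiable_continuous (smooth_on_diff (smooth_on_derive u (smooth_on_derive v sf)) Ax).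
have c2 := differentiable_continuous (smooth_on_diff (smooth_on_derive v (smooth_on_derive u sf)) Ax).
have : \forall y \near x, [/\ A y, `|'D_u ('D_v f) x - 'D_u ('D_v f) y| < e / 2
    & `|'D_v ('D_u f) x - 'D_v ('D_u f) y| < e / 2].
  have n1 : \forall y \near x, `|'D_u ('D_v f) x - 'D_u ('D_v f) y| < e / 2.
    exact ((cvgrPdist_lt _ _).1 c1 _ e2).
  have n2 : \forall y \near x, `|'D_v ('D_u f) x - 'D_v ('D_u f) y| < e / 2.
    exact (((cvgrPdist_lt _ _).1 c2 _ e2)).
  have n0 : \forall y \near x, A y by exact: open_nbhs_nbhs.
  by apply: filterS3 n0 n1 n2 => y.
move=> /nbhs_ballP[r /= r0 Hr].
(* the parallelogram with sides t u and t v stays in the ball of radius r *)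
pose t := r / (2 * (1 + `|u| + `|v|)).
have k0 : 0 < 1 + `|u| + `|v| by rewrite -addrA ltr_wpDr// addr_ge0.
have t0 : 0 < t by rewrite divr_gt0 ?mulr_gt0.
have Ht a b : 0 <= a <= t -> 0 <= b <= t -> ball x r (x + a *: u + b *: v).
  move=> /andP[a0 at_] /andP[b0 bt].
  rewrite -ball_normE /ball_ /= -addrA opprD addrA subrr add0r normrN.
  apply: (le_lt_trans (ler_normD _ _)); rewrite !normrZ !ger0_norm//.
  apply: (@le_lt_trans _ _ (t * (`|u| + `|v|))).
    by rewrite mulrDr lerD// ler_wpM2r.
  apply: (@lt_le_trans _ _ (t * (1 + `|u| + `|v|))); first by rewrite ltr_pM2l// -addrA ltrDr.
  rewrite /t invfM mulrA divfK ?gt_eqF// ler_pdivrMr// ler_peMr ?(ltW r0)//.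
  by rewrite ler1n.
have tn0 : t != 0 by rewrite gt_eqF.
have [a b ha hb|a [b [ha hb E1]]] := second_difference (ltW t0) sf (x := x) (u := u) (v := v).
  by have [] := Hr _ (Ht a b ha hb).
have [c d hc hd|c [d [hc hd E2]]] := second_difference (ltW t0) sf (x := x) (u := v) (v := u).
  by rewrite addrAC; have [] := Hr _ (Ht d c hd hc).
have E : 'D_v ('D_u f) (x + a *: u + b *: v) = 'D_u ('D_v f) (x + c *: v + d *: u).
  (* both sides, multiplied by t ^ 2, equal the second difference *)
  apply: (mulfI tn0); apply: (mulfI tn0); apply: (etrans (esym E1)).
  apply: (etrans _ E2); rewrite (addrAC x (t *: v)).
  congr (_ + f x); exact: addrAC.
have [_ _ h1] := Hr _ (Ht a b ha hb).
have := Ht d c hd hc; rewrite addrAC => /Hr[_ h2 _].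
rewrite E in h1.
exact: dist_halves h2 h1.
Qed.

Lemma clairaut n (A : set V) (f : V -> 'rV[R]_n) x u v : open A -> smooth_on A f -> A x ->
  'D_u ('D_v f) x = 'D_v ('D_u f) x.
Proof.
move=> oA sf Ax; apply/rowP => i.
have E w z : ('D_w ('D_z f) x) 0 i = 'D_w ('D_z (fun y => f y 0 i)) x.
  rewrite derive_rV; last by apply: smooth_on_diff (smooth_on_derive z sf) Ax.
  apply: near_eq_derive; near=> y; apply: derive_rV.
  apply: (smooth_on_diff sf); near: y; exact: open_nbhs_nbhs.
apply: etrans (E u v) _; apply: etrans _ (esym (E v u)).
exact: (clairaut_scalar u v oA ((smooth_on_rVP f oA).1 sf i) Ax).
Unshelve. all: by end_near. Qed.

End MeanValue.

Section LocalBounds.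
Context {R : realType} {n : nat}.

Lemma ler_term_sum (I : finType) (F : I -> R) i :
  (forall j, 0 <= F j) -> F i <= \sum_j F j.
Proof. by move=> F0; rewrite (bigD1 i)//= lerDl; apply: sumr_ge0. Qed.

Lemma ler_term_sum2 (I J : finType) (F : I -> J -> R) i j :
  (forall i j, 0 <= F i j) -> F i j <= \sum_i \sum_j F i j.
Proof.
move=> F0; apply: le_trans (ler_term_sum (F := F i) j _) _ => //.
by apply: (ler_term_sum (F := fun i => \sum_j F i j)) => k; apply: sumr_ge0.
Qed.

Lemma le_bound_sum (x y z w : R) : 0 <= x -> 0 <= y -> z <= w -> z + 1 <= 1 + x + y + w.
Proof. lra. Qed.

Lemma near_finall (T : topologicalType) (I : finType) (P : I -> T -> Prop) (a : T) :
  (forall i, \forall y \near a, P i y) -> \forall y \near a, forall i, P i y.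
Proof. by move=> H; apply: filter_forall. Qed.

(** The quantitative form of smoothness on a small ball that Picard iteration
    uses. One parameter e serves as the radius and, inverted, as the bound for
    all the constants, so that finitely many functions can be handled with a
    single e. *)
Definition taylor_bounds (f : 'rV[R]_n -> R) (a : 'rV[R]_n) (e : R) :=
  forall y z, `|y - a| < e -> `|z - a| < e ->
  [/\ differentiable f y, `|f y| <= e^-1,
      (forall w, `|'D_w f y| <= e^-1 * `|w|),
      `|f z - f y| <= e^-1 * `|z - y| &
      `|f z - f y - 'D_(z - y) f y| <= e^-1 * `|z - y| ^+ 2].

Lemma mvt_ball (f : 'rV[R]_n -> R) a e y z :
  (forall y, `|y - a| < e -> differentiable f y) ->
  `|y - a| < e -> `|z - a| < e ->
  exists2 w, `|w - a| < e /\ `|w - y| <= `|z - y| & f z - f y = 'D_(z - y) f w.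
Proof.
move=> df ya za.
have conv s : 0 <= s <= 1 -> `|y + s *: (z - y) - a| < e.
  move=> /andP[s0 s1].
  have -> : y + s *: (z - y) - a = (1 - s) *: (y - a) + s *: (z - a).
    by rewrite scalerBl scale1r -(addrA (y - a)) (addrC (- _)) -scalerBr opprB addrA subrK addrAC.
  apply: (le_lt_trans (ler_normD _ _)); rewrite !normrZ !ger0_norm ?subr_ge0//.
  have [->|sn0] := eqVneq s 0; first by rewrite subr0 mul1r mul0r addr0.
  have -> : e = (1 - s) * e + s * e by rewrite -mulrDl subrK mul1r.
  by apply: ler_ltD; [rewrite ler_wpM2l ?subr_ge0// ltW|rewrite ltr_pM2l// lt_neqAle eq_sym sn0].
have [s hs|s hs Es] := @mvt_line R _ f y (z - y) 1 ler01.
  by apply: diff_derivable; apply: df; exact: conv.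
exists (y + s *: (z - y)); first split; first exact: conv.
  rewrite addrC addKr normrZ; case/andP: hs => s0 s1.
  by rewrite ger0_norm// ler_piMl.
by move: Es; rewrite scale1r mul1r (addrC y) subrK.
Qed.

Lemma normr_coord (v : 'rV[R]_n) i : `|v 0 i| <= `|v|.
Proof.
rewrite [leRHS]/Num.Def.normr/= mx_normrE.
exact: (le_bigmax _ (fun i => `|v i.1 i.2|) (0, i)).
Qed.

Lemma derive_bound (f : 'rV[R]_n -> R) y w c :
  differentiable f y -> (forall i, `|'D_(delta_mx 0 i) f y| <= c) ->
  `|'D_w f y| <= n%:R * c * `|w|.
Proof.
move=> df Hc; rewrite derive_rV_sum// (le_trans (ler_norm_sum _ _ _))//.
apply: (@le_trans _ _ (\sum_(i < n) c * `|w|)); last first.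
  by rewrite sumr_const card_ord -mulrA mulr_natl.
apply: ler_sum => i _; rewrite normrM mulrC ler_pM//.
exact: normr_coord.
Qed.

(** The first and second derivatives are bounded near a by continuity, so the
    last two bounds follow from the mean value theorem; the constant only has
    to be smaller than the inverse of e, which holds for all small e. *)
Lemma taylor_bounds_near (A : set 'rV[R]_n) (f : 'rV[R]_n -> R) a :
  open A -> A a -> smooth_on A f ->
  \forall e \near 0^'+, taylor_bounds f a e.
Proof.
move=> oA Aa sf.
pose D i := 'D_(delta_mx 0 i) f.
have sD i : smooth_on A (D i) by exact: smooth_on_derive.
(* the derivatives up to order two are at most c near a, since their values
   at a are at most c - 1 *)
pose c := 1 + `|f a| + \sum_i `|D i a| + \sum_i \sum_j `|'D_(delta_mx 0 j) (D i) a|.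
have s1 : 0 <= \sum_i `|D i a| by apply: sumr_ge0.
have s2 : 0 <= \sum_i \sum_j `|'D_(delta_mx 0 j) (D i) a| by apply: sumr_ge0 => i _; apply: sumr_ge0.
have c1 : 1 <= c by rewrite /c -!addrA lerDl !addr_ge0.
have bd (g : 'rV[R]_n -> R) : smooth_on A g -> `|g a| + 1 <= c ->
    \forall y \near a, `|g y| <= c.
  move=> sg ga; have ca := differentiable_continuous (smooth_on_diff sg Aa).
  have n1 : \forall y \near a, `|g a - g y| < 1 by exact: ((cvgrPdist_lt _ _).1 ca _ ltr01).
  apply: filterS n1 => y gy; apply: le_trans ga.
  rewrite -[g y](subrK (g a)) (le_trans (ler_normD _ _))// addrC lerD2l distrC.
  exact: ltW.
have b0 : \forall y \near a, `|f y| <= c.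
  by apply: bd => //; rewrite addrC /c; lra.
have b1 : \forall y \near a, forall i, `|D i y| <= c.
  apply: (near_finall (P := fun i y => `|D i y| <= c)) => i; apply: (bd (D i)) => //.
  have h := ler_term_sum i (fun i => normr_ge0 (D i a)).
  have := normr_ge0 (f a); rewrite /c; move: h; by lra.
have b2 : \forall y \near a, forall i j, `|'D_(delta_mx 0 j) (D i) y| <= c.
  have b2' i : \forall y \near a, forall j, `|'D_(delta_mx 0 j) (D i) y| <= c; last first.
    exact: (near_finall (P := fun i y => forall j, `|'D_(delta_mx 0 j) (D i) y| <= c)) b2'.
  apply: (near_finall (P := fun j y => `|'D_(delta_mx 0 j) (D i) y| <= c)) => j; apply: (bd ('D_(delta_mx 0 j) (D i))).
    exact: smooth_on_derive.
  apply: le_bound_sum => //.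
  exact: (ler_term_sum2 (F := fun i j => `|'D_(delta_mx 0 j) (D i) a|)).
have bA : \forall y \near a, A y by exact: open_nbhs_nbhs.
have b3 : \forall y \near a, `|f y| <= c /\ forall i, `|D i y| <= c.
  by apply: filterS2 b0 b1.
have /nbhs_ballP[r /= r0 Hr] : \forall y \near a, [/\ A y, `|f y| <= c, (forall i, `|D i y| <= c) &
    (forall i j, `|'D_(delta_mx 0 j) (D i) y| <= c)].
  by apply: filterS3 bA b3 b2 => y ? [].
have {}Hr y : `|y - a| < r -> [/\ A y, `|f y| <= c, (forall i, `|D i y| <= c) &
    (forall i j, `|'D_(delta_mx 0 j) (D i) y| <= c)].
  by move=> ya; apply: Hr; rewrite -ball_normE /ball_ /= distrC.
(* the second order estimate sums over two indices, whence the factor n ^ 2 *)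
pose N := (n%:R + 1) ^+ 2 * c.
have n0 : (0:R) <= n%:R by rewrite ler0n.
have c0 : 0 <= c by exact: le_trans c1.
have N0 : 0 < N by rewrite mulr_gt0 ?exprn_gt0 ?(lt_le_trans ltr01)// lerDr.
have NcC : c <= N by rewrite ler_peMl// exprn_ege1// lerDr.
have NnC : n%:R * c <= N.
  by rewrite ler_wpM2r// expr2 (le_trans (y := n%:R + 1)) ?lerDl// ler_peMl ?lerDr// addr_ge0.
have NnnC : n%:R * (n%:R * c) <= N.
  by rewrite mulrA ler_wpM2r// expr2 ler_pM// lerDl.
near=> e.
have e0 : 0 < e by [].
have er : e <= r by near: e; exact: nbhs_right_le.
have eN : N <= e^-1.
  rewrite -[N]invrK lef_pV2 ?posrE ?invr_gt0//.
  by near: e; apply: nbhs_right_le; rewrite invr_gt0.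
move=> y z ya za.
have Hr' w : `|w - a| < e -> `|w - a| < r by move=> h; exact: lt_le_trans er.
have de w : `|w - a| < e -> differentiable f w.
  by move=> /Hr'/Hr[Aw _ _ _]; exact: smooth_on_diff sf Aw.
have dDe i w : `|w - a| < e -> differentiable (D i) w.
  by move=> /Hr'/Hr[Aw _ _ _]; exact: smooth_on_diff (sD i) Aw.
have Db w v : `|w - a| < e -> `|'D_v f w| <= n%:R * c * `|v|.
  by move=> wa; apply: derive_bound => [|i]; [exact: de|have /Hr'/Hr[_ _ h _] := wa; exact: h].
have DDb i w v : `|w - a| < e -> `|'D_v (D i) w| <= n%:R * c * `|v|.
  move=> wa; apply: derive_bound => [|j]; first exact: dDe.
  by have /Hr'/Hr[_ _ _ h] := wa; exact: h.
have [w [wa wy] Ew] := mvt_ball de ya za.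
split.
- exact: de.
- by have /Hr'/Hr[_ + _ _] := ya; move=> /le_trans; apply; exact: le_trans eN.
- by move=> v; apply: le_trans (Db _ _ ya) _; rewrite ler_wpM2r// (le_trans NnC).
- by rewrite Ew; apply: le_trans (Db _ _ wa) _; rewrite ler_wpM2r// (le_trans NnC).
- rewrite Ew (derive_rV_sum _ (de _ wa)) (derive_rV_sum _ (de _ ya)) -sumrB.
  apply: (le_trans (ler_norm_sum _ _ _)).
  apply: (@le_trans _ _ (\sum_(i < n) (n%:R * c * `|z - y|) * `|z - y|)).
    apply: ler_sum => i _; rewrite -scalerBr normrZ mulrC.
    apply: ler_pM => //; last exact: normr_coord.
    have [v [va vy] Ev] := mvt_ball (dDe i) ya wa.
    rewrite -/(D i) Ev; apply: (le_trans (DDb _ _ _ va)).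
    by rewrite ler_wpM2l// mulr_ge0.
  apply: (@le_trans _ _ (n%:R * (n%:R * c) * `|z - y| ^+ 2)).
    by rewrite sumr_const card_ord -[leLHS]mulr_natl expr2 !mulrA.
  by rewrite ler_wpM2r ?exprn_ge0// (le_trans NnnC).
Unshelve. all: by end_near. Qed.
End LocalBounds.

(** * Ordinary differential equations *)

Section Picard.
Context {R : realType}.

(** The integral is taken from -1, so that the fundamental theorem of calculus
    applies in the interior of an interval that contains [0, 1]. *)
Lemma antiderivative_scalar (g : R -> R) : continuous g ->
  exists G : R -> R, G 0 = 0 /\ forall t : R, 0 <= t <= 1 -> is_derive t 1 G (g t).
Proof.
move=> cg; pose mu := @lebesgue_measure R.
pose G0 x := (\int[mu]_(t in [set` `[-1, x]]) g t)%R.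
have ig : mu.-integrable `[-1, 2] (EFin \o g).
  apply: continuous_compact_integrable; first exact: segment_compact.
  exact: continuous_subspaceT.
exists (fun x => G0 x - G0 0); split => [|t /andP[t0 t1]]; first by rewrite subrr.
have [|||d e] := @continuous_FTC1_closed R g (-1) t 2 _ ig.
- by rewrite (le_lt_trans t1)// ltr1n.
- by rewrite (lt_le_trans _ t0)// oppr_lt0.
- exact: cg.
have -> : g t = g t - 0 by rewrite subr0.
apply: (@is_deriveB _ _ _ G0 (cst (G0 0))).
by apply: (DeriveDef d); rewrite -derive1E; exact: e.
Qed.

Lemma is_derive_rVP (V : normedModType R) n (G : V -> 'rV[R]_n) t v (g : 'rV[R]_n) :
  (forall i, is_derive t v (fun s => G s 0 i) (g 0 i)) <-> is_derive t v G g.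
Proof.
split=> [H|[H <-] i]; last first.
  have Hi := (derivable_mxP G t v).1 H 0 i.
  apply: DeriveDef => //.
  by rewrite derive_mx// mxE.
have dG : derivable G t v.
  by apply/derivable_mxP => j i; rewrite ord1; have [] := H i.
apply: DeriveDef => //; apply/rowP => i; rewrite derive_mx// mxE.
by have [_ ->] := H i.
Qed.

Lemma antiderivative n (g : R -> 'rV[R]_n) : continuous g ->
  exists G : R -> 'rV[R]_n, G 0 = 0 /\ forall t : R, 0 <= t <= 1 -> is_derive t 1 G (g t).
Proof.
move=> cg.
have /choice[G HG] : forall i, exists G : R -> R, G 0 = 0 /\
    forall t : R, 0 <= t <= 1 -> is_derive t 1 G (g t 0 i).
  move=> i; apply: (@antiderivative_scalar (fun t => g t 0 i)) => t.
  apply: (@continuous_comp _ _ _ g (fun v : 'rV[R]_n => v 0 i)); first exact: cg.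
  exact: coord_continuous.
exists (fun t => \row_i G i t); split=> [|t ht].
  by apply/rowP => i; rewrite !mxE; have [] := HG i.
apply/is_derive_rVP => i; under eq_fun do rewrite mxE.
by have [_] := HG i; exact.
Qed.

Lemma normr_rV_le n (v : 'rV[R]_n) c : 0 <= c -> (forall i, `|v 0 i| <= c) -> `|v| <= c.
Proof.
move=> c0 H; rewrite [leLHS]/Num.Def.normr/= mx_normrE.
by apply: bigmax_le => // -[i j] _ /=; rewrite ord1.
Qed.

(** The norm on row vectors is the maximum norm, so the scalar mean value
    theorem can be applied to each component. *)
Lemma mvt_bound n (G g : R -> 'rV[R]_n) M : 
  (forall t : R, 0 <= t <= 1 -> is_derive t 1 G (g t)) ->
  (forall t : R, 0 <= t <= 1 -> `|g t| <= M) ->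
  forall s t : R, 0 <= s <= 1 -> 0 <= t <= 1 -> `|G t - G s| <= M * `|t - s|.
Proof.
move=> dG gM s t.
have M0 : 0 <= M by apply: le_trans (normr_ge0 _) (gM 0 _); rewrite lexx ler01.
wlog : s t / s <= t => [H hs ht|st /andP[s0 s1] /andP[t0 t1]].
  by case: (leP s t) => [|/ltW] st; [|rewrite distrC (distrC t)]; apply: H.
apply: normr_rV_le => [|i]; first by rewrite mulr_ge0.
have dGi (r : R) : 0 <= r <= 1 -> is_derive r 1 (fun r => G r 0 i) (g r 0 i).
  by move=> hr; move/is_derive_rVP : (dG r hr); exact.
have hr (r : R) : 0 <= r <= t - s -> 0 <= s + r *: (1 : R) <= 1.
  move=> /andP[r0 rt]; have -> : r *: (1 : R) = r by exact: mulr1.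
  by apply/andP; split; [exact: addr_ge0|lra].
have [||r h] := @mvt_line R _ (fun r => G r 0 i) s 1 (t - s).
- by rewrite subr_ge0.
- by move=> r h; have [] := dGi _ (hr r h).
have -> : (t - s) *: (1 : R) = t - s by exact: mulr1.
rewrite (addrC s) subrK !mxE => ->; rewrite normrM mulrC.
have [_ ->] := dGi _ (hr r h).
by rewrite ler_wpM2r// (le_trans (normr_coord _ _))// gM// hr.
Qed.

(** The intervals of radius 2 C / 2 ^ j around u j are nested; the limit is
    the supremum of their left ends. *)
Lemma geometric_cauchy_scalar (u : nat -> R) C : 
  (forall j, `|u j.+1 - u j| <= C * 2^-1 ^+ j) ->
  exists l, forall j, `|l - u j| <= 2 * C * 2^-1 ^+ j.
Proof.
move=> Hu.
pose d j : R := 2 * C * 2^-1 ^+ j.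
have dS j : d j.+1 = d j - C * 2^-1 ^+ j by rewrite /d exprS; field.
have d0 j : 0 <= d j.
  by have := le_trans (normr_ge0 _) (Hu j); rewrite /d -mulrA => h; lra.
have aS j : u j - d j <= u j.+1 - d j.+1.
  by have := Hu j; rewrite ler_distl dS => /andP[]; lra.
have bS j : u j.+1 + d j.+1 <= u j + d j.
  by have := Hu j; rewrite ler_distl dS => /andP[]; lra.
have aM : {homo (fun j => u j - d j) : i j / (i <= j)%N >-> i <= j}.
  by apply: homo_leq => // y x z; exact: le_trans.
have bM : {homo (fun j => u j + d j) : i j / (i <= j)%N >-> j <= i}.
  by apply: homo_leq => // y x z /[swap]; exact: le_trans.
have ab i j : u i - d i <= u j + d j.
  apply: le_trans (aM _ _ (leq_maxl i j)) _.
  apply: le_trans _ (bM _ _ (leq_maxr i j)); have := d0 (maxn i j); lra.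
pose S := [set u j - d j | j in [set: nat]].
have S0 : S !=set0 by exists (u 0 - d 0), 0.
have hS : has_sup S by split => //; exists (u 0 + d 0) => _ [j _ <-]; exact: ab.
exists (sup S) => j; rewrite ler_distl; apply/andP; split.
  by apply: ub_le_sup; [case: hS|exists j].
by apply: ge_sup => // _ [i _ <-]; exact: ab.
Qed.

Lemma geometric_cauchy n (u : nat -> 'rV[R]_n) C : 0 <= C ->
  (forall j, `|u j.+1 - u j| <= C * 2^-1 ^+ j) ->
  exists l, forall j, `|l - u j| <= 2 * C * 2^-1 ^+ j.
Proof.
move=> C0 Hu.
have /choice[l Hl] : forall i, exists l, forall j, `|l - u j 0 i| <= 2 * C * 2^-1 ^+ j.
  move=> i; apply: geometric_cauchy_scalar => j.
  by apply: le_trans (Hu j); have := normr_coord (u j.+1 - u j) i; rewrite !mxE.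
exists (\row_i l i) => j; apply: normr_rV_le => [|i]; last by rewrite !mxE.
by rewrite !mulr_ge0// exprn_ge0.
Qed.

Lemma le_geometric (x y C : R) : (forall j : nat, x <= y + C * 2^-1 ^+ j) -> x <= y.
Proof.
move=> H; apply/ler_addgt0Pl => e e0.
have z1 : `|2^-1 : R| < 1 by rewrite ger0_norm ?invr_ge0// invf_lt1 ?ltr1n.
have [j _ Hj] : \forall j \near \oo, `|0 - geometric C (2^-1 : R) j| < e.
  by have /cvgrPdist_lt := cvg_geometric C z1; exact.
apply: le_trans (H j) _; rewrite [e + y]addrC lerD2l.
have := Hj j (leqnn j); rewrite sub0r normrN /geometric /= => h.
by apply: le_trans (ler_norm _) (ltW h).
Qed.

(** Composing with this retraction turns functions that matter on [0, 1] only
    into functions on the line, for which continuity needs no restriction. *)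
Definition clamp01 (t : R) := Num.max 0 (Num.min 1 t).

Lemma clamp01_in t : 0 <= clamp01 t <= 1.
Proof. by rewrite /clamp01 le_max lexx ge_max ler01 ge_min lexx. Qed.

Lemma clamp01_id t : 0 <= t <= 1 -> clamp01 t = t.
Proof. by move=> /andP[t0 t1]; rewrite /clamp01 min_r// max_r. Qed.

Lemma clamp01_dist s t : `|clamp01 t - clamp01 s| <= `|t - s|.
Proof.
have n1 := ler_norm (t - s); have n2 := ler_norm (s - t); rewrite distrC in n2.
move: n1 n2; move: `|t - s| => N n1 n2; rewrite /clamp01 ler_norml.
by case: (leP 1 t) => h1; case: (leP 1 s) => h2; rewrite ?(max_r ler01);
  case: (leP 0 t) => h3; case: (leP 0 s) => h4; apply/andP; split; lra.
Qed.

Lemma lipschitz_continuous (V W : normedModType R) (g : V -> W) c :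
  (forall s t, `|g t - g s| <= c * `|t - s|) -> continuous g.
Proof.
move=> Hg t; apply/cvgrPdist_lt => e e0.
have c0 : 0 < `|c| + 1 by rewrite ltr_wpDl.
near=> s; apply: le_lt_trans (Hg s t) _.
apply: (@le_lt_trans _ _ ((`|c| + 1) * `|t - s|)).
  by rewrite ler_wpM2r// (le_trans (ler_norm c))// lerDl.
rewrite mulrC -ltr_pdivlMr//; near: s.
by apply: cvgr_dist_lt => //; rewrite divr_gt0.
Unshelve. all: by end_near. Qed.

(** Picard iteration: the contraction factor is 1/2 because the time interval
    has length one and F is Lipschitz with constant 1/2. The bound mu < e
    keeps the iterates in the ball where F is controlled. *)
Lemma ode_solution n (F : 'rV[R]_n -> 'rV[R]_n) a e mu : 0 < e -> mu < e ->
  (forall y, `|y - a| < e -> `|F y| <= mu) ->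
  (forall y z, `|y - a| < e -> `|z - a| < e -> `|F z - F y| <= 2^-1 * `|z - y|) ->
  exists Y : R -> 'rV[R]_n, Y 0 = a /\ forall t : R, 0 <= t <= 1 ->
    `|Y t - a| < e /\ is_derive t 1 Y (F (Y t)).
Proof.
move=> e0 mue Fmu FL.
have mu0 : 0 <= mu by apply: le_trans (normr_ge0 _) (Fmu a _); rewrite subrr normr0.
have i01 : 0 <= (0 : R) <= 1 by rewrite lexx ler01.
pose T (g : R -> 'rV[R]_n) : R -> 'rV[R]_n := xget (fun=> 0) [set G | G 0 = 0 /\
   forall t : R, 0 <= t <= 1 -> is_derive t 1 G (g t)].
have TP g : continuous g -> T g 0 = 0 /\
    forall t : R, 0 <= t <= 1 -> is_derive t 1 (T g) (g t).
  by move=> /antiderivative GP; have := xgetPex (fun=> 0) GP.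
pose S (y : R -> 'rV[R]_n) t := a + T (fun s => F (y s)) (clamp01 t).
pose good (y : R -> 'rV[R]_n) := (forall t, `|y t - a| <= mu) /\
  (forall s t, `|y t - y s| <= mu * `|t - s|).
have gin y t : good y -> `|y t - a| < e by move=> [h _]; exact: le_lt_trans (h t) mue.
have gc y : good y -> continuous (fun s => F (y s)).
  move=> gy; apply: (@lipschitz_continuous _ _ _ (2^-1 * mu)) => s t.
  apply: le_trans (FL _ _ (gin _ _ gy) (gin _ _ gy)) _.
  by rewrite -mulrA ler_wpM2l ?invr_ge0//; have [_] := gy; exact.
have gS y : good y -> good (S y).
  move=> gy; have [T0 Td] := TP _ (gc _ gy).
  have TL := mvt_bound Td (fun t _ => Fmu _ (gin _ t gy)).
  split=> [t|s t]; rewrite /S.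
    rewrite addrC addKr -[T _ _]subr0 -[X in _ - X]T0.
    apply: le_trans (TL _ _ i01 (clamp01_in t)) _; rewrite subr0.
    by have /andP[c0 c1] := clamp01_in t; rewrite ger0_norm// ler_piMr.
  rewrite opprD addrACA subrr add0r.
  apply: le_trans (TL _ _ (clamp01_in s) (clamp01_in t)) _.
  by rewrite ler_wpM2l// clamp01_dist.
have SL y z D : good y -> good z -> (forall t, `|y t - z t| <= D) ->
    forall t, `|S y t - S z t| <= 2^-1 * D.
  move=> gy gz yz t; have [Ty0 Tyd] := TP _ (gc _ gy); have [Tz0 Tzd] := TP _ (gc _ gz).
  have D0 : 0 <= D by exact: le_trans (yz 0).
  rewrite /S opprD addrACA subrr add0r.
  pose G := T (fun s => F (y s)) - T (fun s => F (z s)).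
  have G0 : G 0 = 0 by rewrite /G !fctE Ty0 Tz0 subrr.
  have dG r : 0 <= r <= 1 -> is_derive (r : R) 1 G (F (y r) - F (z r)).
    by move=> hr; apply: is_deriveB; [exact: Tyd|exact: Tzd].
  have bG r : 0 <= r <= 1 -> `|F (y r) - F (z r)| <= 2^-1 * D.
    move=> _; apply: le_trans (FL _ _ (gin _ _ gz) (gin _ _ gy)) _.
    by rewrite ler_wpM2l ?invr_ge0.
  have := mvt_bound dG bG i01 (clamp01_in t); rewrite G0 !subr0 => h.
  apply: le_trans h _; have /andP[c0 c1] := clamp01_in t; rewrite ger0_norm//.
  by rewrite ler_piMr// mulr_ge0// invr_ge0.
pose Y j := iter j S (fun=> a).
have gY j : good (Y j).
  elim: j => [|j IH]; last exact: gS.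
  by split=> [t|s t]; rewrite /Y /= subrr normr0// mulr_ge0.
have dY j t : `|Y j.+1 t - Y j t| <= mu * 2^-1 ^+ j.
  elim: j t => [|j IH] t; first by rewrite expr0 mulr1; have [h _] := gY 1%N; exact: h.
  rewrite exprS mulrCA; exact: (SL (Y j.+1) (Y j)).
have /choice[Z ZP] : forall t, exists l, forall j, `|l - Y j t| <= 2 * mu * 2^-1 ^+ j.
  by move=> t; apply: geometric_cauchy.
have gZ : good Z.
  split=> [t|s t].
    apply: (@le_geometric _ _ (2 * mu)) => j.
    apply: le_trans (ler_distD (Y j t) _ _) _; rewrite addrC lerD//.
    by have [h _] := gY j; exact: h.
  apply: (@le_geometric _ _ (4 * mu)) => j.
  have h1 := ZP t j; have h2 := ZP s j; have [_ /(_ s t) h3] := gY j.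
  have := ler_distD (Y j t) (Z t) (Z s); have := ler_distD (Y j s) (Y j t) (Z s).
  rewrite (distrC (Y j s)) => h4 h5.
  by move: h1 h2 h3 h4 h5; move: (_ ^+ j) => q; lra.
have [T0 Td] := TP _ (gc _ gZ).
have ZE (t : R) : 0 <= t <= 1 -> Z t = a + T (fun s => F (Z s)) t.
  move=> ht; rewrite -[t in RHS]clamp01_id// -/(S Z t).
  apply/eqP; rewrite -subr_eq0 -normr_le0.
  apply: (@le_geometric _ _ (2 * mu)) => j; rewrite add0r.
  apply: le_trans (ler_distD (Y j.+1 t) _ _) _.
  have h1 := ZP t j.+1.
  have h2 := SL _ _ _ (gY j) gZ (fun t => eq_ind_r (fun x => x <= _) (ZP t j) (distrC _ _)) t.
  by move: h1 h2; rewrite /= exprS -/(Y j.+1); move: (_ ^+ j) => q; lra.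
exists (fun t => a + T (fun s => F (Z s)) t); split=> [|t ht]; first by rewrite T0 addr0.
rewrite -ZE//; split; first exact: gin.
rewrite -[F (Z t)]add0r.
by apply: (@is_deriveD _ _ _ (cst a)); exact: Td.
Qed.
End Picard.

(** * Total differential equations *)

Section Total.
Context {R : realType}.

Lemma normr_mulmx_le k n (x : 'rV[R]_k) (M : 'M[R]_(k, n)) m : 0 <= m ->
  (forall i j, `|M i j| <= m) -> `|x *m M| <= k%:R * m * `|x|.
Proof.
move=> m0 HM; apply: normr_rV_le => [|j]; first by rewrite !mulr_ge0.
rewrite mxE; apply: (le_trans (ler_norm_sum _ _ _)).
apply: (@le_trans _ _ (\sum_(i < k) m * `|x|)); last first.
  by rewrite sumr_const card_ord -[leLHS]mulr_natl mulrA.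
by apply: ler_sum => i _; rewrite normrM mulrC ler_pM// normr_coord.
Qed.

(** A remainder of second order is in particular of order smaller than one. *)
Lemma differentiable_quadratic_remainder (V W : normedModType R) (f : V -> W)
    (L : {linear V -> W}) (x : V) (C r : R) : continuous L ->
  0 < r -> (forall h, `|h| < r -> `|f (x + h) - f x - L h| <= C * `|h| ^+ 2) ->
  differentiable f x /\ forall v, 'D_v f x = L v.
Proof.
move=> cL r0 H.
have dg : f \o shift x = cst (f x) + L +o_ 0 id.
  apply/eqaddoP => e e0; near=> h.
  have hr : `|h| < r by near: h; exact: nbhs0_lt.
  have C0 : 0 < `|C| + 1 by rewrite ltr_wpDl.
  have he : `|h| * (`|C| + 1) <= e.
    by rewrite -ler_pdivlMr//; near: h; apply: nbhs0_le; rewrite divr_gt0.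
  rewrite /= !fctE /= [h + x]addrC opprD addrA.
  apply: le_trans (H h hr) _; rewrite expr2 mulrA ler_wpM2r//.
  apply: le_trans he; rewrite mulrC ler_wpM2l//.
  by rewrite (le_trans (ler_norm C))// lerDl.
have ddE := diff_unique cL dg.
have df : differentiable f x by apply/diff_locallyP; rewrite ddE.
by split=> // v; rewrite deriveE// ddE.
Unshelve. all: by end_near. Qed.

Lemma mulmx_continuous k n (M : 'M[R]_(k, n)) : continuous (fun v : 'rV[R]_k => v *m M).
Proof.
apply: (@lipschitz_continuous _ _ _ _ (k%:R * \sum_i \sum_j `|M i j|)) => s t.
rewrite -mulmxBl; apply: normr_mulmx_le => [|i j].
  by apply: sumr_ge0 => i _; apply: sumr_ge0.
exact: (ler_term_sum2 (F := fun i j => `|M i j|)).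
Qed.

(** Gronwall's inequality on [0, 1] for the growth rate 1/2. Inserting the
    bound 2 b + M / 2 ^ j for G into its differential inequality and
    integrating improves j by one, so no exponential is needed. *)
Lemma gronwall_half n (G g : R -> 'rV[R]_n) M b : 
  (forall t : R, 0 <= t <= 1 -> is_derive t 1 G (g t)) -> G 0 = 0 ->
  (forall t : R, 0 <= t <= 1 -> `|g t| <= 2^-1 * `|G t| + b) ->
  (forall t : R, 0 <= t <= 1 -> `|G t| <= M) ->
  forall t : R, 0 <= t <= 1 -> `|G t| <= 2 * b.
Proof.
move=> dG G0 gb GM t ht; apply: (@le_geometric _ _ _ M) => j.
have i01 : 0 <= (0 : R) <= 1 by rewrite lexx ler01.
have b0 : 0 <= b by have := gb 0 i01; rewrite G0 normr0 mulr0 add0r; exact: le_trans.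
elim: j t ht => [|j IH] t ht; first by rewrite expr0 mulr1 (le_trans (GM t ht))// lerDr mulr_ge0.
have := mvt_bound dG (M := 2 * b + M * 2^-1 ^+ j.+1) _ i01 ht; rewrite G0 !subr0 => h.
apply: le_trans (h _) _ => [s hs|].
  by apply: le_trans (gb s hs) _; have := IH s hs; rewrite exprS; move: (_ ^+ j) => q; lra.
case/andP: ht => t0 t1; rewrite ger0_norm// ler_piMr//.
rewrite addr_ge0 ?mulr_ge0 ?exprn_ge0 ?invr_ge0//.
exact: le_trans (GM 0 i01).
Qed.

Lemma is_derive_mulmx_comp k n (B : 'rV[R]_n -> 'M[R]_(k, n)) (Y : R -> 'rV[R]_n)
    (t : R) dY (h : 'rV[R]_k) :
  is_derive t 1 Y dY -> (forall i j, differentiable (fun y => B y i j) (Y t)) ->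
  is_derive t 1 (fun s => h *m B (Y s))
    (h *m \matrix_(i, j) 'D_dY (fun y => B y i j) (Y t)).
Proof.
move=> [dYt YE] dB; apply/is_derive_rVP => j; rewrite mxE.
have dYd : differentiable Y t by apply/derivable1_diffP.
under eq_fun do rewrite mxE.
have -> : (fun s => \sum_j0 h 0 j0 * B (Y s) j0 j) =
    \sum_i (fun s => h 0 i *: B (Y s) i j) by apply/funext => s; rewrite fct_sumE.
apply: is_derive_eq.
  apply: is_derive_sum => i.
  have d : differentiable ((fun y => B y i j) \o Y) t by exact: differentiable_comp.
  apply: (@is_deriveZ _ _ _ ((fun y => B y i j) \o Y)).
  exact: derivableP (diff_derivable d).
apply: eq_bigr => i _; rewrite mxE derive_comp//.
by rewrite YE.
Qed.

Lemma is_derive_scale n (V : R -> 'rV[R]_n) (t : R) (dV : 'rV[R]_n) : is_derive t 1 V dV ->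
  is_derive t 1 (fun s => s *: V s) (t *: dV + V t).
Proof.
move=> /is_derive_rVP dVi; apply/is_derive_rVP => i.
under eq_fun do rewrite mxE.
have H := @is_deriveM R R id (fun s => V s 0 i) t 1 1 (dV 0 i) (is_derive_id _ _) (dVi i).
by apply: (@is_derive_eq _ _ _ _ _ _ _ _ H); rewrite !mxE; congr (_ + _); exact: mulr1.
Qed.

Lemma uniform_taylor_bounds k n (U : set 'rV[R]_n) (B : 'rV[R]_n -> 'M[R]_(k, n)) a :
  open U -> U a -> (forall i j, smooth_on U (fun y => B y i j)) ->
  exists e, [/\ 0 < e, forall y, `|y - a| < e -> U y &
    forall i j, taylor_bounds (fun y => B y i j) a e].
Proof.
move=> oU Ua sB.
have /nbhs_ballP[r /= r0 Hr] : nbhs a U by exact: open_nbhs_nbhs.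
have tb : \forall e \near 0^'+, forall ij : 'I_k * 'I_n,
    taylor_bounds (fun y => B y ij.1 ij.2) a e.
  by apply: filter_forall => ij; apply: taylor_bounds_near (sB _ _).
near ((0 : R)^'+) => e; exists e; split => // [y ya|i j].
  apply: Hr; rewrite -ball_normE /ball_ /= distrC.
  by apply: lt_le_trans ya _; near: e; exact: nbhs_right_le.
exact: (near tb e _ (i, j)).
Unshelve. all: by end_near. Qed.

(** The system D Phi x v = v B (Phi x). Along the ray through x it becomes the
    ordinary differential equation Y' = x B (Y), and Phi x is the value of its
    solution at time one. To see that Phi solves the system in all directions,
    consider u t = Y_(x + h) t - Y_x t - t h B (Y_x t). The commutation
    hypothesis exchanges the roles of x and h in the derivative of B, after
    which u satisfies a linear differential inequality whose inhomogeneous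
    part is quadratic in h; by Gronwall u 1 is quadratic in h. *)
Lemma total_differential_equation k n (U : set 'rV[R]_n)
    (B : 'rV[R]_n -> 'M[R]_(k, n)) a : open U -> U a ->
  (forall i j, smooth_on U (fun y => B y i j)) ->
  (forall y (v w : 'rV[R]_k), U y ->
    v *m \matrix_(i, j) 'D_(w *m B y) (fun z => B z i j) y =
    w *m \matrix_(i, j) 'D_(v *m B y) (fun z => B z i j) y) ->
  exists (d : R) (Phi : 'rV[R]_k -> 'rV[R]_n), [/\ 0 < d, Phi 0 = a &
    forall x, `|x| < d -> [/\ U (Phi x), differentiable Phi x &
      forall v, 'D_v Phi x = v *m B (Phi x)]].
Proof.
move=> oU Ua sB comm.
have [e [e0 eU tb]] := uniform_taylor_bounds oU Ua sB.
pose dB y w := \matrix_(i, j) 'D_w (fun z => B z i j) y.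
pose c := k%:R * e^-1 + 1.
have ei0 : 0 <= e^-1 by rewrite invr_ge0 ltW.
have c0 : 0 < c by rewrite ltr_wpDl// mulr_ge0.
have kc : k%:R * e^-1 <= c by rewrite lerDl.
have mulb (x : 'rV[R]_k) (M : 'M[R]_(k, n)) m : 0 <= m ->
    (forall i j, `|M i j| <= e^-1 * m) -> `|x *m M| <= c * `|x| * m.
  move=> m0 HM; apply: le_trans (normr_mulmx_le x _ HM) _; first by rewrite mulr_ge0.
  by rewrite mulrA mulrAC ler_wpM2r// ler_wpM2r.
have b1 y (x : 'rV[R]_k) : `|y - a| < e -> `|x *m B y| <= c * `|x|.
  move=> ya; rewrite -[leRHS]mulr1; apply: mulb => // i j.
  by rewrite mulr1; have [_ h _ _ _] := tb i j _ _ ya ya.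
have b2 y z (x : 'rV[R]_k) : `|y - a| < e -> `|z - a| < e ->
    `|x *m (B z - B y)| <= c * `|x| * `|z - y|.
  move=> ya za; apply: mulb => // i j.
  by rewrite !mxE; have [_ _ _ h _] := tb i j _ _ ya za.
have b3 y w (x : 'rV[R]_k) : `|y - a| < e -> `|x *m dB y w| <= c * `|x| * `|w|.
  move=> ya; apply: mulb => // i j.
  by rewrite mxE; have [_ _ h _ _] := tb i j _ _ ya ya; exact: h.
have b4 y z (x : 'rV[R]_k) : `|y - a| < e -> `|z - a| < e ->
    `|x *m (B z - B y - dB y (z - y))| <= c * `|x| * `|z - y| ^+ 2.
  move=> ya za; apply: mulb => [|i j]; first exact: exprn_ge0.
  by rewrite !mxE; have [_ _ _ _ h] := tb i j _ _ ya za.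
have dif y i j : `|y - a| < e -> differentiable (fun z => B z i j) y.
  by move=> ya; have [] := tb i j _ _ ya ya.
(* for such x the field x B maps into the ball of radius e and is Lipschitz
   with constant 1/2, as ode_solution requires *)
pose d := Num.min (e / c) (2^-1 / c).
have d0 : 0 < d by rewrite lt_min !divr_gt0.
have de (x : 'rV[R]_k) : `|x| < d -> c * `|x| < e.
  by rewrite lt_min => /andP[+ _]; rewrite ltr_pdivlMr// mulrC.
have d2 (x : 'rV[R]_k) : `|x| < d -> c * `|x| <= 2^-1.
  by rewrite lt_min => /andP[_ +]; rewrite ltr_pdivlMr// mulrC => /ltW.
have /choice[Y YP] : forall x : 'rV[R]_k, exists Y : R -> 'rV[R]_n, `|x| < d ->
    Y 0 = a /\ forall t : R, 0 <= t <= 1 ->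
      `|Y t - a| < e /\ is_derive t 1 Y (x *m B (Y t)).
  move=> x; have [xd|xd] := ltP `|x| d; last by exists (fun=> a).
  have [|y z ya za|Y HY] := @ode_solution R n (fun y => x *m B y) a e (c * `|x|) e0 (de x xd).
  - by move=> y ya; exact: b1.
  - rewrite -mulmxBr; apply: le_trans (b2 _ _ x ya za) _.
    by rewrite ler_wpM2r// d2.
  - by exists Y.
exists d, (fun x => Y x 1).
have i1 : 0 <= (1 : R) <= 1 by rewrite lexx ler01.
have i0 : 0 <= (0 : R) <= 1 by rewrite lexx ler01.
split => //.
  have [Y0 Yd] := YP 0 (eq_ind_r (fun z => z < d) d0 (normr0 _)).
  apply/eqP; rewrite -subr_eq0 -normr_le0 -[X in _ - X]Y0.
  have := @mvt_bound R n (Y 0) (fun t => 0 *m B (Y 0 t)) 0 _ _ _ _ i0 i1.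
  rewrite mul0r; apply=> t ht; first by have [] := Yd t ht.
  by rewrite mul0mx normr0.
move=> x xd; have [Y0 Yd] := YP x xd.
have UY : U (Y x 1) by apply: eU; have [] := Yd 1 i1.
suff [df De] : differentiable (fun x => Y x 1) x /\
    forall v, 'D_v (fun x => Y x 1) x = v *m B (Y x 1) by split.
have rem := @differentiable_quadratic_remainder _ _ (fun x => Y x 1)
  (mulmxr (B (Y x 1))) x (8 * c ^+ 2) (d - `|x|).
(* the factor 8 arises as twice the sum of the two quadratic terms h4 and h5
   below *)
suff est h : `|h| < d - `|x| ->
    `|Y (x + h) 1 - Y x 1 - h *m B (Y x 1)| <= 8 * c ^+ 2 * `|h| ^+ 2.
  have dx : 0 < d - `|x| by rewrite subr_gt0.
  by have [df De] := rem (@mulmx_continuous _ _ _) dx est.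
move=> hd.
have xhd : `|x + h| < d by rewrite (le_lt_trans (ler_normD _ _))// -ltrBrDl.
have [Z0 Zd] := YP _ xhd.
(* a first Gronwall estimate bounds D linearly in h *)
pose D t := Y (x + h) t - Y x t.
have D0 : D 0 = 0 by rewrite /D Z0 Y0 subrr.
have Yin t : 0 <= t <= 1 -> `|Y x t - a| < e by move=> /Yd[].
have Zin t : 0 <= t <= 1 -> `|Y (x + h) t - a| < e by move=> /Zd[].
pose D' t := (x + h) *m B (Y (x + h) t) - x *m B (Y x t).
have dD t : 0 <= t <= 1 -> is_derive (t : R) 1 D (D' t).
  by move=> ht; apply: is_deriveB; [have [] := Zd t ht|have [] := Yd t ht].
have DE t : D' t = h *m B (Y (x + h) t) + x *m (B (Y (x + h) t) - B (Y x t)).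
  by rewrite /D' mulmxDl mulmxBr addrA (addrC (x *m _)).
have ch0 : 0 <= c * `|h| by rewrite mulr_ge0// ltW.
have bD t : 0 <= t <= 1 -> `|D t| <= 2 * (c * `|h|).
  apply: (gronwall_half dD D0 (M := 2 * e)) => {}t ht.
    rewrite DE addrC; apply: le_trans (ler_normD _ _) _; apply: lerD.
      apply: le_trans (b2 _ _ _ (Yin t ht) (Zin t ht)) _.
      by rewrite ler_wpM2r// d2.
    by apply: b1; exact: Zin.
  rewrite /D (le_trans (ler_distD a _ _))// (distrC a) mulr_natl mulr2n.
  by rewrite lerD// ltW// ?Yin ?Zin.
pose u t := D t - t *: (h *m B (Y x t)).
pose u' t := D' t - (t *: (h *m dB (Y x t) (x *m B (Y x t))) + h *m B (Y x t)).
have du t : 0 <= t <= 1 -> is_derive (t : R) 1 u (u' t).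
  move=> ht; apply: is_deriveB; first exact: dD.
  have hB : is_derive (t : R) 1 (fun s => h *m B (Y x s)) (h *m dB (Y x t) (x *m B (Y x t))).
    apply: is_derive_mulmx_comp; first by have [] := Yd t ht.
    by move=> i j; apply: dif; exact: Yin.
  exact: is_derive_scale.
have u0 : u 0 = 0 by rewrite /u D0 scale0r subrr.
have dBlin y w1 w2 s : `|y - a| < e -> dB y (w1 - s *: w2) = dB y w1 - s *: dB y w2.
  move=> ya; have -> : w1 - s *: w2 = (- s) *: w2 + w1 by rewrite addrC scaleNr.
  apply/matrixP => i j; rewrite !mxE derive_linear; last exact: dif.
  by rewrite [LHS]addrC scaleNr.
have uE t : 0 <= t <= 1 -> u' t = x *m dB (Y x t) (u t)
    + (h *m (B (Y (x + h) t) - B (Y x t))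
       + x *m (B (Y (x + h) t) - B (Y x t) - dB (Y x t) (D t))).
  move=> ht; rewrite /u' DE /u dBlin; last exact: Yin.
  have -> : h *m dB (Y x t) (x *m B (Y x t)) = x *m dB (Y x t) (h *m B (Y x t)).
    (* the commutation hypothesis exchanges x and h *)
    by apply: comm; apply: eU; exact: Yin.
  rewrite !mulmxBr -!scalemxAr.
  move: (x *m B (Y x t)) (x *m B _) (h *m B (Y x t)) (h *m B _) (x *m dB _ (D t)) (t *: _).
  by move=> p1 p2 p3 p4 p5 p6; apply/rowP => j; rewrite !mxE; ring.
have -> : Y (x + h) 1 - Y x 1 - h *m B (Y x 1) = u 1 by rewrite /u /D scale1r.
have -> : 8 * c ^+ 2 * `|h| ^+ 2 = 2 * (4 * c ^+ 2 * `|h| ^+ 2) by ring.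
apply: (gronwall_half du u0 (M := 2 * (c * `|h|) + c * `|h|)) => // t ht; last first.
  rewrite (le_trans (ler_normB _ _))// lerD ?bD// normrZ.
  have /andP[t0 t1] := ht; rewrite ger0_norm//.
  apply: le_trans (ler_piMl (normr_ge0 _) t1) _.
  by apply: b1; exact: Yin.
rewrite uE//; apply: le_trans (ler_normD _ _) _; apply: lerD.
  by apply: le_trans (b3 _ _ _ (Yin t ht)) _; rewrite ler_wpM2r// d2.
apply: le_trans (ler_normD _ _) _.
have h1 := b2 _ _ h (Yin t ht) (Zin t ht).
have h2 := b4 _ _ x (Yin t ht) (Zin t ht).
have h3 := bD t ht.
have h4 : c * `|h| * `|D t| <= 2 * c ^+ 2 * `|h| ^+ 2.
  apply: (@le_trans _ _ (c * `|h| * (2 * (c * `|h|)))); first by rewrite ler_wpM2l.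
  by rewrite le_eqVlt; apply/orP; left; apply/eqP; ring.
have h5 : c * `|x| * `|D t| ^+ 2 <= 2 * c ^+ 2 * `|h| ^+ 2.
  apply: (@le_trans _ _ (2^-1 * (2 * (c * `|h|)) ^+ 2)).
    have cx0 : 0 <= c * `|x| by rewrite mulr_ge0// ltW.
    apply: ler_pM => //; first exact: d2.
    by rewrite lerXn2r ?nnegrE ?mulr_ge0 ?(ltW c0)// ltW.
  by rewrite le_eqVlt; apply/orP; left; apply/eqP; field.
apply: le_trans (lerD (le_trans h1 h4) (le_trans h2 h5)) _.
by rewrite le_eqVlt; apply/orP; left; apply/eqP; ring.
Qed.
End Total.

(** * The Frobenius theorem in coordinates *)

Section MatrixDerivative.
Context {R : realType} {n : nat}.

(** The derivative is taken entrywise, so that only the entries have to be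
    differentiable. *)
Definition mxderiv p q (E : 'rV[R]_n -> 'M[R]_(p, q)) (y u : 'rV[R]_n) : 'M[R]_(p, q) :=
  \matrix_(i, j) 'D_u (fun z => E z i j) y.

Lemma mxderiv_mul p q r (E : 'rV[R]_n -> 'M[R]_(p, q)) (F : 'rV[R]_n -> 'M[R]_(q, r)) y u :
  (forall i j, differentiable (fun z => E z i j) y) ->
  (forall i j, differentiable (fun z => F z i j) y) ->
  mxderiv (fun z => E z *m F z) y u = mxderiv E y u *m F y + E y *m mxderiv F y u.
Proof.
move=> dE dF; apply/matrixP => i j; rewrite !mxE.
have -> : (fun z => (E z *m F z) i j) = \sum_l (fun z => E z i l * F z l j).
  by apply/funext => z; rewrite mxE fct_sumE.
have dEF l : derivable (fun z => E z i l * F z l j) y u.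
  apply: (@derivableM _ _ (fun z => E z i l) (fun z => F z l j));
  by apply: diff_derivable.
rewrite derive_sum// -big_split; apply: eq_bigr => l _ /=.
rewrite (@deriveM _ _ (fun z => E z i l) (fun z => F z l j)); try exact: diff_derivable.
by rewrite !mxE addrC; congr (_ + _); exact: mulrC.
Qed.

Lemma mxderiv_near p q (E F : 'rV[R]_n -> 'M[R]_(p, q)) y u :
  (\forall z \near y, E z = F z) -> mxderiv E y u = mxderiv F y u.
Proof.
move=> EF; apply/matrixP => i j; rewrite !mxE; apply: near_eq_derive.
by apply: filterS EF => z ->.
Qed.

Lemma mxderiv_cst p q (C : 'M[R]_(p, q)) y u : mxderiv (fun=> C) y u = 0.
Proof. by apply/matrixP => i j; rewrite !mxE; exact: derive_cst. Qed.

Lemma mxderiv_mull p q r (C : 'M[R]_(p, q)) (F : 'rV[R]_n -> 'M[R]_(q, r)) y u :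
  (forall i j, differentiable (fun z => F z i j) y) ->
  mxderiv (fun z => C *m F z) y u = C *m mxderiv F y u.
Proof.
move=> dF; rewrite mxderiv_mul// ?mxderiv_cst ?mul0mx ?add0r// => i j.
Qed.

Lemma differentiable_mulmx (V : normedModType R) p q (f : V -> 'rV[R]_p) (S : 'M[R]_(p, q)) x j :
  differentiable f x -> differentiable (fun z => (f z *m S) 0 j) x.
Proof.
move=> /differentiable_rVP df.
have -> : (fun z => (f z *m S) 0 j) = \sum_l (S l j *: (fun z => f z 0 l)).
  apply/funext => z; rewrite mxE fct_sumE; apply: eq_bigr => l _; exact: mulrC.
by apply: differentiable_sum => l; exact: differentiableZ.
Qed.

Lemma derive_mulmx (V : normedModType R) p q (f : V -> 'rV[R]_p) (S : 'M[R]_(p, q)) x v :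
  differentiable f x -> 'D_v (fun z => f z *m S) x = 'D_v f x *m S.
Proof.
move=> df.
have dg : differentiable (mulmxr S : 'rV[R]_p -> 'rV[R]_q) (f x).
  by apply: linear_differentiable; exact: mulmx_continuous.
rewrite (derive_comp (g := mulmxr S))// deriveE//.
by rewrite (diff_lin (f := mulmxr S))//; exact: mulmx_continuous.
Qed.

End MatrixDerivative.

Section Frobenius.
Context {R : realType}.

Lemma open_norm_lt (V : normedModType R) (d : R) : open [set x : V | `|x| < d].
Proof.
have -> : [set x : V | `|x| < d] = ball (0 : V) d.
  by apply/seteqP; split => x; rewrite -ball_normE /ball_ /= sub0r normrN.
have [d0|d0] := ltP 0 d; first exact: ball_open.
rewrite (_ : ball _ _ = set0); first exact: open0.
apply/seteqP; split => x //; rewrite -ball_normE /ball_ /= => /(le_lt_trans (normr_ge0 _)).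
by rewrite ltNge d0.
Qed.

(** The missing columns are read off the invertible factor of a Gaussian
    elimination of A. *)
Lemma complete_columns c k (A : 'M[R]_(c + k, c)) : \rank A = c ->
  exists S : 'M[R]_(c + k, k), row_mx A S \in unitmx.
Proof.
move=> rA; pose L := col_ebase A; exists (rsubmx L).
have -> : row_mx A (rsubmx L) = L *m block_mx (row_ebase A) 0 0 1%:M.
  rewrite -[in RHS](hsubmxK L) /block_mx mul_row_col !mul_mx_row !mulmx0 mulmx1 add_row_mx.
  rewrite addr0 add0r; congr row_mx.
  rewrite -[LHS](mulmx_ebase A) rA -/L -{1}(hsubmxK L).
  rewrite (_ : pid_mx c = col_mx 1%:M 0 :> 'M[R]_(c + k, c)).
    by rewrite mul_row_col mulmx0 mulmx1 addr0.
  by rewrite pid_mx_col.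
rewrite unitmx_mul col_ebase_unit /= unitmxE det_ublock det1 mulr1 -unitmxE.
exact: row_ebase_unit.
Qed.

(** The matrix (N y | S) is invertible at a for a suitable constant S, hence
    near a. The lower block of its inverse is a frame B of the kernel of N
    which is normalised by B S = 1. *)
Lemma kernel_frame c k (U : set 'rV[R]_(c + k)) (N : 'rV[R]_(c + k) -> 'M[R]_(c + k, c)) a :
  open U -> U a -> (forall i j, smooth_on U (fun y => N y i j)) ->
  \rank (N a) = c ->
  exists (U' : set 'rV[R]_(c + k)) (S : 'M[R]_(c + k, k))
      (B : 'rV[R]_(c + k) -> 'M[R]_(k, c + k)),
    [/\ open U', U' a, U' `<=` U, forall i j, smooth_on U' (fun y => B y i j) &
     forall y, U' y -> [/\ B y *m N y = 0, B y *m S = 1%:M &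
       forall u v : 'rV[R]_(c + k), u *m N y = v *m N y -> u *m S = v *m S -> u = v]].
Proof.
move=> oU Ua sN rN.
have [S KS] := complete_columns rN.
pose K y := row_mx (N y) S.
have sK i j : smooth_on U (fun y => K y i j).
  rewrite /K; case: (split_ordP j) => j' ->.
    by under eq_fun do rewrite row_mxEl; exact: sN.
  by under eq_fun do rewrite row_mxEr; exact: smooth_on_cst.
pose U' := U `&` [set y | \det (K y) != 0].
have oU' : open U'.
  rewrite openE => y [Uy /= Ky]; apply: filterI; first exact: open_nbhs_nbhs.
  have : {for y, continuous (fun y => \det (K y))}.
    by apply: differentiable_continuous; exact: smooth_on_diff (smooth_on_det oU sK) Uy.
  by move/(_ [set r | r != 0]); apply; exact: open_nbhs_nbhs.
have uK y : U' y -> K y \in unitmx by move=> [_ /= h]; rewrite unitmxE unitfE.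
have U'U : U' `<=` U by move=> y [].
pose B y := dsubmx (invmx (K y)).
exists U', S, B; split => //.
- by split => //=; rewrite -unitfE -unitmxE.
- move=> i j; rewrite /B; under eq_fun do rewrite mxE.
  by apply: smooth_on_invmx => // l m; exact: smooth_onW U'U (sK _ _).
move=> y Uy.
have : col_mx (usubmx (invmx (K y))) (B y) *m K y = 1%:M.
  by rewrite vsubmxK mulVmx// uK.
rewrite mul_col_mx scalar_mx_block /block_mx => /eq_col_mx[_].
rewrite mul_mx_row => /eq_row_mx[BN BS]; split => // u v uvN uvS.
rewrite -(mulmxK (uK y Uy) u) -(mulmxK (uK y Uy) v).
by rewrite /K !mul_mx_row uvN uvS.
Qed.

(** The closedness hypothesis says that the exterior derivatives of the forms
    given by the columns of N vanish on their common kernel. For the frame B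
    normalised by B S = 1 it becomes the commutation condition of the total
    differential equation for B: the two sides of that condition have the same
    product with N, by closedness, and with S, because B S is constant. The
    normalisation also shows that Phi is a graph over the coordinates given by
    S. *)
Lemma frobenius c k (U : set 'rV[R]_(c + k)) (N : 'rV[R]_(c + k) -> 'M[R]_(c + k, c)) a :
  open U -> U a -> (forall i j, smooth_on U (fun y => N y i j)) ->
  \rank (N a) = c ->
  (forall y v w, U y -> v *m N y = 0 -> w *m N y = 0 ->
     w *m mxderiv N y v = v *m mxderiv N y w) ->
  exists (d : R) (Phi : 'rV[R]_k -> 'rV[R]_(c + k)) (S : 'M[R]_(c + k, k)),
    [/\ 0 < d, Phi 0 = a, smooth_on [set x | `|x| < d] Phi,
      forall x, `|x| < d -> Phi x *m S = x + a *m S &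
      forall x, `|x| < d -> [/\ U (Phi x), forall v, 'D_v Phi x *m S = v &
        range (fun v => 'D_v Phi x) = [set u | u *m N (Phi x) = 0]]].
Proof.
move=> oU Ua sN rN inv.
have [U' [S [B [oU' U'a U'U sB BP]]]] := kernel_frame oU Ua sN rN.
have NSinj y (X Y : 'rV[R]_(c + k)) : U' y -> X *m N y = Y *m N y -> X *m S = Y *m S -> X = Y.
  by move=> /BP[_ _]; exact.
have BK y : U' y -> B y *m N y = 0 /\ B y *m S = 1%:M by move=> /BP[].
have dB y i j : U' y -> differentiable (fun z => B z i j) y.
  by move=> Uy; exact: smooth_on_diff (sB i j) Uy.
have dN y i j : U' y -> differentiable (fun z => N z i j) y.
  by move=> /U'U Uy; exact: smooth_on_diff (sN i j) Uy.
have BS0 y u : U' y -> mxderiv B y u *m S = 0.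
  move=> Uy; have : mxderiv (fun z => B z *m S) y u = 0.
    rewrite -(mxderiv_cst (1%:M : 'M[R]_k) y u); apply: mxderiv_near.
    near=> z; have [|_ ->//] := BK z; near: z; exact: open_nbhs_nbhs.
  rewrite mxderiv_mul ?mxderiv_cst ?mulmx0 ?addr0// => i j; exact: dB.
have BN0 y u : U' y -> mxderiv B y u *m N y = - (B y *m mxderiv N y u).
  move=> Uy; have : mxderiv (fun z => B z *m N z) y u = 0.
    rewrite -(mxderiv_cst (0 : 'M[R]_(k, c)) y u); apply: mxderiv_near.
    near=> z; have [|->//] := BK z; near: z; exact: open_nbhs_nbhs.
  rewrite mxderiv_mul => [/eqP|i j|i j]; [|exact: dB|exact: dN].
  by rewrite addr_eq0 => /eqP.
have comm y (v w : 'rV[R]_k) : U' y ->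
    v *m mxderiv B y (w *m B y) = w *m mxderiv B y (v *m B y).
  move=> Uy.
  have vN (z : 'rV[R]_k) : z *m B y *m N y = 0 by have [BN _] := BK y Uy; rewrite -mulmxA BN mulmx0.
  have := inv y (w *m B y) (v *m B y) (U'U _ Uy) (vN w) (vN v).
  move: (BN0 y (w *m B y) Uy) (BN0 y (v *m B y) Uy) (BS0 y (w *m B y) Uy) (BS0 y (v *m B y) Uy).
  move: (mxderiv B y (w *m B y)) (mxderiv B y (v *m B y)) => P Q.
  move: (mxderiv N y (w *m B y)) (mxderiv N y (v *m B y)) => P' Q' PN QN PS QS E.
  apply: (NSinj y _ _ Uy); rewrite -!mulmxA ?PN ?QN ?PS ?QS ?mulmx0//.
  by rewrite !mulmxN !mulmxA E.
have [d [Phi [d0 Phi0 HPhi]]] := total_differential_equation oU' U'a sB comm.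
exists d, Phi, S.
have oB : open [set x : 'rV[R]_k | `|x| < d] by exact: open_norm_lt.
split => //.
- apply/smooth_on_rVP => // i.
  (* coinduction: the derivative of F o Phi is again a smooth function of
     Phi, by the differential equation *)
  pose P h := exists2 F : 'rV[R]_(c + k) -> R, smooth_on U' F & h = F \o Phi.
  apply: (@smooth_on_coind _ _ _ _ P) => //; last first.
    by exists (fun z => z 0 i) => //; exact: smooth_on_coord.
  move=> _ [F sF ->]; split=> [x xd|v].
    have [Ux dx _] := HPhi x xd.
    by apply: differentiable_comp => //; exact: smooth_on_diff sF Ux.
  exists ((fun z => \sum_j (v *m B z) 0 j * 'D_(delta_mx 0 j) F z) \o Phi).
    eexists; last reflexivity.
    apply: smooth_on_sum => // j _; apply: smooth_onM => //.
      by apply: smooth_on_mulmx => // i1 i2; exact: smooth_on_cst.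
    exact: smooth_on_derive.
  move=> x xd; have [Ux dx Dx] := HPhi x xd.
  have dF := smooth_on_diff sF Ux.
  by apply: etrans (derive_comp v dx dF) _; rewrite Dx (derive_rV_sum _ dF).
- move=> x xd; apply/eqP; rewrite -subr_eq; apply/eqP.
  apply/rowP => i.
  (* f has vanishing derivative on the ball, hence is constant *)
  pose f z := (Phi z *m S) 0 i - z 0 i.
  have xd0 : `|0 : 'rV[R]_k| < d by rewrite normr0.
  have df z : `|z - 0| < d -> differentiable f z /\ forall v, 'D_v f z = 0.
    rewrite subr0 => zd; have [Uz dz Dz] := HPhi z zd.
    have dS : differentiable (fun z => (Phi z *m S) 0 i) z.
      by apply/differentiable_mulmx.
    have dc : differentiable (fun z : 'rV[R]_k => z 0 i) z by exact: differentiable_coord.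
    split; first exact: differentiableB dS dc.
    move=> v; rewrite deriveB; try exact: diff_derivable.
    rewrite -(derive_rV (f := fun z => Phi z *m S)) ?derive_mulmx//; last first.
      by apply/differentiable_rVP => j; apply: differentiable_mulmx.
    rewrite -(derive_rV (f := id)) ?derive_id// Dz -mulmxA; have [_ ->] := BK _ Uz.
    by rewrite mulmx1 subrr.
  have [z zd|||w [wd _] E] := @mvt_ball R k f 0 d 0 x.
  - by have [] := df z zd.
  - by rewrite subr0.
  - by rewrite subr0.
  move: E; have [_ ->] := df w wd; rewrite /f Phi0 => E.
  have -> : (Phi x *m S - a *m S) 0 i = (Phi x *m S) 0 i - (a *m S) 0 i by rewrite !mxE.
  have z0 : (0 : 'rV[R]_k) 0 i = 0 by rewrite mxE.
  by rewrite z0 in E; move: E; move: ((Phi x *m S) 0 i) ((a *m S) 0 i) => p q; lra.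
- move=> x xd; have [Ux dx De] := HPhi x xd; have [BN BS] := BK _ Ux.
  split; first exact: U'U.
    by move=> v; rewrite De -mulmxA BS mulmx1.
  apply/seteqP; split => [_ [v _ <-]|u /= uN].
    by rewrite /= De -mulmxA BN mulmx0.
  exists (u *m S) => //; rewrite De.
  by apply: (NSinj _ _ _ Ux); rewrite -!mulmxA ?BN ?BS ?mulmx0 ?mulmx1 ?uN.
Unshelve. all: by end_near. Qed.
End Frobenius.

(** * Charts and tangent maps *)

Section Charts.
Context {R : realType} {n : nat} {M : smoothManifold R n}.
Implicit Types p x : M.

Lemma chart_image_invK p y : (chart p @` dom p) y ->
  dom p (chart_inv p y) /\ chart p (chart_inv p y) = y.
Proof. by move=> [x px <-]; rewrite chartK. Qed.

Lemma near_chart_inv p x (P : M -> Prop) : dom p x -> (\forall z \near x, P z) ->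
  \forall y \near chart p x, P (chart_inv p y).
Proof.
move=> px Px; have := @chart_inv_continuous _ _ M p (chart p x) _.
rewrite /prop_for /continuous_at chartK// => /(_ _ P); apply => //.
Qed.

Lemma near_chart_image p x : dom p x -> \forall y \near chart p x, (chart p @` dom p) y.
Proof.
move=> px; apply: open_nbhs_nbhs; split; first exact: chart_image_open.
by exists x.
Qed.

Lemma near_dom p x : dom p x -> \forall z \near x, dom p z.
Proof. by move=> px; apply: open_nbhs_nbhs; split => //; exact: dom_open. Qed.

Lemma open_chart_image p (W : set M) : open W -> W `<=` dom p -> open (chart p @` W).
Proof.
move=> oW Wp; rewrite openE => _ [x Wx <-].
have px := Wp x Wx.
have Wn : \forall z \near x, W z by exact: open_nbhs_nbhs.
have h1 := near_chart_inv px Wn; have h2 := near_chart_image px.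
rewrite /interior; apply: filterS2 h1 h2 => y Wy /chart_image_invK[_ yE].
by exists (chart_inv p y).
Qed.

End Charts.

Section TangentMap.
Context {R : realType}.

(** The differential of f at x in the chart a of the source and the chart b of
    the target. The maps tmap and tchange are the special cases in which the
    charts are those of the base points, and in which f is the identity. *)
Definition dmap n m (N : smoothManifold R n) (M : smoothManifold R m)
    (f : N -> M) (a : N) (b : M) (x : N) (u : 'rV[R]_n) : 'rV[R]_m :=
  'D_u (chart b \o f \o chart_inv a) (chart a x).

Definition chart_dom n m (N : smoothManifold R n) (M : smoothManifold R m)
    (f : N -> M) (a : N) (b : M) : set N := dom a `&` f @^-1` dom b.

Section OneMap.
Context {n m : nat} {N : smoothManifold R n} {M : smoothManifold R m}.
Variable f : N -> M.
Hypothesis sf : smooth_map f.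

Lemma open_chart_dom a b : open (chart_dom f a b).
Proof.
apply: openI; first exact: dom_open.
by case: sf => cf _; apply: open_comp; [move=> x _; exact: cf|exact: dom_open].
Qed.

Lemma near_chart_dom a b x : dom a x -> dom b (f x) -> \forall z \near x, chart_dom f a b z.
Proof. by move=> ax bx; apply: open_nbhs_nbhs; split => //; exact: open_chart_dom. Qed.

Lemma near_chart_dom_rep a b x : dom a x -> dom b (f x) ->
  \forall y \near chart a x, [/\ dom a (chart_inv a y), dom b (f (chart_inv a y)) &
     chart a (chart_inv a y) = y].
Proof.
move=> ax bx; have h1 := near_chart_inv ax (near_chart_dom ax bx).
have h2 := near_chart_image ax.
by apply: filterS2 h1 h2 => y [? ?] /chart_image_invK[].
Qed.

Lemma open_chart_dom_rep a b : open (chart a @` chart_dom f a b).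
Proof. by apply: open_chart_image; [exact: open_chart_dom|move=> x []]. Qed.

Lemma rep_smooth a b :
  smooth_on (chart a @` chart_dom f a b) (chart b \o f \o chart_inv a).
Proof. by case: sf => _; exact. Qed.

Lemma rep_differentiable a b x : dom a x -> dom b (f x) ->
  differentiable (chart b \o f \o chart_inv a) (chart a x).
Proof.
by move=> ax bx; apply: (smooth_on_diff (rep_smooth (a := a) (b := b))); exists x.
Qed.

Lemma dmap_linear a b x : dom a x -> dom b (f x) -> linear (dmap f a b x).
Proof.
by move=> ax bx c u v; apply: derive_linear; exact: rep_differentiable.
Qed.

Lemma tmap_linear x : linear (tmap f x).
Proof. exact: (dmap_linear (dom_center _) (dom_center _)). Qed.

End OneMap.

Lemma smooth_map_id n (M : smoothManifold R n) : smooth_map (@idfun M).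
Proof.
split=> [x|q p]; first exact: cvg_id.
exact: transition_smooth.
Qed.

Section TwoMaps.
Context {n m l : nat} {N : smoothManifold R n} {M : smoothManifold R m}
  {L : smoothManifold R l}.

Lemma rep_comp_near (f : N -> M) (h : M -> L) a b c x : smooth_map f ->
  dom a x -> dom b (f x) ->
  \forall y \near chart a x, (chart c \o (h \o f) \o chart_inv a) y =
    ((chart c \o h \o chart_inv b) \o (chart b \o f \o chart_inv a)) y.
Proof.
move=> sf ax bx; apply: filterS (near_chart_dom_rep sf ax bx) => y [_ by_ _] /=.
by rewrite chartK.
Qed.

Lemma dmap_comp (f : N -> M) (h : M -> L) a b c x u : smooth_map f -> smooth_map h ->
  dom a x -> dom b (f x) -> dom c (h (f x)) ->
  dmap h b c (f x) (dmap f a b x u) = dmap (h \o f) a c x u.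
Proof.
move=> sf sh ax bx cx; rewrite /dmap.
have E : chart b (f x) = (chart b \o f \o chart_inv a) (chart a x) by rewrite /= chartK.
rewrite {1}E -derive_comp.
- by apply: near_eq_derive; apply: filterS (rep_comp_near h c sf ax bx) => y ->.
- exact: rep_differentiable.
- by rewrite -E; exact: rep_differentiable.
Qed.

Lemma smooth_map_comp (f : N -> M) (h : M -> L) : smooth_map f -> smooth_map h ->
  smooth_map (h \o f).
Proof.
move=> sf sh; split=> [x|a c].
  by apply: continuous_comp; [case: sf => + _; exact|case: sh => + _; exact].
apply: smooth_on_loc => _ [x [ax cx] <-] /=.
pose b := f x.
have oW : open (chart a @` (chart_dom f a b `&` chart_dom (h \o f) a c)).
  apply: open_chart_image => [|? [[]]//].
  apply: openI; first exact: open_chart_dom.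
  apply: openI; first exact: dom_open.
  apply: open_comp; last exact: dom_open.
  move=> z _; apply: continuous_comp; [case: sf => + _; exact|case: sh => + _; exact].
exists (chart a @` (chart_dom f a b `&` chart_dom (h \o f) a c)).
  by exists x => //; split => //; split => //; exact: dom_center.
apply: (@smooth_on_eq _ _ _ _ ((chart c \o h \o chart_inv b) \o (chart b \o f \o chart_inv a))) => //.
  by move=> _ [z [[az bz] [_ cz]] <-] /=; rewrite !chartK.
apply: (@smooth_on_comp_rV _ _ _ oW _ _ (chart b @` chart_dom h b c)).
- exact: open_chart_dom_rep.
- apply: smooth_onW (rep_smooth sf (a := a) (b := b)).
  by move=> _ [z [[az bz] _] <-]; exists z.
- exact: rep_smooth.
- move=> _ [z [[az bz] [_ cz]] <-] /=; rewrite chartK//.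
  by exists (f z).
Qed.
End TwoMaps.

Section TangentChange.
Context {n m : nat} {N : smoothManifold R n} {M : smoothManifold R m}.

(** A change of tangent coordinates is the differential of the identity, so
    its composition law is the chain rule for maps. *)
Lemma tchange_comp (a b c x : M) v : dom a x -> dom b x -> dom c x ->
  tchange b c x (tchange a b x v) = tchange a c x v.
Proof.
by move=> ax bx cx; apply: (dmap_comp (f := idfun) (h := idfun));
  do ?exact: smooth_map_id.
Qed.

Lemma tchange_id (a x : M) v : dom a x -> tchange a a x v = v.
Proof.
move=> ax; rewrite /tchange -[RHS](derive_id (chart a x) v).
apply: near_eq_derive; apply: filterS (near_chart_image ax) => y.
by move=> /chart_image_invK[_ yE].
Qed.

Lemma tchange_linear (a b x : M) : dom a x -> dom b x -> linear (tchange a b x).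
Proof. by move=> ax bx; apply: (dmap_linear (f := idfun)) => //; exact: smooth_map_id. Qed.

Variable f : N -> M.
Hypothesis sf : smooth_map f.

Lemma tchange_dmap a b c x u : dom a x -> dom b (f x) -> dom c (f x) ->
  tchange b c (f x) (dmap f a b x u) = dmap f a c x u.
Proof.
move=> ax bx cx; apply: (dmap_comp (f := f) (h := idfun)) => //; exact: smooth_map_id.
Qed.

Lemma dmap_tchange a b z x u : dom a x -> dom z x -> dom b (f x) ->
  dmap f a b x (tchange z a x u) = dmap f z b x u.
Proof.
move=> ax zx bx; apply: (dmap_comp (f := idfun) (h := f)) => //; exact: smooth_map_id.
Qed.

Lemma field_rep_at V q p x : dom q x ->
  field_rep f V q p (chart q x) = tchange (f x) p (f x) (V x).
Proof. by move=> qx; rewrite /field_rep chartK. Qed.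

Lemma field_rep_center V q : field_rep f V q (f q) (chart q q) = V q.
Proof. by rewrite field_rep_at ?tchange_id//; exact: dom_center. Qed.

Lemma field_rep_tmap W q p x : dom q x -> dom p (f x) ->
  field_rep f (fun x => tmap f x (W x)) q p (chart q x) =
  dmap f q p x (field_rep idfun W q q (chart q x)).
Proof.
move=> qx px; rewrite /field_rep chartK//= dmap_tchange ?tchange_dmap//; exact: dom_center.
Qed.

End TangentChange.

Section LinearFamily.
Context {V : normedModType R} {m : nat}.

(** The Leibniz rule for the pairing of a vector with a family of linear
    forms, reduced by linearity to the coordinates of the vector. *)
Lemma derive_linear_family_scalar (L : V -> 'rV[R]_m -> R) (a : V -> 'rV[R]_m) y0 u :
  (\forall y \near y0, scalar (L y)) ->
  (forall v, differentiable (L^~ v) y0) -> differentiable a y0 ->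
  differentiable (fun y => L y (a y)) y0 /\
  'D_u (fun y => L y (a y)) y0 = L y0 ('D_u a y0) + 'D_u (L^~ (a y0)) y0.
Proof.
move=> Ll dL da.
have dai i : differentiable (fun y => a y 0 i) y0 by move/differentiable_rVP : da; exact.
pose e i : 'rV[R]_m := delta_mx 0 i.
have LE y v : scalar (L y) -> L y v = \sum_i v 0 i * L y (e i).
  move=> Ly; pose Lf := HB.pack_for {scalar 'rV[R]_m} (L y)
    (GRing.isLinear.Build _ _ _ _ _ Ly).
  rewrite -[L y]/(Lf : _ -> _) {1}(row_sum_delta v) linear_sum.
  by apply: eq_bigr => i _; rewrite linearZ.
have E : \forall y \near y0, (\sum_i (fun y => a y 0 i * L y (e i))) y = L y (a y).
  by apply: filterS Ll => y Ly; rewrite fct_sumE (LE y (a y) Ly).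
have E0 : \forall y \near y0, (\sum_i (fun y => a y0 0 i * L y (e i))) y = L y (a y0).
  by apply: filterS Ll => y Ly; rewrite fct_sumE (LE y (a y0) Ly).
have dp i : differentiable (fun y => a y 0 i * L y (e i)) y0.
  exact: (@differentiableM _ _ (fun y => a y 0 i)).
have dp0 i : differentiable (fun y => a y0 0 i * L y (e i)) y0.
  exact: (@differentiableZ _ _ _ (L^~ (e i)) (a y0 0 i)).
split; first by apply: near_eq_differentiable E _; exact: differentiable_sum.
rewrite -(near_eq_derive _ E) -(near_eq_derive _ E0).
rewrite !derive_sum; try by move=> i; exact: diff_derivable.
rewrite (LE y0 ('D_u a y0) (nbhs_singleton Ll)) -big_split; apply: eq_bigr => i _ /=.
rewrite (@deriveM _ _ (fun y => a y 0 i) (L^~ (e i))); try exact: diff_derivable.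
rewrite (@deriveZ _ _ _ (L^~ (e i)) (a y0 0 i)); last exact: diff_derivable.
by rewrite derive_rV// addrC; congr (_ + _); exact: mulrC.
Qed.

Lemma derive_linear_family k (L : V -> 'rV[R]_m -> 'rV[R]_k) (a : V -> 'rV[R]_m) y0 u :
  (\forall y \near y0, linear (L y)) ->
  (forall v, differentiable (L^~ v) y0) -> differentiable a y0 ->
  differentiable (fun y => L y (a y)) y0 /\
  'D_u (fun y => L y (a y)) y0 = L y0 ('D_u a y0) + 'D_u (L^~ (a y0)) y0.
Proof.
move=> Ll dL da.
have Lli i : \forall y \near y0, scalar (fun v => L y v 0 i).
  by apply: filterS Ll => y Ly c v w; rewrite Ly !mxE.
have dLi i v : differentiable (fun y => L y v 0 i) y0.
  by move/differentiable_rVP : (dL v); exact.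
have H i := derive_linear_family_scalar u (Lli i) (dLi i) da.
have dF : differentiable (fun y => L y (a y)) y0.
  by apply/differentiable_rVP => i; have [] := H i.
split => //; apply/rowP => i; rewrite derive_rV//; have [_ ->] := H i.
by rewrite mxE derive_rV.
Qed.

End LinearFamily.
End TangentMap.

(** * Inner products and Christoffel symbols *)

Section SmoothFamily.
Context {R : realType} {n : nat}.

Lemma linear_expand m (L : 'rV[R]_m -> R) v : scalar L ->
  L v = \sum_i v 0 i * L (delta_mx 0 i).
Proof.
move=> Ll; pose Lf := HB.pack_for {scalar 'rV[R]_m} L
  (GRing.isLinear.Build _ _ _ _ _ Ll).
rewrite -[L]/(Lf : _ -> _) {1}(row_sum_delta v) linear_sum.
by apply: eq_bigr => i _; rewrite linearZ.
Qed.

Lemma smooth_linear_family_scalar (A : set 'rV[R]_n) m (L : 'rV[R]_n -> 'rV[R]_m -> R)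
    (a : 'rV[R]_n -> 'rV[R]_m) : open A ->
  (forall y, A y -> scalar (L y)) -> (forall v, smooth_on A (L^~ v)) ->
  smooth_on A a -> smooth_on A (fun y => L y (a y)).
Proof.
move=> oA Ll sL sa.
apply: (@smooth_on_eq _ _ _ _ (fun y => \sum_i a y 0 i * L y (delta_mx 0 i))) => //.
  by move=> y Ay; rewrite [RHS]linear_expand//; exact: Ll.
apply: smooth_on_sum => // i _; apply: smooth_onM => //.
exact: (smooth_on_rVP a oA).1 sa i.
Qed.

Lemma smooth_linear_family (A : set 'rV[R]_n) m k (L : 'rV[R]_n -> 'rV[R]_m -> 'rV[R]_k)
    (a : 'rV[R]_n -> 'rV[R]_m) : open A ->
  (forall y, A y -> linear (L y)) -> (forall v, smooth_on A (L^~ v)) ->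
  smooth_on A a -> smooth_on A (fun y => L y (a y)).
Proof.
move=> oA Ll sL sa; apply/smooth_on_rVP => // i.
apply: (@smooth_linear_family_scalar A m (fun y v => L y v 0 i)) => //.
  by move=> y Ay c v w; rewrite Ll// !mxE.
by move=> v; exact: (smooth_on_rVP _ oA).1 (sL v) i.
Qed.

End SmoothFamily.

Section Inner.
Context {R : realType} {n : nat}.

Definition inner (b : 'rV[R]_n -> 'rV[R]_n -> R) : Prop :=
  [/\ forall w, scalar (b^~ w), forall v w, b v w = b w v &
      forall v, v != 0 -> 0 < b v v].

Variable b : 'rV[R]_n -> 'rV[R]_n -> R.
Hypothesis ib : inner b.

Lemma innerP c u v w : b (c *: u + v) w = c * b u w + b v w.
Proof. by have [bl _ _] := ib; exact: bl. Qed.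

Lemma innerC v w : b v w = b w v. Proof. by have [_ + _] := ib; exact. Qed.

Lemma innerDl u v w : b (u + v) w = b u w + b v w.
Proof. by rewrite -[u]scale1r innerP mul1r scale1r. Qed.

Lemma inner0l w : b 0 w = 0.
Proof. by have := innerDl 0 0 w; rewrite addr0 => /eqP; rewrite -subr_eq0 opprD addrA subrr add0r oppr_eq0 => /eqP. Qed.

Lemma innerZl c u w : b (c *: u) w = c * b u w.
Proof. by rewrite -[c *: u]addr0 innerP inner0l addr0. Qed.

Lemma innerNl u w : b (- u) w = - b u w.
Proof. by rewrite -scaleN1r innerZl mulN1r. Qed.

Lemma innerBl u v w : b (u - v) w = b u w - b v w.
Proof. by rewrite innerDl innerNl. Qed.

Lemma innerDr u v w : b w (u + v) = b w u + b w v.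
Proof. by rewrite innerC innerDl !(innerC w). Qed.

Lemma innerZr c u w : b w (c *: u) = c * b w u.
Proof. by rewrite innerC innerZl (innerC w). Qed.

Lemma innerNr u w : b w (- u) = - b w u.
Proof. by rewrite innerC innerNl (innerC w). Qed.

Lemma inner0r w : b w 0 = 0. Proof. by rewrite innerC inner0l. Qed.

Lemma inner_eq0 v : b v v = 0 -> v = 0.
Proof.
by have [_ _ bp] := ib; move=> bv; apply/eqP; apply: contraT => /bp; rewrite bv ltxx.
Qed.

Lemma inner_inj u v : (forall w, b u w = b v w) -> u = v.
Proof.
move=> uv; apply/eqP; rewrite -subr_eq0; apply/eqP; apply: inner_eq0.
by rewrite innerBl uv subrr.
Qed.

Definition gram := \matrix_(i, j) b (delta_mx 0 i) (delta_mx 0 j).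

Lemma mulmx_gram v j : (v *m gram) 0 j = b v (delta_mx 0 j).
Proof.
rewrite mxE (@linear_expand _ _ (b^~ (delta_mx 0 j))); last by have [+ _ _] := ib; exact.
by apply: eq_bigr => i _; rewrite !mxE.
Qed.

Lemma gram_unit : gram \in unitmx.
Proof.
rewrite -row_free_unit; apply/row_freeP.
suff K0 : kermx gram = 0 by apply/row_freeP; rewrite -kermx_eq0 K0.
apply/row_matrixP => i; rewrite row0; apply: inner_eq0.
have K : row i (kermx gram) *m gram = 0 by rewrite -row_mul mulmx_ker row0.
rewrite (@linear_expand _ _ (b (row i (kermx gram)))).
  rewrite big1// => j _.
  by have -> : b (row i (kermx gram)) (delta_mx 0 j) = 0; [rewrite -mulmx_gram K mxE|rewrite mulr0].
by move=> c u v; rewrite !(innerC (row _ _)) innerP.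
Qed.

(** Every linear form is an inner product with a vector, since the Gram matrix
    is invertible. This is what makes Koszul's formula and the tangential
    projection meaningful. *)
Lemma riesz (l : 'rV[R]_n -> R) : scalar l -> exists c, forall w, b c w = l w.
Proof.
move=> ll; exists ((\row_j l (delta_mx 0 j)) *m invmx gram) => w.
rewrite (linear_expand w ll) (@linear_expand _ _ (b _)).
  by apply: eq_bigr => j _; rewrite -mulmx_gram mulmxKV ?gram_unit// mxE.
by move=> c u v; rewrite !(innerC (_ *m _)) innerP.
Qed.

End Inner.

Lemma half_sum_scalar (R : realType) n (l1 l2 l3 : 'rV[R]_n -> R) :
  scalar l1 -> scalar l2 -> scalar l3 -> scalar (fun w => 2^-1 * (l1 w + l2 w - l3 w)).
Proof.
move=> h1 h2 h3 c u v; rewrite h1 h2 h3 /GRing.scale /=; ring.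
Qed.

Lemma koszul_eq (R : realType) (a b x y z : R) :
  2 * a = x + y - z -> 2 * b = y + x - z -> a = b.
Proof. lra. Qed.

Lemma koszul_add (R : realType) (a b x y z : R) :
  2 * a = x + y - z -> 2 * b = x + z - y -> x = a + b.
Proof. lra. Qed.

Section Metric.
Context {R : realType} {n : nat} {M : smoothManifold R n}.
Variable g : M -> 'rV[R]_n -> 'rV[R]_n -> R.
Hypothesis rg : riemannian g.

Lemma riemannian_inner p : inner (g p).
Proof. by have [gl gs gp _] := rg; split; [exact: gl|exact: gs|exact: gp]. Qed.

Lemma metric_repE p x v w : dom p x ->
  metric_rep g p (tchange x p x v) (tchange x p x w) (chart p x) = g x v w.
Proof.
by move=> px; rewrite /metric_rep /= chartK// !tchange_comp ?tchange_id//; exact: dom_center.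
Qed.

Lemma metric_rep_center p v w : metric_rep g p v w (chart p p) = g p v w.
Proof. by rewrite /metric_rep /= chartK ?tchange_id//; exact: dom_center. Qed.

Lemma metric_rep_sym p v w : metric_rep g p v w = metric_rep g p w v.
Proof. by apply/funext => y; have [_ gs _ _] := rg; exact: gs. Qed.

Lemma metric_rep_linear p w y : (chart p @` dom p) y ->
  scalar (fun v => metric_rep g p v w y).
Proof.
move=> [x px <-] c u v; rewrite /metric_rep /= chartK//.
by rewrite (tchange_linear px (dom_center x)) (innerP (riemannian_inner x)).
Qed.

Lemma metric_rep_smooth p v w : smooth_on (chart p @` dom p) (metric_rep g p v w).
Proof. by have [_ _ _] := rg; exact. Qed.

Lemma metric_rep_differentiable p v w x : dom p x ->
  differentiable (metric_rep g p v w) (chart p x).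
Proof. by move=> px; apply: smooth_on_diff (metric_rep_smooth v w) _; exists x. Qed.

(** The Leibniz rule for g (a, b) along a curve c of base points, where a, b,
    c are functions of a further variable. *)
Lemma derive_metric_rep (V : normedModType R) p (a b c : V -> 'rV[R]_n) x y0 u :
  dom p x -> c y0 = chart p x -> differentiable a y0 -> differentiable b y0 ->
  differentiable c y0 ->
  differentiable (fun y => metric_rep g p (a y) (b y) (c y)) y0 /\
  'D_u (fun y => metric_rep g p (a y) (b y) (c y)) y0 =
    metric_rep g p ('D_u a y0) (b y0) (chart p x) +
    metric_rep g p (a y0) ('D_u b y0) (chart p x) +
    'D_('D_u c y0) (metric_rep g p (a y0) (b y0)) (chart p x).
Proof.
move=> px cy da db dc.
have cn : \forall y \near y0, (chart p @` dom p) (c y).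
  have cc := differentiable_continuous dc.
  apply: (cc (chart p @` dom p)); rewrite cy; exact: near_chart_image.
have dG v w : differentiable (metric_rep g p v w) (c y0).
  by rewrite cy; exact: metric_rep_differentiable.
have dGc v w : differentiable (fun y => metric_rep g p v w (c y)) y0.
  exact: (differentiable_comp (f := c)).
have l1 v : \forall y \near y0, scalar (fun w => metric_rep g p v w (c y)).
  apply: filterS cn => y yc; have := metric_rep_linear v yc.
  by under eq_fun do rewrite metric_rep_sym.
have h1 v := derive_linear_family_scalar u (l1 v) (dGc v) db.
have l2 : \forall y \near y0, scalar (fun v => metric_rep g p v (b y) (c y)).
  by apply: filterS cn => y yc; exact: metric_rep_linear.
have [d2 D2] := derive_linear_family_scalar u l2 (fun v => (h1 v).1) da.
have [_ E1] := h1 (a y0).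
have E2 := derive_comp u dc (dG (a y0) (b y0)).
split; first exact: d2.
apply: (etrans D2); apply: (etrans (congr2 +%R erefl E1)).
apply: (etrans (congr2 +%R erefl (congr2 +%R erefl E2))).
apply: (etrans (addrA _ _ _)); rewrite cy; reflexivity.
Qed.

Lemma derive_metric_rep_linear p u w :
  scalar (fun v => 'D_u (metric_rep g p v w) (chart p p)).
Proof.
have pp := dom_center p.
move=> c v1 v2.
have E : \forall y \near chart p p, metric_rep g p (c *: v1 + v2) w y =
    (c *: metric_rep g p v1 w + metric_rep g p v2 w) y.
  by apply: filterS (near_chart_image pp) => y yp; exact: (metric_rep_linear w yp).
have d v : derivable (metric_rep g p v w) (chart p p) u.
  by apply: diff_derivable; exact: metric_rep_differentiable.
rewrite (near_eq_derive _ E) deriveD; last 2 first.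
- by apply: derivableZ; exact: d.
- exact: d.
by rewrite deriveZ//; exact: d.
Qed.

(** The right-hand side of Koszul's formula is linear in w, hence represented
    by a vector. *)
Lemma christoffelP p u v w : 2 * g p (christoffel g p u v) w =
  'D_u (metric_rep g p v w) (chart p p) + 'D_v (metric_rep g p u w) (chart p p)
  - 'D_w (metric_rep g p u v) (chart p p).
Proof.
have pp := dom_center p.
have Dl u1 v1 : scalar (fun w => 'D_u1 (metric_rep g p v1 w) (chart p p)).
  by move=> c w1 w2; rewrite !(metric_rep_sym p v1); exact: derive_metric_rep_linear.
have Dw : scalar (fun w => 'D_w (metric_rep g p u v) (chart p p)).
  by move=> c w1 w2; apply: derive_linear; exact: metric_rep_differentiable.
have [c Hc] := riesz (riemannian_inner p) (half_sum_scalar (Dl u v) (Dl v u) Dw).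
suff : [set c | forall w : 'rV[R]_n,
    2 * g p c w = 'D_u (metric_rep g p v w) (chart p p)
                + 'D_v (metric_rep g p u w) (chart p p)
                - 'D_w (metric_rep g p u v) (chart p p)] (christoffel g p u v) by exact.
apply: (@xgetI _ 0 _ c) => w' /=.
have two0 : (2 : R) != 0 by rewrite pnatr_eq0.
apply: (etrans (congr1 ( *%R 2) (Hc w'))); exact: (mulVKf two0).
Qed.

Lemma christoffel_sym p u v : christoffel g p u v = christoffel g p v u.
Proof.
apply: (inner_inj (riemannian_inner p)) => w.
have h := christoffelP p v u w; rewrite (metric_rep_sym p v u) in h.
exact: koszul_eq (christoffelP p u v w) h.
Qed.

(** Koszul's formulas for (u, v, w) and (u, w, v) add up to the derivative of
    the metric: this is the compatibility of the connection with the metric in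
    coordinates. *)
Lemma christoffel_metric p u v w :
  'D_u (metric_rep g p v w) (chart p p) =
  g p (christoffel g p u v) w + g p v (christoffel g p u w).
Proof.
have h := christoffelP p u w v; rewrite (metric_rep_sym p w v) in h.
rewrite (innerC (riemannian_inner p) v).
exact: koszul_add (christoffelP p u v w) h.
Qed.

End Metric.

(** * Covariant derivatives along maps *)

Section ChristoffelLinear.
Context {R : realType} {n : nat} {M : smoothManifold R n}.
Variable g : M -> 'rV[R]_n -> 'rV[R]_n -> R.
Hypothesis rg : riemannian g.

Lemma koszul_linear (c a1 a2 a x1 x2 y1 y2 z1 z2 : R) :
  2 * a1 = x1 + y1 - z1 -> 2 * a2 = x2 + y2 - z2 ->
  2 * a = (c * x1 + x2) + (c * y1 + y2) - (c * z1 + z2) -> a = c * a1 + a2.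
Proof.
move=> h1 h2 h; have two0 : (2 : R) != 0 by rewrite pnatr_eq0.
by apply: (mulfI two0); rewrite h mulrDr mulrCA h1 h2; ring.
Qed.

Lemma christoffel_linear p u : linear (christoffel g p u).
Proof.
move=> c v1 v2; apply: (inner_inj (riemannian_inner rg p)) => w.
rewrite (innerP (riemannian_inner rg p)).
apply: (koszul_linear (christoffelP rg p u v1 w) (christoffelP rg p u v2 w)).
apply: (etrans (christoffelP rg p u _ w)).
apply: congr2; first apply: congr2.
- exact: (derive_metric_rep_linear rg).
- exact: derive_linear (metric_rep_differentiable rg u w (dom_center p)).
- congr (- _); rewrite !(metric_rep_sym rg p u); exact: (derive_metric_rep_linear rg).
Qed.

End ChristoffelLinear.

Section Leibniz.
Context {R : realType} {V : normedModType R} {m : nat}.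

Lemma derive_scale (k : V -> R) (a : V -> 'rV[R]_m) y u :
  differentiable k y -> differentiable a y ->
  differentiable (fun z => k z *: a z) y /\
  'D_u (fun z => k z *: a z) y = k y *: 'D_u a y + 'D_u k y *: a y.
Proof.
move=> dk da.
have dai i : differentiable (fun z => a z 0 i) y by move/differentiable_rVP : da; exact.
have E i : (fun z => (k z *: a z) 0 i) = k * (fun z => a z 0 i).
  by apply/funext => z; rewrite mxE.
have dka : differentiable (fun z => k z *: a z) y.
  by apply/differentiable_rVP => i; rewrite E; exact: differentiableM.
split => //; apply/rowP => i; rewrite derive_rV// E.
rewrite deriveM; try exact: diff_derivable.
by rewrite !mxE derive_rV//; congr (_ + _); exact: mulrC.
Qed.

End Leibniz.

Section Covariant.
Context {R : realType} {n m : nat} {N : smoothManifold R n} {M : smoothManifold R m}.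
Variables (g : M -> 'rV[R]_m -> 'rV[R]_m -> R) (f : N -> M).
Hypotheses (rg : riemannian g) (sf : smooth_map f).

(** Differentiability at q of a field along f, in the chart used by the
    covariant derivative. *)
Definition diff_along (V : N -> 'rV[R]_m) (q : N) : Prop :=
  differentiable (field_rep f V q (f q)) (chart q q).

Lemma near_dom_rep q : \forall y \near chart q q,
  [/\ dom q (chart_inv q y), dom (f q) (f (chart_inv q y)) & chart q (chart_inv q y) = y].
Proof. have H := near_chart_dom_rep sf (dom_center q) (dom_center (f q)); exact H. Qed.

Lemma cov_add (V W : N -> 'rV[R]_m) q u : diff_along V q -> diff_along W q ->
  diff_along (fun x => V x + W x) q /\
  cov g f (fun x => V x + W x) q u = cov g f V q u + cov g f W q u.
Proof.
move=> dV dW.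
have E : \forall y \near chart q q, (field_rep f V q (f q) + field_rep f W q (f q)) y =
    field_rep f (fun x => V x + W x) q (f q) y.
  apply: filterS (near_dom_rep q) => y [_ py _]; rewrite /field_rep !fctE.
  have := tchange_linear (dom_center (f (chart_inv q y))) py 1.
  by move/(_ (V (chart_inv q y)) (W (chart_inv q y))); rewrite !scale1r => ->.
split.
  by apply: near_eq_differentiable E _; exact: differentiableD.
have D := etrans (esym (near_eq_derive u E)) (deriveD (diff_derivable (v := u) dV) (diff_derivable (v := u) dW)).
have := christoffel_linear rg (f q) (tmap f q u) 1 (V q) (W q); rewrite !scale1r => G.
by apply: (etrans (congr2 +%R D G)); exact: addrACA.
Qed.

Lemma cov_scale (k : N -> R) (V : N -> 'rV[R]_m) q u :
  differentiable (k \o chart_inv q) (chart q q) -> diff_along V q ->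
  diff_along (fun x => k x *: V x) q /\
  cov g f (fun x => k x *: V x) q u =
    k q *: cov g f V q u + 'D_u (k \o chart_inv q) (chart q q) *: V q.
Proof.
move=> dk dV.
have E : \forall y \near chart q q, (k \o chart_inv q) y *: field_rep f V q (f q) y =
    field_rep f (fun x => k x *: V x) q (f q) y.
  apply: filterS (near_dom_rep q) => y [_ py _]; rewrite /field_rep /=.
  have := tchange_linear (dom_center (f (chart_inv q y))) py (k (chart_inv q y)) (V (chart_inv q y)) 0.
  by rewrite !addr0 => ->; rewrite /tchange derive0 addr0.
have [d D] := derive_scale u dk dV.
split; first by apply: near_eq_differentiable E _; exact: d.
rewrite /cov -(near_eq_derive u E) D /= chartK; last exact: dom_center.
rewrite field_rep_center.
have := christoffel_linear rg (f q) (tmap f q u) (k q) (V q) 0.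
have G0 : christoffel g (f q) (tmap f q u) 0 = 0.
  have := christoffel_linear rg (f q) (tmap f q u) 1 0 0.
  by rewrite !scale1r addr0 => /eqP; rewrite -subr_eq0 opprD addrA subrr add0r oppr_eq0 => /eqP.
by rewrite G0 !addr0 => ->; rewrite scalerDr addrAC.
Qed.

(** In coordinates the derivative of g (V, W) has a term from the derivatives
    of the components and one from the derivative of the metric tensor; the
    latter is the sum of the two Christoffel terms. *)
Lemma cov_metric (V W : N -> 'rV[R]_m) q u : diff_along V q -> diff_along W q ->
  differentiable (fun y => g (f (chart_inv q y)) (V (chart_inv q y)) (W (chart_inv q y))) (chart q q) /\
  'D_u (fun y => g (f (chart_inv q y)) (V (chart_inv q y)) (W (chart_inv q y))) (chart q q) =
    g (f q) (cov g f V q u) (W q) + g (f q) (V q) (cov g f W q u).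
Proof.
move=> dV dW; have qq := dom_center q; have ff := dom_center (f q).
pose c := chart (f q) \o f \o chart_inv q.
have E : \forall y \near chart q q,
    metric_rep g (f q) (field_rep f V q (f q) y) (field_rep f W q (f q) y) (c y) =
    g (f (chart_inv q y)) (V (chart_inv q y)) (W (chart_inv q y)).
  by apply: filterS (near_dom_rep q) => y [_ py _]; exact: metric_repE.
have dc : differentiable c (chart q q) by exact: rep_differentiable.
have cq : c (chart q q) = chart (f q) (f q) by rewrite /c /= chartK.
have [d D] := derive_metric_rep rg u ff cq dV dW dc.
split; first by apply: near_eq_differentiable E _; exact: d.
apply: (etrans (esym (near_eq_derive u E))); apply: (etrans D).
rewrite !field_rep_center !metric_rep_center.
have -> : 'D_u c (chart q q) = tmap f q u by [].
rewrite (christoffel_metric rg) /cov.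
rewrite (innerDl (riemannian_inner rg _)) (innerDr (riemannian_inner rg _)).
exact: addrACA.
Qed.

(** The field df (v), for v constant in the chart at q, has as components the
    partial derivatives of f in the direction v. *)
Lemma field_rep_constant q p v : dom p (f q) -> \forall y \near chart q q,
  'D_v (chart p \o f \o chart_inv q) y =
  field_rep f (fun x => tmap f x (tchange q x x v)) q p y.
Proof.
move=> pq; apply: filterS (near_chart_dom_rep sf (dom_center q) pq) => y [qy py yE].
have F : field_rep idfun (fun x => tchange q x x v) q q y = v.
  have xx := dom_center (chart_inv q y).
  exact: (etrans (tchange_comp v qy xx qy) (tchange_id v qy)).
have H := field_rep_tmap sf (fun x => tchange q x x v) qy py; rewrite yE F in H.
by rewrite H /dmap yE.
Qed.

Lemma diff_along_constant q v : diff_along (fun x => tmap f x (tchange q x x v)) q.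
Proof.
apply: near_eq_differentiable (field_rep_constant v (dom_center (f q))) _.
apply: (smooth_on_diff (smooth_on_derive v (rep_smooth sf (a := q) (b := f q)))).
by exists q => //; split; exact: dom_center.
Qed.

(** For fields that are constant in the chart at q, the absence of torsion is
    the symmetry of the second derivatives of f and of the Christoffel
    symbols. *)
Lemma cov_torsion_free q u v :
  cov g f (fun x => tmap f x (tchange q x x v)) q u =
  cov g f (fun x => tmap f x (tchange q x x u)) q v.
Proof.
have Q : (chart q @` chart_dom f q (f q)) (chart q q).
  by exists q => //; split; exact: dom_center.
have E w z := near_eq_derive z (field_rep_constant w (dom_center (f q))).
rewrite /cov; apply: (congr2 +%R).
  apply: (etrans (esym (E v u))); apply: (etrans _ (E u v)).
  exact: (clairaut _ _ (@open_chart_dom_rep _ _ _ _ _ _ sf q (f q)) (@rep_smooth _ _ _ _ _ _ sf q (f q)) Q).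
rewrite (tchange_id u (dom_center q)) (tchange_id v (dom_center q)).
exact: christoffel_sym.
Qed.

End Covariant.

Section Pullback.
Context {R : realType} {n m l : nat} {L : smoothManifold R l}
  {N : smoothManifold R n} {M : smoothManifold R m}.
Variables (g : M -> 'rV[R]_m -> 'rV[R]_m -> R) (f : N -> M) (i : L -> N).
Hypotheses (sf : smooth_map f) (si : smooth_map i).

Lemma tmap_comp q u : tmap f (i q) (tmap i q u) = tmap (f \o i) q u.
Proof. by apply: dmap_comp => //; exact: dom_center. Qed.

(** The Christoffel term at a point depends on the field and the direction
    there only, so the claim is the chain rule for the components. *)
Lemma cov_pullback (V : N -> 'rV[R]_m) q u : diff_along f V (i q) ->
  diff_along (f \o i) (V \o i) q /\
  cov g (f \o i) (V \o i) q u = cov g f V (i q) (tmap i q u).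
Proof.
move=> dV; have qq := dom_center q; have ii := dom_center (i q).
pose c := chart (i q) \o i \o chart_inv q.
have E : \forall y \near chart q q, (field_rep f V (i q) (f (i q)) \o c) y =
    field_rep (f \o i) (V \o i) q (f (i q)) y.
  by apply: filterS (near_dom_rep si q) => y [_ py _]; rewrite /field_rep /= chartK.
have dc : differentiable c (chart q q) by exact: rep_differentiable.
have cq : c (chart q q) = chart (i q) (i q) by rewrite /c /= chartK.
have dVc : differentiable (field_rep f V (i q) (f (i q))) (c (chart q q)) by rewrite cq.
split.
  by apply: near_eq_differentiable E _; exact: differentiable_comp.
rewrite /cov; apply: (congr2 +%R); last by rewrite tmap_comp.
apply: (etrans (esym (near_eq_derive u E))).
by apply: (etrans (derive_comp u dc dVc)); rewrite cq.
Qed.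

End Pullback.

(** * Isometric immersions and the Gauss formula *)

Section SmoothMetric.
Context {R : realType} {n : nat} {M : smoothManifold R n}.
Variable g : M -> 'rV[R]_n -> 'rV[R]_n -> R.
Hypothesis rg : riemannian g.

Lemma smooth_metric_rep k (A : set 'rV[R]_k) (a b c : 'rV[R]_k -> 'rV[R]_n) p :
  open A -> smooth_on A a -> smooth_on A b -> smooth_on A c ->
  (forall y, A y -> (chart p @` dom p) (c y)) ->
  smooth_on A (fun y => metric_rep g p (a y) (b y) (c y)).
Proof.
move=> oA sa sb sc Ac.
apply: (@smooth_linear_family_scalar _ _ A _ (fun y v => metric_rep g p v (b y) (c y))) => //.
  by move=> y Ay; exact: (metric_rep_linear rg (b y) (Ac y Ay)).
move=> v.
apply: (@smooth_linear_family_scalar _ _ A _ (fun y w => metric_rep g p v w (c y))) => //.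
  move=> y Ay r w1 w2; rewrite !(metric_rep_sym rg p v).
  exact: (metric_rep_linear rg v (Ac y Ay)).
move=> w; apply: (@smooth_on_comp _ _ _ oA _ (chart p @` dom p)) => //.
exact: metric_rep_smooth.
Qed.

End SmoothMetric.

Section Induced.
Context {R : realType} {n m : nat} {N : smoothManifold R n} {M : smoothManifold R m}.
Variables (g : M -> 'rV[R]_m -> 'rV[R]_m -> R) (f : N -> M).
Hypotheses (rg : riemannian g) (imf : immersion f).
Let sf : smooth_map f := imf.1.

Lemma tchange_tmap_constant q p x v : dom q x -> dom p (f x) ->
  tchange (f x) p (f x) (tmap f x (tchange q x x v)) = dmap f q p x v.
Proof.
move=> qx px; have xx := dom_center x; have ff := dom_center (f x).
have -> : tmap f x (tchange q x x v) = dmap f q (f x) x v.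
  exact: (@dmap_tchange _ _ _ _ _ f sf x (f x) q x v xx qx ff).
exact: tchange_dmap.
Qed.

Lemma induced_rep q p x v w : dom q x -> dom p (f x) ->
  metric_rep (induced_metric g f) q v w (chart q x) =
  metric_rep g p (dmap f q p x v) (dmap f q p x w) (chart p (f x)).
Proof.
move=> qx px.
rewrite -(tchange_tmap_constant v qx px) -(tchange_tmap_constant w qx px).
by rewrite (metric_repE _ _ _ px) /metric_rep /= chartK.
Qed.

Lemma tmap0 q : tmap f q 0 = 0.
Proof. exact: derive0. Qed.

Lemma induced_inner q : inner (induced_metric g f q).
Proof.
have ig := riemannian_inner rg (f q).
split=> [w c u v|v w|v v0]; rewrite /induced_metric.
- by rewrite (tmap_linear sf) (innerP ig).
- exact: innerC.
- have [_ _ gp] := ig; apply: gp; apply: contra_neq v0 => fv0.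
  by case: imf => _ /(_ q); apply; rewrite fv0 tmap0.
Qed.

Lemma riemannian_induced : riemannian (induced_metric g f).
Proof.
split=> [p w|p v w|p v v0|q v w].
- by have [+ _ _] := induced_inner p; exact.
- exact: innerC (induced_inner p) v w.
- by have [_ _] := induced_inner p; exact.
apply: smooth_on_loc => _ [x qx <-].
pose A := chart q @` chart_dom f q (f x).
have oA : open A by exact: open_chart_dom_rep.
exists A; first by exists x => //; split => //; exact: dom_center.
pose c := chart (f x) \o f \o chart_inv q.
have sc : smooth_on A c by exact: rep_smooth.
apply: (@smooth_on_eq _ _ _ _ (fun y => metric_rep g (f x) ('D_v c y) ('D_w c y) (c y))) => //.
  by move=> _ [z [qz pz] <-]; rewrite (induced_rep v w qz pz) /c /= chartK.
apply: smooth_metric_rep => //; try exact: smooth_on_derive.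
by move=> _ [z [qz pz] <-]; exists (f z) => //; rewrite /c /= chartK.
Qed.

Lemma koszul_symmetric (x y z t : R) : 2 * x = (y + z) + (y + t) - (z + t) -> x = y.
Proof. lra. Qed.

(** The field df (b), with b constant in the chart, has a covariant derivative
    C a b that is symmetric in a and b. Expressing the derivatives of the
    induced metric through C by metricity, Koszul's formula for the induced
    metric leaves exactly 2 g (C a b, df w). *)
Lemma gauss_constant q a b w :
  induced_metric g f q (christoffel (induced_metric g f) q a b) w =
  g (f q) (cov g f (fun x => tmap f x (tchange q x x b)) q a) (tmap f q w).
Proof.
have ig := riemannian_inner rg (f q).
pose C u v := cov g f (fun x => tmap f x (tchange q x x v)) q u.
have CC u v : C u v = C v u by exact: cov_torsion_free.
have D u v1 v2 : 'D_u (metric_rep (induced_metric g f) q v1 v2) (chart q q) =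
    g (f q) (C u v1) (tmap f q v2) + g (f q) (tmap f q v1) (C u v2).
  have [_ H] := cov_metric rg sf u (diff_along_constant sf q v1)
    (diff_along_constant sf q v2).
  apply: (etrans H).
  have e v := tchange_id v (dom_center q).
  exact: (congr2 +%R (congr1 (fun z => g (f q) (C u v1) (tmap f q z)) (e v2))
    (congr1 (fun z => g (f q) (tmap f q z) (C u v2)) (e v1))).
have := etrans (christoffelP riemannian_induced q a b w)
  (congr2 (fun x y => x - y) (congr2 +%R (D a b w) (D b a w)) (D w a b)).
rewrite -/(C a b); move: C CC {D} => C CC.
rewrite (CC b a) (CC w a) (CC w b).
rewrite (innerC ig (C a w) (tmap f q b)).
exact: koszul_symmetric.
Qed.

End Induced.

Section Gauss.
Context {R : realType} {l n m : nat} {L : smoothManifold R l}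
  {N : smoothManifold R n} {M : smoothManifold R m}.
Variables (g : M -> 'rV[R]_m -> 'rV[R]_m -> R) (f : N -> M) (i : L -> N).
Hypotheses (rg : riemannian g) (imf : immersion f) (si : smooth_map i).
Let sf : smooth_map f := imf.1.

(** The product rule for df (V), with V a field along i: one term
    differentiates the components of V and the other the differential of f,
    the vector V q being kept constant in the chart at i q. *)
Lemma cov_tmap (V : L -> 'rV[R]_n) q u : diff_along i V q ->
  diff_along (f \o i) (fun x => tmap f (i x) (V x)) q /\
  cov g (f \o i) (fun x => tmap f (i x) (V x)) q u =
    tmap f (i q) ('D_u (field_rep i V q (i q)) (chart q q)) +
    cov g f (fun x => tmap f x (tchange (i q) x x (V q))) (i q) (tmap i q u).
Proof.
move=> dV; have qq := dom_center q; have ii := dom_center (i q).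
have ff := dom_center (f (i q)).
pose p := i q; pose P := f p.
pose c := chart p \o i \o chart_inv q.
pose F := chart P \o f \o chart_inv p.
have oF := @open_chart_dom_rep _ _ _ _ _ f sf p P.
have sF := @rep_smooth _ _ _ _ _ f sf p P.
have dc : differentiable c (chart q q) by exact: rep_differentiable.
have cq : c (chart q q) = chart p p by rewrite /c /= chartK.
have Fp : (chart p @` chart_dom f p P) (chart p p) by exists p.
have E : \forall y \near chart q q, 'D_(field_rep i V q p y) F (c y) =
    field_rep (f \o i) (fun x => tmap f (i x) (V x)) q P y.
  have sfi := smooth_map_comp si sf.
  apply: filterS2 (near_chart_dom_rep sfi qq ff) (near_dom_rep si q) => y.
  move=> [qy Py _] [_ py _]; rewrite /field_rep /=.
  have xx := dom_center (i (chart_inv q y)).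
  apply: (etrans (@dmap_tchange _ _ _ _ _ f sf p P (i (chart_inv q y)) (i (chart_inv q y)) _ py xx Py)).
  by apply/esym; apply: tchange_dmap => //; exact: dom_center.
have dFv v : differentiable ('D_v F) (c (chart q q)).
  by rewrite cq; exact: (smooth_on_diff (smooth_on_derive v sF) Fp).
have Fn : \forall y \near chart q q, linear (fun v => 'D_v F (c y)).
  have cc := differentiable_continuous dc.
  have : \forall y \near chart q q, (chart p @` chart_dom f p P) (c y).
    by apply: (cc (chart p @` chart_dom f p P)); rewrite cq; exact: open_nbhs_nbhs.
  apply: filterS => y Ay r v1 v2; apply: derive_linear.
  exact: (smooth_on_diff sF Ay).
have dFc v : differentiable (fun y => 'D_v F (c y)) (chart q q).
  exact: differentiable_comp dc (dFv v).
have [d D] := derive_linear_family u Fn dFc dV.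
split; first by apply: near_eq_differentiable E _; exact: d.
have D1 := etrans (esym (near_eq_derive u E)) D.
have D2 := derive_comp u dc (dFv (field_rep i V q p (chart q q))).
have {}D2 : 'D_u (fun y => 'D_(field_rep i V q p (chart q q)) F (c y)) (chart q q) =
    'D_(tmap i q u) ('D_(V q) F) (chart p p).
  have fc := @field_rep_center _ _ _ _ _ i V q.
  exact: (etrans D2 (congr2 (fun a b => 'D_(tmap i q u) ('D_a F) b) fc cq)).
have D3 := near_eq_derive (tmap i q u) (field_rep_constant sf (q := p) (p := P) (V q) ff).
have D4 := congr1 (fun b => 'D_('D_u (field_rep i V q p) (chart q q)) F b) cq.
have tq := tchange_id (V q) (dom_center p).
have G : christoffel g P (tmap (f \o i) q u) (tmap f p (V q)) =
    christoffel g P (tmap f p (tmap i q u)) (tmap f p (tchange p p p (V q))).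
  by rewrite (tmap_comp sf si) tq.
apply: (etrans (congr2 +%R (etrans D1 (congr2 +%R D4 (etrans D2 D3))) G)).
exact: (esym (addrA _ _ _)).
Qed.

(** The tangential part of the ambient covariant derivative of df (V) is the
    covariant derivative of V for the induced metric. By cov_tmap it suffices
    to treat fields that are constant in a chart. *)
Lemma gauss (V : L -> 'rV[R]_n) q u w : diff_along i V q ->
  g (f (i q)) (cov g (f \o i) (fun x => tmap f (i x) (V x)) q u) (tmap f (i q) w) =
  induced_metric g f (i q) (cov (induced_metric g f) i V q u) w.
Proof.
move=> dV; have [_ ->] := cov_tmap u dV.
rewrite (innerDl (riemannian_inner rg _)) -(gauss_constant rg imf).
by rewrite /cov (innerDl (induced_inner rg imf _)).
Qed.

End Gauss.

Lemma sub_common (R : zmodType) (a a' b c : R) : a = a' -> a + b - (a' + c) = b - c.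
Proof. by move=> ->; rewrite opprD addrACA subrr add0r. Qed.

(** * Exterior derivatives of one-forms *)

Section OneForm.
Context {R : realType} {n : nat} {M : smoothManifold R n}.
Variable omega : M -> 'rV[R]_n -> R.

Definition form_rep (p : M) (v y : 'rV[R]_n) : R :=
  let x := chart_inv p y in omega x (tchange p x x v).

(** The exterior derivative on vectors with constant components in the chart
    at p; the bracket term of the invariant formula is then zero. *)
Definition dform (p : M) (v w y : 'rV[R]_n) : R :=
  'D_v (form_rep p w) y - 'D_w (form_rep p v) y.

Hypothesis lo : forall x, scalar (omega x).

(** Passing from the chart at p to the chart at x produces the second
    derivatives of the coordinate change, which cancel by symmetry. This
    invariance is what allows a pointwise formula for the exterior derivative
    to be used on a whole neighbourhood in one chart. *)
Lemma dform_chart p x v w : dom p x ->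
  (forall u, differentiable (form_rep x u) (chart x x)) ->
  dform p v w (chart p x) = dform x (tchange p x x v) (tchange p x x w) (chart x x).
Proof.
move=> px dfo; have xx := dom_center x.
have sid := @smooth_map_id _ _ M.
pose A := chart p @` chart_dom idfun p x.
have oA : open A by exact: (open_chart_dom_rep sid).
pose t := chart x \o @idfun M \o chart_inv p.
have st : smooth_on A t by exact: (rep_smooth sid).
have Ax : A (chart p x) by exists x.
have dt := smooth_on_diff st Ax.
have tx : t (chart p x) = chart x x by rewrite /t /= chartK.
have key u1 u2 : 'D_u1 (form_rep p u2) (chart p x) =
    form_rep x ('D_u1 ('D_u2 t) (chart p x)) (chart x x) +
    'D_(tchange p x x u1) (form_rep x (tchange p x x u2)) (chart x x).
  have E : \forall y \near chart p x, form_rep x ('D_u2 t y) (t y) = form_rep p u2 y.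
    apply: filterS (near_chart_dom_rep sid px xx) => y [py xy yE].
    rewrite /form_rep /= chartK//; congr (omega _ _).
    have zz := dom_center (chart_inv p y).
    apply: (etrans _ (tchange_comp u2 py xy zz)); congr (tchange _ _ _ _).
    by rewrite -{1}yE.
  have dxt v1 : differentiable (form_rep x v1) (t (chart p x)) by rewrite tx.
  have dl : \forall y \near chart p x, scalar (fun v => form_rep x v (t y)).
    apply: filterS (near_chart_dom_rep sid px xx) => y [py xy yE] r v1 v2.
    have tz : chart_inv x (t y) = chart_inv p y by exact: chartK.
    rewrite /form_rep tz (tchange_linear xy (dom_center (chart_inv p y))).
    exact: lo.
  have dxc v1 : differentiable (fun y => form_rep x v1 (t y)) (chart p x).
    exact: differentiable_comp dt (dxt v1).
  have dd : differentiable ('D_u2 t) (chart p x).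
    exact: (smooth_on_diff (smooth_on_derive u2 st) Ax).
  have [_ D] := derive_linear_family_scalar u1 dl dxc dd.
  apply: (etrans (esym (near_eq_derive u1 E))); apply: (etrans D).
  have D2 := derive_comp u1 dt (dxt ('D_u2 t (chart p x))).
  exact: (congr2 +%R (congr1 (form_rep x ('D_u1 ('D_u2 t) (chart p x))) tx)
    (etrans D2 (congr1 ('D_(tchange p x x u1) (form_rep x (tchange p x x u2))) tx))).
rewrite /dform; apply: (etrans (congr2 (fun a b => a - b) (key v w) (key w v))).
exact: sub_common (congr1 (fun z => form_rep x z (chart x x)) (clairaut v w oA st Ax)).
Qed.

End OneForm.

Section MetricForm.
Context {R : realType} {n m : nat} {N : smoothManifold R n} {M : smoothManifold R m}.
Variables (g : M -> 'rV[R]_m -> 'rV[R]_m -> R) (f : N -> M).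
Hypotheses (rg : riemannian g) (sf : smooth_map f).
Variable W : N -> 'rV[R]_m.

(** The one-form dual to a field W along f. *)
Definition metric_form (x : N) (u : 'rV[R]_n) : R := g (f x) (tmap f x u) (W x).

Lemma metric_form_linear x : scalar (metric_form x).
Proof. by move=> c u v; rewrite /metric_form (tmap_linear sf) (innerP (riemannian_inner rg _)). Qed.

Lemma metric_form_differentiable q v : diff_along f W q ->
  differentiable (form_rep metric_form q v) (chart q q).
Proof. by move=> dW; have [] := cov_metric rg sf v (diff_along_constant sf q v) dW. Qed.

(** The terms that differentiate df cancel because the connection is
    torsion-free; only derivatives of W remain. *)
Lemma dform_metric q v w : diff_along f W q ->
  dform metric_form q v w (chart q q) =
  g (f q) (tmap f q w) (cov g f W q v) - g (f q) (tmap f q v) (cov g f W q w).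
Proof.
move=> dW; have ig := riemannian_inner rg (f q).
have [_ D1] := cov_metric rg sf v (diff_along_constant sf q w) dW.
have [_ D2] := cov_metric rg sf w (diff_along_constant sf q v) dW.
apply: (etrans (congr2 (fun a b => a - b) D1 D2)).
rewrite (tchange_id v (dom_center q)) (tchange_id w (dom_center q)).
exact: sub_common (congr1 (fun z => g (f q) z (W q)) (cov_torsion_free rg sf q v w)).
Qed.

End MetricForm.

(** * Cut-off functions *)

Section Bump.
Context {R : realType}.

(** The functions t ^ (- k) exp (- 1 / t), extended by zero: the derivative of
    each of them is a combination of the next two, so their span is stable
    under derivation. *)
Definition flat (k : nat) (t : R) : R :=
  if 0 < t then t^-1 ^+ k * expR (- t^-1) else 0.

(** The exponential dominates a term of its power series, which gives a
    quadratic bound at the origin and hence a vanishing derivative there. *)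
Lemma flat_le k (t : R) : `|flat k t| <= (k.+2)`!%:R * `|t| ^+ 2.
Proof.
rewrite /flat; case: ifP => t0; last by rewrite normr0 mulr_ge0// exprn_ge0.
set u := t^-1; have u0 : 0 < u by rewrite invr_gt0.
have f0 : 0 < (k.+2)`!%:R :> R by rewrite ltr0n fact_gt0.
(* u ^ (k + 2) / (k + 2)! <= exp u *)
have := expR_ge1Dxn k.+1 (ltW u0) => h.
have {}h : u ^+ k.+2 <= (k.+2)`!%:R * expR u.
  by rewrite mulrC -ler_pdivrMr//; apply: le_trans h; rewrite lerDr.
rewrite ger0_norm ?mulr_ge0 ?exprn_ge0 ?expR_ge0 ?(ltW u0)//.
rewrite (gtr0_norm t0) expRN ler_pdivrMr ?expR_gt0//.
have -> : u ^+ k = u ^+ k.+2 * t ^+ 2.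
  by rewrite -addn2 exprD -mulrA -exprMn /u mulVf ?gt_eqF// expr1n mulr1.
by rewrite [leRHS]mulrAC ler_wpM2r// exprn_ge0// ltW.
Qed.

Lemma is_derive_flat k (t : R) :
  is_derive t 1 (flat k) (- k%:R * flat k.+1 t + flat k.+2 t).
Proof.
have [t0|t0|->] := ltgtP t 0.
- have -> : - k%:R * flat k.+1 t + flat k.+2 t = 0.
    by rewrite /flat ltNge (ltW t0) /= mulr0 addr0.
  have E : \forall s \near t, cst 0 s = flat k s.
    by apply: filterS (lt_nbhsl t0) => s s0; rewrite /flat ltNge (ltW s0).
  apply: near_eq_is_derive E _; exact: is_derive_cst.
- have tn0 : t != 0 by rewrite gt_eqF.
  have du : is_derive t 1 (fun s : R => s^-1) (- t ^- 2).
    apply: DeriveDef; first exact: (@derivableV _ _ id).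
    by rewrite (@deriveV _ _ id)// derive_id; exact: mulr1.
  have dH : is_derive (t^-1) 1 (fun u : R => u ^+ k * expR (- u))
      (k%:R * t^-1 ^+ k.-1 * expR (- t^-1) - t^-1 ^+ k * expR (- t^-1)).
    have de : is_derive (t^-1) 1 (fun u : R => expR (- u)) (expR (- t^-1) * -1).
      by apply: (@is_derive1_comp _ expR -%R); exact: is_deriveNid.
    have dX : is_derive (t^-1) 1 (fun u : R => u ^+ k) (k%:R * t^-1 ^+ k.-1).
      apply: DeriveDef; first exact: exprn_derivable.
      by apply: (etrans (exp_derive _ _ _)); rewrite /GRing.scale /= mulr1.
    have := @is_deriveM _ _ (fun u : R => u ^+ k) (fun u => expR (- u)) _ _ _ _ dX de.
    move=> H; apply: is_derive_eq; rewrite /GRing.scale /=; ring.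
  have E : \forall s \near t, ((fun u : R => u ^+ k * expR (- u)) \o (fun s => s^-1)) s = flat k s.
    by apply: filterS (lt_nbhsr t0) => s s0; rewrite /flat s0.
  apply: near_eq_is_derive E _.
  have H := @is_derive1_comp R (fun u : R => u ^+ k * expR (- u)) (fun s : R => s^-1) t _ _ dH du.
  apply: (@is_derive_eq _ _ _ _ _ _ _ _ H).
  rewrite /flat t0 -exprVn; case: k {dH H} => [|k] /=; first by rewrite !expr0 expr1; ring.
  by rewrite !exprS; ring.
- have -> : - k%:R * flat k.+1 0 + flat k.+2 0 = (0 : R).
    by rewrite /flat ltxx mulr0 addr0.
  have [|||d D] := @differentiable_quadratic_remainder R R R (flat k) \0 0 (k.+2)`!%:R 1.
  + exact: cst_continuous.
  + exact: ltr01.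
  + move=> h _; rewrite add0r {2}/flat ltxx !subr0; exact: flat_le.
  + by apply: DeriveDef; [exact: diff_derivable|rewrite D].
Qed.

Inductive flat_span : ('rV[R]_1 -> R) -> Prop :=
| Span_flat k : flat_span (fun z => flat k (z 0 0))
| Span_add F G of flat_span F & flat_span G : flat_span (fun z => F z + G z)
| Span_scale c F of flat_span F : flat_span (fun z => c * F z).

Lemma smooth_flat k : smooth_on [set: 'rV[R]_1] (fun z => flat k (z 0 0)).
Proof.
apply: (@smooth_on_coind _ _ _ _ flat_span); [exact: openT| |exact: Span_flat].
move=> f0; elim=> {f0} [{}k|F G _ [dF DF] _ [dG DG]|c F _ [dF DF]].
- have dc (z : 'rV[R]_1) : differentiable (fun z : 'rV[R]_1 => z 0 0) z by exact: differentiable_coord.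
  have df (t : R) : differentiable (flat k) t.
    by apply/derivable1_diffP; have [] := is_derive_flat k t.
  split=> [x _|v]; first exact: differentiable_comp (dc x) (df _).
  exists (fun z : 'rV[R]_1 => v 0 0 * (- k%:R * flat k.+1 (z 0 0) + flat k.+2 (z 0 0))).
    by apply: Span_scale; apply: Span_add; [apply: Span_scale|]; exact: Span_flat.
  move=> x _; apply: (etrans (derive_comp v (dc x) (df _))).
  rewrite -(derive_rV (f := id))// derive_id.
  rewrite -[v 0 0 in LHS]mulr1 -[v 0 0 * 1]/(v 0 0 *: 1) -[_ *: 1]addr0.
  rewrite derive_linear// derive0 addr0; have [_ ->] := is_derive_flat k (x 0 0).
  reflexivity.
- split=> [x _|v].
    by apply: (@differentiableD _ _ _ F G); [exact: dF|exact: dG].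
  have [F' sF' EF] := DF v; have [G' sG' EG] := DG v.
  exists (fun z => F' z + G' z); first exact: Span_add.
  move=> x _; rewrite -EF// -EG//; apply: (@deriveD _ _ _ F G);
    apply: diff_derivable; [exact: dF|exact: dG].
- split=> [x _|v].
    by apply: (@differentiableZ _ _ _ F); exact: dF.
  have [F' sF' EF] := DF v.
  exists (fun z => c * F' z); first exact: Span_scale.
  by move=> x _; rewrite -EF//; apply: (@deriveZ _ _ _ F); apply: diff_derivable; exact: dF.
Qed.

(** The flat function of r ^ 2 - |y - c| ^ 2 for the Euclidean norm,
    normalised at c. Its derivative at c is zero because it is invariant under
    the reflection at c. *)
Lemma bump_function n (c : 'rV[R]_n) (r : R) : 0 < r -> exists psi : 'rV[R]_n -> R,
  [/\ smooth_on [set: 'rV[R]_n] psi, psi c = 1, forall u, 'D_u psi c = 0 &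
      forall y, r <= `|y - c| -> psi y = 0].
Proof.
move=> r0.
pose h (y : 'rV[R]_n) := r ^+ 2 - \sum_i (y 0 i - c 0 i) ^+ 2.
have hc : h c = r ^+ 2.
  by rewrite /h big1 ?subr0// => i _; rewrite subrr expr2 mul0r.
have sh : smooth_on [set: 'rV[R]_n] h.
  have oT := @openT 'rV[R]_n.
  apply: smooth_onD => //; first exact: smooth_on_cst.
  under eq_fun do rewrite -mulN1r.
  apply: smooth_onM => //; first exact: smooth_on_cst.
  apply: smooth_on_sum => // i _; under eq_fun do rewrite expr2.
  have s1 : smooth_on [set: 'rV[R]_n] (fun y => y 0 i - c 0 i).
    by apply: smooth_onD => //; [exact: smooth_on_coord|exact: smooth_on_cst].
  exact: smooth_onM.
have F0 : flat 0 (r ^+ 2) != 0.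
  by rewrite /flat exprn_gt0// expr0 mul1r expR_eq0.
pose psi y := flat 0 (h y) / flat 0 (r ^+ 2).
have spsi : smooth_on [set: 'rV[R]_n] psi.
  have oT := @openT 'rV[R]_n.
  apply: smooth_onM => //; last exact: smooth_on_cst.
  have sr : smooth_on [set: 'rV[R]_n] (fun y => \row_(i < 1) h y).
    by apply/smooth_on_rVP => // i; under eq_fun do rewrite mxE.
  have H := @smooth_on_comp R n setT oT 1 setT _ _ sr (smooth_flat 0) (fun _ _ => I).
  by apply: smooth_on_eq oT _ H => y _; rewrite mxE.
exists psi; split => //.
- by rewrite /psi hc mulfV.
- move=> u.
  (* psi is even about c, so its derivative there is equal to its opposite *)
  have refl (y : 'rV[R]_n) : psi (c + c - y) = psi y.
    rewrite /psi; congr (flat 0 _ / _); congr (_ - _); apply: eq_bigr => i _.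
    by rewrite !mxE -sqrrN; congr (_ ^+ 2); ring.
  have dr : differentiable (fun y => c + c - y) c.
    exact: (@differentiableB _ _ _ (cst (c + c)) id).
  have Dr : 'D_u (fun y => c + c - y) c = - u.
    have -> : (fun y => c + c - y) = cst (c + c) - id by [].
    by rewrite deriveB ?derive_cst ?derive_id ?sub0r.
  have cc : c + c - c = c by rewrite addrK.
  have dpsi : differentiable psi (c + c - c) by exact: (smooth_on_diff spsi).
  have : 'D_u psi c = 'D_(- u) psi c.
    rewrite -{1}(funext refl).
    by apply: (etrans (derive_comp u dr dpsi)); rewrite Dr cc.
  have d0 : differentiable psi c by rewrite -[c]cc.
  rewrite -scaleN1r -[-1 *: u]addr0 derive_linear// derive0 addr0 scaleN1r.
  by lra.
- move=> y ry; rewrite /psi /flat.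
  have -> : (0 < h y) = false; last by rewrite mul0r.
  apply/negbTE; rewrite -leNgt subr_le0.
  rewrite leNgt; apply/negP => sr.
  set S := \sum_i _ in sr; have S0 : 0 <= S by apply: sumr_ge0 => i _; exact: sqr_ge0.
  have : `|y - c| <= Num.sqrt S.
    apply: normr_rV_le => [|i]; first exact: sqrtr_ge0.
    rewrite !mxE -sqrtr_sqr ler_sqrt//.
    by apply: (ler_term_sum (F := fun i => (y 0 i - c 0 i) ^+ 2)) => j; exact: sqr_ge0.
  move/(le_trans ry); rewrite leNgt => /negP; apply.
  by rewrite -(ger0_norm (ltW r0)) -sqrtr_sqr ltr_sqrt// exprn_gt0.
Qed.

End Bump.

Section Extension.
Context {R : realType} {n : nat} {M : smoothManifold R n}.
Implicit Types x q p : M.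

(** The components in another chart are the image of F under the differential
    of the coordinate change, a smooth family of linear maps. *)
Lemma coordinate_field_smooth x0 (O : set M) (F : 'rV[R]_n -> 'rV[R]_n) :
  open O -> O `<=` dom x0 -> smooth_on (chart x0 @` O) F ->
  smooth_field_on O idfun (fun x => tchange x0 x x (F (chart x0 x))).
Proof.
move=> oO Ox sF q p.
have sid := @smooth_map_id _ _ M.
set A := [set chart q x | x in _].
have oA : open A.
  apply: open_chart_image => [|z [[]]//].
  by apply: openI; [apply: openI => //; exact: dom_open|exact: dom_open].
pose t := chart x0 \o @idfun M \o chart_inv q.
pose G := chart p \o @idfun M \o chart_inv x0.
have st : smooth_on A t.
  apply: smooth_onW (@rep_smooth _ _ _ _ _ _ sid q x0).
  by move=> _ [z [[Oz qz] pz] <-]; exists z => //; split => //; exact: Ox.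
have sG := @rep_smooth _ _ _ _ _ _ sid x0 p.
have oG := @open_chart_dom_rep _ _ _ _ _ _ sid x0 p.
have At y : A y -> (chart x0 @` chart_dom idfun x0 p) (t y).
  move=> [z [[Oz qz] pz] <-]; exists z; first by split => //; exact: Ox.
  by rewrite /t /= chartK.
have AO y : A y -> (chart x0 @` O) (t y).
  by move=> [z [[Oz qz] pz] <-]; exists z => //; rewrite /t /= chartK.
have oO' : open (chart x0 @` O) by exact: open_chart_image.
apply: (@smooth_on_eq _ _ _ _ (fun y => 'D_(F (t y)) G (t y))) => //.
  move=> _ [z [[Oz qz] pz] <-]; rewrite /field_rep /t /= chartK//.
  have zz := dom_center z.
  exact: esym (tchange_comp _ (Ox z Oz) zz pz).
apply: (@smooth_linear_family _ _ A _ _ (fun y v => 'D_v G (t y)) (fun y => F (t y))) => //.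
- move=> y Ay c v w; apply: derive_linear; exact: (smooth_on_diff sG (At y Ay)).
- move=> v; apply: (@smooth_on_comp_rV _ _ _ oA _ _ _ _ ('D_v G) oG st _ At).
  exact: smooth_on_derive.
- exact: (@smooth_on_comp_rV _ _ _ oA _ _ _ _ F oO' st sF AO).
Qed.

(** A bump function in the chart at x0, extended by zero. The value 1 and the
    vanishing derivative at x0 ensure that multiplying a field by k changes
    neither its value nor its covariant derivatives at x0. Smoothness outside
    the chart holds because the support is compact, hence closed: this is
    where the Hausdorff property enters. *)
Lemma cutoff x0 (O : set M) : open O -> O x0 ->
  exists k : M -> R, [/\ k x0 = 1, forall x, ~ O x -> k x = 0,
    differentiable (k \o chart_inv x0) (chart x0 x0),
    forall u, 'D_u (k \o chart_inv x0) (chart x0 x0) = 0 &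
    forall X, smooth_field_on O idfun X -> vector_field (fun x => k x *: X x)].
Proof.
move=> oO Ox0; have dx := dom_center x0; pose c := chart x0 x0.
pose O' := O `&` dom x0.
have oO' : open O' by apply: openI => //; exact: dom_open.
have oA : open (chart x0 @` O') by apply: open_chart_image => // z [].
have [r r0 Hr] : exists2 r, 0 < r & forall y, `|y - c| <= r -> (chart x0 @` O') y.
  have /nbhs_ballP[e /= e0 He] : nbhs c (chart x0 @` O').
    by apply: open_nbhs_nbhs; split => //; exists x0.
  exists (e / 2); first by rewrite divr_gt0.
  move=> y ye; apply: He; rewrite -ball_normE /ball_ /= distrC (le_lt_trans ye)//.
  by rewrite ltr_pdivrMr// ltr_pMr// ltr1n.
have [psi [spsi psic Dpsi psi0]] := bump_function c r0.
pose k x := if `[< dom x0 x >] then psi (chart x0 x) else 0.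
have kE x : dom x0 x -> k x = psi (chart x0 x) by rewrite /k => /asboolP ->.
pose Bc := [set y : 'rV[R]_n | `|y - c| <= r].
pose K := chart_inv x0 @` Bc.
(* the support of k is contained in the image of a closed ball, a compact set *)
have cK : closed K.
  apply: compact_closed; first exact: points_hausdorff.
  apply: continuous_compact.
    apply: continuous_in_subspaceT => y /set_mem yB.
    apply: chart_inv_continuous; have [z [_ xz] <-] := Hr y yB; by exists z.
  apply: bounded_closed_compact.
    exists (`|c| + r); split; first exact: num_real.
    move=> s sr y /= yB; rewrite -[y](subrK c); apply: le_trans (ler_normD _ _) _.
    by apply: le_trans _ (ltW sr); rewrite addrC lerD2l.
  have cn : continuous (fun y : 'rV[R]_n => `|y - c|).
    apply: (@lipschitz_continuous _ _ _ _ 1) => s t; rewrite mul1r.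
    by apply: le_trans (ler_dist_dist _ _) _; rewrite opprB addrA subrK.
  exact: ((continuous_closedP _).1 cn _ (@closed_le _ r)).
have KO' : K `<=` O'.
  by move=> _ [y yB <-]; have [z [Oz xz] <-] := Hr y yB; rewrite chartK.
have k0 x : ~ K x -> k x = 0.
  move=> nK; rewrite /k; case: asboolP => // xx; apply: psi0.
  rewrite leNgt; apply/negP => h; apply: nK.
  by exists (chart x0 x); [exact: ltW|rewrite chartK].
have kn : \forall y \near c, psi y = (k \o chart_inv x0) y.
  apply: filterS (near_chart_image dx) => y /chart_image_invK[xy yE].
  by rewrite /= kE// yE.
exists k; split.
- by rewrite kE.
- by move=> x nO; apply: k0 => /KO'[].
- by apply: near_eq_differentiable kn _; exact: (smooth_on_diff spsi).
- by move=> u; apply: (etrans (esym (near_eq_derive u kn))).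
move=> X sX q p.
have sid := @smooth_map_id _ _ M.
apply: smooth_on_loc => _ [z [[_ qz] pz] <-].
have repE x : dom q x -> dom p x ->
    field_rep idfun (fun x => k x *: X x) q p (chart q x) =
    k x *: field_rep idfun X q p (chart q x).
  move=> qx px; rewrite /field_rep /= chartK//.
  have := tchange_linear (dom_center x) px (k x) (X x) 0.
  have t0 : tchange x p x 0 = 0 by exact: derive0.
  by rewrite t0 !addr0.
have [Kz|nKz] := pselect (K z).
- have [Oz xz] := KO' z Kz.
  pose W := (O `&` dom q `&` idfun @^-1` dom p) `&` dom x0.
  have oW : open (chart q @` W).
    apply: open_chart_image => [|w [[[]]]//]; apply: openI; last exact: dom_open.
    by apply: openI; [apply: openI => //; exact: dom_open|exact: dom_open].
  exists (chart q @` W); first by exists z.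
  pose t := chart x0 \o @idfun M \o chart_inv q.
  apply: (@smooth_on_eq _ _ _ _ (fun y => psi (t y) *: field_rep idfun X q p y)) => //.
    by move=> _ [w [[[Ow qw] pw] xw] <-]; rewrite repE// kE// /t /= chartK.
  apply/smooth_on_rVP => // i; under eq_fun do rewrite mxE.
  apply: smooth_onM => //.
    apply: (@smooth_on_comp _ _ _ oW _ setT t psi) => //.
    apply: smooth_onW (@rep_smooth _ _ _ _ _ _ sid q x0).
    by move=> _ [w [[[Ow qw] pw] xw] <-]; exists w.
  apply: (smooth_on_rVP _ oW).1; apply: smooth_onW (sX q p).
  by move=> _ [w [Ww _] <-]; exists w.
- pose W := (~` K `&` dom q) `&` dom p.
  have oW : open (chart q @` W).
    apply: open_chart_image => [|w [[]]//].
    apply: openI; last exact: dom_open.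
    by apply: openI; [exact: closed_openC|exact: dom_open].
  exists (chart q @` W); first by exists z.
  apply: (@smooth_on_eq _ _ _ _ (fun=> 0)) => //; last exact: smooth_on_cst.
  by move=> _ [w [[nKw qw] pw] <-]; rewrite repE// k0// scale0r.
Qed.

Lemma constant_field_smooth x0 v :
  smooth_field_on (dom x0) idfun (fun x => tchange x0 x x v).
Proof.
apply: (@coordinate_field_smooth x0 (dom x0) (fun=> v)) => //; first exact: dom_open.
by apply: smooth_on_cst; exact: chart_image_open.
Qed.

End Extension.

(** * Sasakian structures *)

Section Solve.
Context {R : realType} {k n : nat}.

(** By Cramer's rule the solution of a linear system depends smoothly on the
    system. *)
Lemma smooth_solve (A : set 'rV[R]_k) (G : 'rV[R]_k -> 'M[R]_n) (c s : 'rV[R]_k -> 'rV[R]_n) :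
  open A -> (forall i j, smooth_on A (fun y => G y i j)) ->
  (forall y, A y -> G y \in unitmx) -> (forall y, A y -> c y *m G y = s y) ->
  smooth_on A s -> smooth_on A c.
Proof.
move=> oA sG uG cG ss.
apply: (@smooth_on_eq _ _ _ _ (fun y => s y *m invmx (G y))) => //.
  by move=> y Ay; rewrite -cG// mulmxK// uG.
apply/smooth_on_rVP => // j; apply: smooth_on_mulmx => //.
  by move=> i l; rewrite (ord1 i); exact: (smooth_on_rVP _ oA).1.
exact: smooth_on_invmx.
Qed.

End Solve.

Section RepInner.
Context {R : realType} {n : nat} {M : smoothManifold R n}.
Variable g : M -> 'rV[R]_n -> 'rV[R]_n -> R.
Hypothesis rg : riemannian g.

Lemma metric_rep_inner p y : (chart p @` dom p) y ->
  inner (fun v w => metric_rep g p v w y).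
Proof.
move=> yp; split=> [w|v w|v v0].
- exact: metric_rep_linear.
- by rewrite metric_rep_sym.
have [x px xy] := yp; rewrite -xy /metric_rep /= chartK//.
have [_ _ gp] := riemannian_inner rg x; apply: gp; apply: contra_neq v0 => tv0.
have xx := dom_center x.
rewrite -[v](tchange_id v px) -(tchange_comp v px xx px) tv0; exact: derive0.
Qed.

Lemma gram_rep_smooth p i j :
  smooth_on (chart p @` dom p) (fun y => gram (fun v w => metric_rep g p v w y) i j).
Proof. by under eq_fun do rewrite mxE; exact: metric_rep_smooth. Qed.

Lemma gram_rep_unit p y : (chart p @` dom p) y ->
  gram (fun v w => metric_rep g p v w y) \in unitmx.
Proof. by move=> yp; exact: gram_unit (metric_rep_inner yp). Qed.

End RepInner.

Section VectorField.
Context {R : realType} {n : nat} {M : smoothManifold R n}.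

Lemma vector_field_rep (X : M -> 'rV[R]_n) p : vector_field X ->
  smooth_on (chart p @` dom p) (field_rep idfun X p p).
Proof.
by move=> /(_ p p); apply: smooth_onW => _ [x px <-]; exists x.
Qed.

Lemma local_field_diff_along (X : M -> 'rV[R]_n) (O : set M) p : open O -> O p ->
  smooth_field_on O idfun X -> diff_along idfun X p.
Proof.
move=> oO Op /(_ p p) sX; apply: (smooth_on_diff sX).
by exists p => //; split; [split => //; exact: dom_center|exact: dom_center].
Qed.

Lemma vector_field_diff_along (X : M -> 'rV[R]_n) p : vector_field X ->
  diff_along idfun X p.
Proof. exact: local_field_diff_along openT I. Qed.

Lemma tmap_id (x : M) u : tmap idfun x u = u.
Proof. exact: tchange_id u (dom_center x). Qed.

Lemma extend_vector (p : M) v : exists2 X : M -> 'rV[R]_n, vector_field X & X p = v.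
Proof.
have [k [kp _ _ _ kX]] := cutoff (@dom_open _ _ M p) (dom_center p).
exists (fun x => k x *: tchange p x x v).
  by apply: kX; exact: constant_field_smooth.
by rewrite kp scale1r tchange_id//; exact: dom_center.
Qed.

End VectorField.

Section Sasakian.
Context {R : realType} {m : nat} {Mbar : smoothManifold R (2 * m + 1)}.
Notation T := 'rV[R]_(2 * m + 1).
Variables (g : Mbar -> T -> T -> R) (phi : Mbar -> T -> T) (xi : Mbar -> T)
  (eta : Mbar -> T -> R).
Hypothesis sas : sasakian g phi xi eta.

Let rg : riemannian g := let: conj (And4 r _ _ _) _ := sas in r.

Lemma sasakian_riemannian : riemannian g. Proof. exact: rg. Qed.

Let vxi : vector_field xi := let: conj (And4 _ _ v _) _ := sas in v.
Let ig p : inner (g p) := riemannian_inner rg p.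

Lemma phi_linear p : linear (phi p).
Proof. by have [[_ [lphi _] _ _] _] := sas; exact: lphi. Qed.

Lemma eta_scalar p : scalar (eta p).
Proof. by have [[_ _ _ [leta _]] _] := sas; exact: leta. Qed.

Lemma phi0 p : phi p 0 = 0.
Proof.
have := phi_linear p (-1) 0 0.
by rewrite scaler0 addr0 scaleN1r addNr.
Qed.

Lemma phiN p v : phi p (- v) = - phi p v.
Proof. by have := phi_linear p (-1) v 0; rewrite phi0 !addr0 !scaleN1r. Qed.

Lemma phiD p v w : phi p (v + w) = phi p v + phi p w.
Proof. by have := phi_linear p 1 v w; rewrite !scale1r. Qed.

Lemma phiB p v w : phi p (v - w) = phi p v - phi p w.
Proof. by rewrite phiD phiN. Qed.

Lemma phiZ p a v : phi p (a *: v) = a *: phi p v.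
Proof. by have := phi_linear p a v 0; rewrite phi0 !addr0. Qed.

Lemma phiphi p v : phi p (phi p v) = - v + eta p v *: xi p.
Proof. by have [_ [+ _ _ _ _]] := sas; exact. Qed.

Lemma eta_xi p : eta p (xi p) = 1.
Proof. by have [_ [_ + _ _ _]] := sas; exact. Qed.

Lemma phi_xi p : phi p (xi p) = 0.
Proof. by have [_ [_ _ + _ _]] := sas; exact. Qed.

Lemma g_phi_phi p v w : g p (phi p v) (phi p w) = g p v w - eta p v * eta p w.
Proof. by have [_ [_ _ _ + _]] := sas; exact. Qed.

(** The isometry property of phi applied to v and xi, as phi xi = 0. *)
Lemma g_xi p v : g p v (xi p) = eta p v.
Proof.
have := g_phi_phi p v (xi p); rewrite phi_xi (inner0r (ig p)) eta_xi mulr1.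
by move/esym/eqP; rewrite subr_eq0 => /eqP.
Qed.

(** Computing phi ^ 3 in two ways shows that eta (phi v) xi vanishes. *)
Lemma eta_phi p v : eta p (phi p v) = 0.
Proof.
have : phi p (phi p (phi p v)) = - phi p v.
  by rewrite (phiphi p v) phiD phiN phiZ phi_xi scaler0 addr0.
rewrite phiphi => /eqP; rewrite addrC -subr_eq0 opprK addrNK => /eqP H.
have := congr1 (eta p) H; have := eta_scalar p (eta p (phi p v)) (xi p) 0.
have e0 : eta p 0 = 0 by rewrite -g_xi (inner0l (ig p)).
by rewrite e0 !addr0 eta_xi => ->; rewrite mulr1.
Qed.

Lemma g_phi_skew p v w : g p (phi p v) w = - g p v (phi p w).
Proof.
have := g_phi_phi p v (phi p w); rewrite eta_phi mulr0 subr0 phiphi.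
rewrite (innerDr (ig p)) (innerNr (ig p)) (innerZr (ig p)) g_xi eta_phi mulr0 addr0.
by move=> /eqP; rewrite eqr_oppLR => /eqP.
Qed.

Lemma cov_phi_identity X Y p : vector_field X -> vector_field Y ->
  cov g idfun (fun x => phi x (Y x)) p (X p) =
  phi p (cov g idfun Y p (X p)) + (g p (X p) (Y p) *: xi p - eta p (Y p) *: X p).
Proof.
move=> vX vY; have [_ [_ _ _ _ H]] := sas.
by rewrite -(H X Y vX vY p) addrC subrK.
Qed.

Lemma cov_zero n (N : smoothManifold R n) (f : N -> Mbar) p u : cov g f (fun=> 0) p u = 0.
Proof.
rewrite /cov.
have -> : field_rep f (fun=> 0) p (f p) = fun=> 0.
  by apply/funext => y; exact: derive0.
rewrite (derive_cst 0) add0r.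
have := christoffel_linear rg (f p) (tmap f p u) (-1) 0 0.
by rewrite scaler0 addr0 scaleN1r addNr.
Qed.

(** The Sasakian identity for Y = xi reads 0 = phi (nabla_u xi) + eta (u) xi -
    u. Applying phi again gives nabla_u xi, because this vector is orthogonal
    to xi, which has constant length. *)
Lemma cov_xi p u : cov g idfun xi p u = - phi p u.
Proof.
have [X vX Xp] := extend_vector p u.
have := cov_phi_identity p vX vxi.
have -> : (fun x => phi x (xi x)) = fun=> 0 by apply/funext => x; exact: phi_xi.
rewrite cov_zero Xp g_xi eta_xi scale1r => H.
have dxi := vector_field_diff_along p vxi.
have sid := @smooth_map_id _ _ Mbar.
(* xi has constant length *)
have etac : eta p (cov g idfun xi p u) = 0.
  have [_ D] := cov_metric rg sid u dxi dxi.
  have E : (fun y => g (idfun (chart_inv p y)) (xi (chart_inv p y)) (xi (chart_inv p y))) = fun=> 1.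
    by apply/funext => y; rewrite g_xi eta_xi.
  rewrite E derive_cst (innerC (ig _) (xi _)) /= g_xi in D.
  by move: D; move: (eta p _) => z; lra.
have := congr1 (phi p) H.
rewrite phi0 phiD phiphi etac scale0r addr0 phiB phiZ phi_xi scaler0 sub0r.
by move=> /esym/eqP; rewrite addr_eq0 eqr_opp => /eqP.
Qed.

Definition phi_rep p (v y : T) : T :=
  let x := chart_inv p y in tchange x p x (phi x (tchange p x x v)).

Lemma form_rep_xi p v y : (chart p @` dom p) y ->
  form_rep (metric_form g idfun xi) p v y = metric_rep g p v (field_rep idfun xi p p y) y.
Proof.
move=> [x px <-]; rewrite /form_rep /metric_form /field_rep /metric_rep /= chartK//.
by rewrite tmap_id tchange_comp ?tchange_id//; exact: dom_center.
Qed.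

Lemma form_rep_xi_smooth p v :
  smooth_on (chart p @` dom p) (form_rep (metric_form g idfun xi) p v).
Proof.
have oA := @chart_image_open _ _ Mbar p.
apply: (@smooth_on_eq _ _ _ _ (fun y => metric_rep g p v (field_rep idfun xi p p y) y)) => //.
  by move=> y yp; rewrite form_rep_xi.
apply: (smooth_metric_rep rg) => //.
- exact: smooth_on_cst.
- exact: vector_field_rep.
- exact: smooth_on_id.
Qed.

(** The exterior derivative of eta on a and b, once nabla xi is replaced by -
    phi. *)
Lemma xi_skew p a b : g p b (- phi p a) - g p a (- phi p b) = - 2 * g p (phi p a) b.
Proof.
rewrite !(innerNr (ig p)) (innerC (ig p) b) (g_phi_skew p a b) opprK.
by move: (g p a _) => z; ring.
Qed.

(** The identity d eta (v, w) = - 2 g (phi v, w) in coordinates: d eta is the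
    skew part of nabla xi = - phi, and phi is skew already. *)
Lemma dform_xi p x v w : dom p x ->
  dform (metric_form g idfun xi) p v w (chart p x) =
  - 2 * metric_rep g p (phi_rep p v (chart p x)) w (chart p x).
Proof.
move=> px; have xx := dom_center x; have sid := @smooth_map_id _ _ Mbar.
have dxi z := vector_field_diff_along z vxi.
have lo z : scalar (metric_form g idfun xi z) by exact: (metric_form_linear rg sid).
have dfo z u : differentiable (form_rep (metric_form g idfun xi) z u) (chart z z).
  exact: (metric_form_differentiable rg sid u (dxi z)).
have E : metric_rep g p (phi_rep p v (chart p x)) w (chart p x) =
    g x (phi x (tchange p x x v)) (tchange p x x w).
  have t z : tchange p x x (tchange x p x z) = z.
    exact: (etrans (tchange_comp z xx px xx) (tchange_id z xx)).
  by rewrite /metric_rep /phi_rep (chartK px) t.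
apply: (etrans (dform_chart lo v w px (dfo x))).
apply: (etrans (dform_metric rg sid _ _ (dxi x))).
rewrite E (cov_xi x (tchange p x x v)) (cov_xi x (tchange p x x w)).
rewrite (tmap_id x (tchange p x x v)) (tmap_id x (tchange p x x w)).
exact: xi_skew.
Qed.

(** By dform_xi the components of phi solve a linear system whose matrix is
    the Gram matrix and whose right-hand side is the exterior derivative of
    eta, and both of these are smooth. *)
Lemma phi_rep_smooth p v : smooth_on (chart p @` dom p) (phi_rep p v).
Proof.
have oA := @chart_image_open _ _ Mbar p.
apply: (@smooth_solve _ _ _ _ (fun y => gram (fun v w => metric_rep g p v w y)) _
  (fun y => \row_j (- 2^-1 * dform (metric_form g idfun xi) p v (delta_mx 0 j) y))) => //.
- exact: gram_rep_smooth.
- exact: gram_rep_unit.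
- move=> _ [x px <-]; apply/rowP => j; have yp : (chart p @` dom p) (chart p x) by exists x.
  rewrite (mulmx_gram (metric_rep_inner rg yp)) mxE (dform_xi v _ px) mulrA.
  by rewrite mulrNN mulVf ?mul1r// pnatr_eq0.
apply/smooth_on_rVP => // j; under eq_fun do rewrite mxE.
apply: smooth_onM => //; first exact: smooth_on_cst.
apply: smooth_onD => //; first by apply: smooth_on_derive; exact: form_rep_xi_smooth.
under eq_fun do rewrite -mulN1r.
apply: smooth_onM => //; first exact: smooth_on_cst.
by apply: smooth_on_derive; exact: form_rep_xi_smooth.
Qed.

Lemma phi_rep_linear p y : (chart p @` dom p) y -> linear (fun v => phi_rep p v y).
Proof.
move=> [x px <-] c v w; have xx := dom_center x.
rewrite /phi_rep /= chartK// (tchange_linear px xx) phi_linear.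
exact: tchange_linear.
Qed.

Lemma phi_rep_center p v : phi_rep p v (chart p p) = phi p v.
Proof. by have pp := dom_center p; rewrite /phi_rep /= chartK// !tchange_id. Qed.

Section PhiAlong.
Context {n : nat} {N : smoothManifold R n}.
Variable f : N -> Mbar.
Hypothesis sf : smooth_map f.

Lemma field_rep_phi V q y : dom (f q) (f (chart_inv q y)) ->
  chart q (chart_inv q y) = y ->
  field_rep f (fun x => phi (f x) (V x)) q (f q) y =
  phi_rep (f q) (field_rep f V q (f q) y) ((chart (f q) \o f \o chart_inv q) y).
Proof.
move=> py yE; have zz := dom_center (f (chart_inv q y)).
have e : chart_inv (f q) ((chart (f q) \o f \o chart_inv q) y) = f (chart_inv q y).
  exact: chartK.
rewrite /phi_rep e /field_rep; congr (tchange _ _ _ (phi _ _)).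
exact: esym (etrans (tchange_comp _ zz py zz) (tchange_id _ zz)).
Qed.

(** The covariant derivative of the tensor phi in the direction a, evaluated
    on b. *)
Definition phi_derivative p (a b : T) : T :=
  'D_a (phi_rep p b) (chart p p) + christoffel g p a (phi p b)
  - phi p (christoffel g p a b).

(** The Leibniz rule in coordinates. It isolates a term that depends on the
    values of the direction and of the field only, so that the Sasakian
    identity, which is about vector fields, can be transferred to fields along
    a map. *)
Lemma cov_phi_expand V q u : diff_along f V q ->
  diff_along f (fun x => phi (f x) (V x)) q /\
  cov g f (fun x => phi (f x) (V x)) q u =
    phi (f q) (cov g f V q u) + phi_derivative (f q) (tmap f q u) (V q).
Proof.
move=> dV; have ff := dom_center (f q); have qq := dom_center q.
pose c := chart (f q) \o f \o chart_inv q.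
have dc : differentiable c (chart q q) by exact: rep_differentiable.
have cq : c (chart q q) = chart (f q) (f q) by rewrite /c /= chartK.
have E : \forall y \near chart q q, phi_rep (f q) (field_rep f V q (f q) y) (c y) =
    field_rep f (fun x => phi (f x) (V x)) q (f q) y.
  by apply: filterS (near_dom_rep sf q) => y [qy py yE]; rewrite field_rep_phi.
have dp v : differentiable (phi_rep (f q) v) (c (chart q q)).
  by rewrite cq; apply: smooth_on_diff (phi_rep_smooth v) _; exists (f q).
have dpc v : differentiable (fun y => phi_rep (f q) v (c y)) (chart q q).
  exact: differentiable_comp dc (dp v).
have lp : \forall y \near chart q q, linear (fun v => phi_rep (f q) v (c y)).
  apply: filterS (near_dom_rep sf q) => y [qy py yE]; apply: phi_rep_linear.
  by exists (f (chart_inv q y)).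
have [d D] := derive_linear_family u lp dpc dV.
split; first by apply: near_eq_differentiable E _; exact: d.
have D1 := etrans (esym (near_eq_derive u E)) D.
have D2 := derive_comp u dc (dp (field_rep f V q (f q) (chart q q))).
have fc := @field_rep_center _ _ _ _ _ f V q.
have D3 : phi_rep (f q) ('D_u (field_rep f V q (f q)) (chart q q)) (c (chart q q)) =
    phi (f q) ('D_u (field_rep f V q (f q)) (chart q q)).
  by apply: (etrans (congr1 (phi_rep (f q) _) cq)); exact: phi_rep_center.
have D4 := etrans D2 (congr2 (fun a b => 'D_(tmap f q u) (phi_rep (f q) a) b) fc cq).
rewrite /cov phiD /phi_derivative.
apply: (etrans (congr2 +%R (etrans D1 (congr2 +%R D3 D4)) erefl)).
move: (phi _ ('D_u _ _)) ('D_(tmap f q u) _ _) => A B.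
move: (christoffel _ _ _ _) (phi _ (christoffel _ _ _ _)) => C E'.
by apply/rowP => j; rewrite !mxE; ring.
Qed.

End PhiAlong.

(** Both vectors extend to vector fields, for which this is the Sasakian
    identity. *)
Lemma phi_derivativeE p a b :
  phi_derivative p a b = g p a b *: xi p - eta p b *: a.
Proof.
have sid := @smooth_map_id _ _ Mbar.
have [X vX Xp] := extend_vector p a; have [Y vY Yp] := extend_vector p b.
have [_] := cov_phi_expand sid (X p) (vector_field_diff_along p vY).
rewrite (cov_phi_identity p vX vY) tmap_id Xp Yp.
by move/addrI.
Qed.

Section CovariantAlong.
Context {n : nat} {N : smoothManifold R n}.
Variable f : N -> Mbar.
Hypothesis sf : smooth_map f.

Lemma cov_phi_along V q u : diff_along f V q ->
  diff_along f (fun x => phi (f x) (V x)) q /\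
  cov g f (fun x => phi (f x) (V x)) q u =
    phi (f q) (cov g f V q u) +
    (g (f q) (tmap f q u) (V q) *: xi (f q) - eta (f q) (V q) *: tmap f q u).
Proof. by move=> dV; rewrite -phi_derivativeE; exact: cov_phi_expand. Qed.

Lemma cov_xi_along q u : diff_along f (xi \o f) q /\
  cov g f (xi \o f) q u = - phi (f q) (tmap f q u).
Proof.
have sid := @smooth_map_id _ _ Mbar.
have [d D] := cov_pullback g sid sf u (vector_field_diff_along (f q) vxi).
by split; [exact: d|rewrite -cov_xi; exact: D].
Qed.

End CovariantAlong.
End Sasakian.

(** * Tangent and normal parts *)

Section Splitting.
Context {R : realType} {n m : nat} {N : smoothManifold R n} {M : smoothManifold R m}.
Variables (g : M -> 'rV[R]_m -> 'rV[R]_m -> R) (f : N -> M).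
Hypotheses (rg : riemannian g) (imf : immersion f).
Let sf : smooth_map f := imf.1.
Let ig q : inner (g (f q)) := riemannian_inner rg (f q).

Lemma tangent_partP q v w :
  g (f q) (tmap f q (tangent_part g f q v)) (tmap f q w) = g (f q) v (tmap f q w).
Proof.
have [|c Hc] := riesz (induced_inner rg imf q) (l := fun w => g (f q) v (tmap f q w)).
  by move=> a u1 u2; rewrite (tmap_linear sf) (innerC (ig q)) (innerP (ig q)) !(innerC (ig q) _ v).
have Pc := @xgetPex _ 0 [set u | forall w : 'rV[R]_n,
    g (f q) (tmap f q u) (tmap f q w) = g (f q) v (tmap f q w)] (ex_intro _ c Hc).
exact: Pc w.
Qed.

Lemma tangent_normal q v :
  tmap f q (tangent_part g f q v) + normal_part g f q v = v.
Proof. by rewrite /normal_part addrC subrK. Qed.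

Lemma tangent_part_tmap q u : tangent_part g f q (tmap f q u) = u.
Proof.
by apply: (inner_inj (induced_inner rg imf q)) => w; exact: tangent_partP.
Qed.

Lemma normal_part_tmap q u : normal_part g f q (tmap f q u) = 0.
Proof. by rewrite /normal_part tangent_part_tmap subrr. Qed.

(** A normal vector does not see tangential parts; this removes the
    projections from the second fundamental form and from the normal
    connection. *)
Lemma normal_part_pair q v w : (forall u, g (f q) w (tmap f q u) = 0) ->
  g (f q) (normal_part g f q v) w = g (f q) v w.
Proof.
move=> nw; rewrite /normal_part (innerBl (ig q)).
by rewrite (innerC (ig q) (tmap _ _ _)) nw subr0.
Qed.

Lemma smooth_tmap_field (X : N -> 'rV[R]_n) (O : set N) q : open O -> O q ->
  smooth_field_on O idfun X ->
  let A := chart q @` (O `&` chart_dom f q (f q)) in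
  smooth_on A (field_rep f (fun x => tmap f x (X x)) q (f q)).
Proof.
move=> oO Oq sX A.
have oA : open A.
  apply: open_chart_image => [|x [_ []]//]; apply: openI => //; exact: open_chart_dom.
pose c := chart (f q) \o f \o chart_inv q.
have sc : smooth_on A c.
  by apply: smooth_onW (@rep_smooth _ _ _ _ _ _ sf q (f q)) => _ [x [Ox qx] <-]; exists x.
have sX' : smooth_on A (field_rep idfun X q q).
  by apply: smooth_onW (sX q q) => _ [x [Ox [qx _]] <-]; exists x.
apply: (@smooth_on_eq _ _ _ _ (fun y => 'D_(field_rep idfun X q q y) c y)) => //.
  by move=> _ [x [Ox [qx px]] <-]; apply/esym; exact: field_rep_tmap.
apply: (@smooth_linear_family _ _ A _ _ (fun y v => 'D_v c y)) => //.
  by move=> y Ay a v w; apply: derive_linear; exact: (smooth_on_diff sc Ay).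
by move=> v; exact: smooth_on_derive.
Qed.

Lemma diff_along_tmap (X : N -> 'rV[R]_n) (O : set N) q : open O -> O q ->
  smooth_field_on O idfun X -> diff_along f (fun x => tmap f x (X x)) q.
Proof.
move=> oO Oq sX; apply: (smooth_on_diff (smooth_tmap_field oO Oq sX)).
by exists q => //; split => //; split; exact: dom_center.
Qed.

(** The components of the tangential part solve the linear system whose matrix
    is the Gram matrix of the induced metric. *)
Lemma diff_along_tangent_part (V : N -> 'rV[R]_m) q :
  smooth_on (chart q @` chart_dom f q (f q)) (field_rep f V q (f q)) ->
  diff_along f (fun x => tmap f x (tangent_part g f x (V x))) q.
Proof.
move=> sV; set A := chart q @` _ in sV.
have oA : open A by exact: open_chart_dom_rep.
pose c := chart (f q) \o f \o chart_inv q.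
have sc : smooth_on A c by exact: rep_smooth.
have Aq : A (chart q q) by exists q => //; split; exact: dom_center.
have Adom y : A y -> (chart q @` dom q) y by move=> [x [qx _] <-]; exists x.
have ri := riemannian_induced rg imf.
pose T := field_rep idfun (fun x => tangent_part g f x (V x)) q q.
have sT : smooth_on A T.
  apply: (@smooth_solve _ _ _ _
    (fun y => gram (fun v w => metric_rep (induced_metric g f) q v w y)) _
    (fun y => \row_j metric_rep g (f q) (field_rep f V q (f q) y)
       ('D_(delta_mx 0 j) c y) (c y))) => //.
  - by move=> i j; apply: smooth_onW (@gram_rep_smooth _ _ _ _ ri q i j).
  - by move=> y /Adom yq; exact: (gram_rep_unit ri yq).
  - move=> _ [x [qx px] <-]; apply/rowP => j.
    have xq : (chart q @` dom q) (chart q x) by exists x.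
    rewrite (mulmx_gram (metric_rep_inner ri xq)) mxE.
    have cx : c (chart q x) = chart (f q) (f x) by rewrite /c /= chartK.
    have Dc : 'D_(delta_mx 0 j) c (chart q x) =
        tchange (f x) (f q) (f x) (tmap f x (tchange q x x (delta_mx 0 j))).
      by rewrite (tchange_tmap_constant imf _ qx px).
    rewrite Dc cx (field_rep_at f V (f q) qx) (metric_repE g _ _ px).
    have xx := dom_center x.
    have TE := field_rep_at idfun (fun x => tangent_part g f x (V x)) q qx.
    have t := etrans (tchange_comp (tangent_part g f x (V x)) xx qx xx) (tchange_id _ xx).
    rewrite /T TE /metric_rep (chartK qx) t; exact: tangent_partP.
  - apply/smooth_on_rVP => // j; under eq_fun do rewrite mxE.
    apply: (smooth_metric_rep rg) => //; first exact: smooth_on_derive.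
    by move=> _ [x [qx px] <-]; exists (f x) => //; rewrite /c /= chartK.
have dT := smooth_on_diff sT Aq.
have E : \forall y \near chart q q, 'D_(T y) c y =
    field_rep f (fun x => tmap f x (tangent_part g f x (V x))) q (f q) y.
  have : \forall y \near chart q q, A y by exact: open_nbhs_nbhs.
  apply: filterS => _ [x [qx px] <-].
  apply: esym; exact: (field_rep_tmap sf (fun x => tangent_part g f x (V x)) qx px).
apply: near_eq_differentiable E _.
have lA : \forall y \near chart q q, linear (fun v => 'D_v c y).
  have : \forall y \near chart q q, A y by exact: open_nbhs_nbhs.
  by apply: filterS => y Ay a v w; apply: derive_linear; exact: (smooth_on_diff sc Ay).
have dA v : differentiable ('D_v c) (chart q q).
  exact: (smooth_on_diff (smooth_on_derive v sc) Aq).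
by have [] := derive_linear_family 0 lA dA dT.
Qed.

End Splitting.

(** * The annihilator of the ambiguous distribution *)

Section PTR.
Context {R : realType} {m n : nat} {Mbar : smoothManifold R (2 * m + 1)}.
Notation T := 'rV[R]_(2 * m + 1).
Variables (g : Mbar -> T -> T -> R) (phi : Mbar -> T -> T) (xi : Mbar -> T)
  (eta : Mbar -> T -> R).
Context {M : smoothManifold R n}.
Variables (f : M -> Mbar) (D : M -> set 'rV[R]_n).
Hypotheses (sas : sasakian g phi xi eta) (ptr : ptr_submanifold g phi xi eta f D).

Let rg : riemannian g := sasakian_riemannian sas.
Let ig q : inner (g q) := riemannian_inner rg q.
Let imf : immersion f := let: And5 i _ _ _ _ := ptr in i.
Let sf : smooth_map f := imf.1.
Let ii q : inner (induced_metric g f q) := induced_inner rg imf q.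

Notation Dt := (ambiguous_distribution g xi f D).
Notation df X := (fun x => tmap f x (X x)).

Lemma ptr_immersion : immersion f. Proof. exact: imf. Qed.

Lemma ptr_xi q : exists w, tmap f q w = xi (f q).
Proof. by have [_ /(_ q)[w _ <-] _ _ _] := ptr; exists w. Qed.

Lemma ptr_eta q u : D q u -> eta (f q) (tmap f q u) = 0.
Proof. by have [_ _ _ H _] := ptr; exact: H. Qed.

Lemma ptr_normal q u v : D q u -> g (f q) (phi (f q) (tmap f q u)) (tmap f q v) = 0.
Proof. by have [_ _ _ _ H] := ptr; exact: H. Qed.

Lemma ptr_normal_xi q u : D q u -> g (f q) (phi (f q) (tmap f q u)) (xi (f q)) = 0.
Proof. by move=> Du; have [w <-] := ptr_xi q; exact: ptr_normal. Qed.

Lemma smooth_phi_tmap Y q : vector_field Y ->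
  smooth_on (chart q @` chart_dom f q (f q))
    (field_rep f (fun x => phi (f x) (tmap f x (Y x))) q (f q)).
Proof.
move=> vY; set A := chart q @` _.
have oA : open A by exact: open_chart_dom_rep.
have sY : smooth_on A (field_rep f (df Y) q (f q)).
  have := smooth_tmap_field imf openT (I : [set: M] q) vY; rewrite setTI; exact.
pose c := chart (f q) \o f \o chart_inv q.
have sc : smooth_on A c by exact: rep_smooth.
have Ac y : A y -> (chart (f q) @` dom (f q)) (c y).
  by move=> [x [qx px] <-]; exists (f x) => //; rewrite /c /= chartK.
apply: (@smooth_on_eq _ _ _ _ (fun y => phi_rep phi (f q) (field_rep f (df Y) q (f q) y) (c y))) => //.
  move=> _ [x [qx px] <-]; apply/esym; apply: field_rep_phi; first by rewrite chartK.
  by rewrite chartK.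
apply: (@smooth_linear_family _ _ A _ _ (fun y v => phi_rep phi (f q) v (c y))) => //.
  by move=> y Ay; apply: (phi_rep_linear sas); exact: Ac.
move=> v; apply: (@smooth_on_comp_rV _ _ _ oA _ _ (chart (f q) @` dom (f q)) c) => //.
  exact: chart_image_open.
exact: (phi_rep_smooth sas).
Qed.

(** The second fundamental form and the normal connection are the normal parts
    of the derivatives of the two components of phi Y, so their sum pairs with
    the normal vector phi Z as nabla_X (phi Y) does. The Sasakian identity
    reduces this to g (phi (nabla_X Y), phi Z), its other terms being along xi
    and X, which are tangent to M. What remains is g (nabla_X Y, Z), and g (Y,
    Z) = 0 is differentiated. *)
Lemma first_condition_eq X Y Z p : section_of Dt X -> section_of Dt Y ->
  section_of D Z ->
  g (f p)
    (second_fundamental_form g f X (tensorP g phi f Y) p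
     + normal_connection g f X (tensorF g phi f Y) p)
    (phi (f p) (tmap f p (Z p))) =
  - g (f p) (tmap f p (Y p)) (cov g f (df Z) p (X p)).
Proof.
move=> [vX DX] [vY DY] [vZ DZ].
have dY : diff_along f (df Y) p := diff_along_tmap imf openT (I : [set: M] p) vY.
have dZ : diff_along f (df Z) p := diff_along_tmap imf openT (I : [set: M] p) vZ.
have [dphi cphi] := cov_phi_along sas sf (X p) dY.
pose V := fun x => phi (f x) (tmap f x (Y x)).
pose PV := fun x => tmap f x (tangent_part g f x (V x)).
pose FV := fun x => normal_part g f x (V x).
have dP : diff_along f PV p := diff_along_tangent_part rg imf (smooth_phi_tmap vY).
have FE : FV = fun x => V x + (-1) *: PV x.
  by apply/funext => x; rewrite /FV /normal_part scaleN1r.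
have d1 : differentiable ((fun=> -1 : R) \o chart_inv p) (chart p p) by exact: differentiable_cst.
have [dmP _] := cov_scale rg sf (X p) d1 dP.
have dF : diff_along f FV p by rewrite FE; have [] := cov_add rg sf (X p) dphi dmP.
have [_ cPF] := cov_add rg sf (X p) dP dF.
have VE : (fun x => PV x + FV x) = V by apply/funext => x; exact: tangent_normal.
have nZ u : g (f p) (phi (f p) (tmap f p (Z p))) (tmap f p u) = 0 by exact: ptr_normal.
have pair a b : g (f p) (normal_part g f p a + normal_part g f p b) (phi (f p) (tmap f p (Z p))) =
    g (f p) (a + b) (phi (f p) (tmap f p (Z p))).
  apply: (etrans (innerDl (ig (f p)) _ _ _)).
  apply: (etrans (congr2 +%R (normal_part_pair rg a nZ) (normal_part_pair rg b nZ))).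
  exact: esym (innerDl (ig (f p)) _ _ _).
apply: (etrans (pair _ _)).
have cV := etrans (congr1 (fun W => cov g f W p (X p)) (esym VE)) cPF.
apply: (etrans (congr1 (fun z => g (f p) z (phi (f p) (tmap f p (Z p)))) (esym cV))).
apply: (etrans (congr1 (fun z => g (f p) z (phi (f p) (tmap f p (Z p)))) cphi)).
(* the remaining terms of the Sasakian identity are tangent to M *)
have nxi : g (f p) (xi (f p)) (phi (f p) (tmap f p (Z p))) = 0.
  by rewrite (innerC (ig (f p))); exact: ptr_normal_xi.
have nX : g (f p) (tmap f p (X p)) (phi (f p) (tmap f p (Z p))) = 0.
  by rewrite (innerC (ig (f p))).
have drop a b w : g (f p) (w + (a *: xi (f p) - b *: tmap f p (X p))) (phi (f p) (tmap f p (Z p))) =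
    g (f p) w (phi (f p) (tmap f p (Z p))).
  rewrite (innerDl (ig (f p))) (innerBl (ig (f p))) (innerZl (ig (f p))) (innerZl (ig (f p))) nxi nX.
  by rewrite !mulr0 subrr addr0.
apply: (etrans (drop _ _ _)); apply: (etrans (g_phi_phi sas _ _ _)).
rewrite (ptr_eta (DZ p)) mulr0 subr0.
have [_ Dm] := cov_metric rg sf (X p) dY dZ.
have E0 : (fun y => g (f (chart_inv p y)) (tmap f (chart_inv p y) (Y (chart_inv p y)))
    (tmap f (chart_inv p y) (Z (chart_inv p y)))) = fun=> 0.
  by apply/funext => y; have [H _] := DY (chart_inv p y); exact: H (DZ _).
rewrite E0 derive_cst in Dm.
by apply/eqP; rewrite -addr_eq0; apply/eqP; exact: esym Dm.
Qed.

Section Conormal.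
Context {r : nat} (U : set M) (E : 'I_r -> M -> 'rV[R]_n).
Hypotheses (oU : open U) (sE : forall i, smooth_field_on U idfun (E i)).
Hypothesis UE : forall q, U q -> row_free (\matrix_i E i q) /\
  D q = [set v | (v <= \matrix_i E i q)%MS].

(** The vectors, along f, to which the ambiguous distribution is orthogonal:
    xi and the members of the frame. *)
Definition conormal_field (j : 'I_(1 + r)) : M -> T :=
  match fintype.split j with inl _ => xi \o f | inr i => df (E i) end.

Notation omega j := (metric_form g f (conormal_field j)).

(** The columns are the components in the chart at p of the one-forms dual to
    the conormal fields. *)
Definition conormal (p : M) (y : 'rV[R]_n) : 'M[R]_(n, 1 + r) :=
  \matrix_(a, j) form_rep (omega j) p (delta_mx 0 a) y.

Lemma conormal_field_xi (i : 'I_1) : conormal_field (lshift r i) = xi \o f.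
Proof. by rewrite /conormal_field (unsplitK (inl i)). Qed.

Lemma conormal_field_frame i : conormal_field (rshift 1 i) = df (E i).
Proof. by rewrite /conormal_field (unsplitK (inr i)). Qed.

Lemma mulmx_conormal p x v j : dom p x ->
  (v *m conormal p (chart p x)) 0 j = omega j x (tchange p x x v).
Proof.
move=> px; rewrite mxE.
rewrite (@linear_expand _ _ (fun v => omega j x (tchange p x x v))).
  by apply: eq_bigr => a _; rewrite mxE /form_rep /= chartK.
move=> a u w; rewrite (tchange_linear px (dom_center x)).
exact: (metric_form_linear rg sf).
Qed.

Lemma frame_in i q : U q -> D q (E i q).
Proof.
move=> /UE[_ ->] /=.
by have := row_sub i (\matrix_i E i q); rewrite rowK.
Qed.

Lemma frame_expand q u : U q -> D q u -> exists a : 'rV[R]_r, u = \sum_i a 0 i *: E i q.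
Proof.
move=> /UE[_ ->] /= /submxP[a ->]; exists a.
by rewrite mulmx_sum_row; apply: eq_bigr => i _; rewrite rowK.
Qed.

Lemma tmap_sum x (I : Type) (s : seq I) (F : I -> 'rV[R]_n) :
  tmap f x (\sum_(i <- s) F i) = \sum_(i <- s) tmap f x (F i).
Proof.
apply: (big_morph _ _ (tmap0 f x)) => u v.
by have := tmap_linear sf x 1 u v; rewrite !scale1r.
Qed.

Lemma tmapZ x a u : tmap f x (a *: u) = a *: tmap f x u.
Proof. by have := tmap_linear sf x a u 0; rewrite (tmap0 f x) !addr0. Qed.

Lemma inner_sumr k (b : 'rV[R]_k -> 'rV[R]_k -> R) v (I : Type) (s : seq I) (F : I -> 'rV[R]_k) :
  inner b -> b v (\sum_(i <- s) F i) = \sum_(i <- s) b v (F i).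
Proof.
move=> ib; apply: (big_morph _ _ (inner0r ib v)) => u w; exact: innerDr.
Qed.

Lemma conormal_ker p x v : U x -> dom p x ->
  v *m conormal p (chart p x) = 0 <-> Dt x (tchange p x x v).
Proof.
move=> Ux px; split=> [v0|[vD vxi]].
  have oj j : omega j x (tchange p x x v) = 0 by rewrite -mulmx_conormal// v0 mxE.
  split=> [u /(frame_expand Ux)[a ->]|]; last first.
    by have := oj (lshift r 0); rewrite /metric_form conormal_field_xi.
  rewrite (inner_sumr _ _ _ (ii x)) big1// => i _; rewrite (innerZr (ii x)).
  by have := oj (rshift 1 i); rewrite /metric_form conormal_field_frame /induced_metric => ->; rewrite mulr0.
apply/rowP => j; rewrite mulmx_conormal// [RHS]mxE /metric_form.
case: (split_ordP j) => i ->; first by rewrite conormal_field_xi.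
by rewrite conormal_field_frame; apply: vD; exact: frame_in.
Qed.

(** A vanishing linear combination of the columns gives a vector z of M
    orthogonal to itself. Since eta (xi) = 1 and eta vanishes on the frame,
    the coefficient of xi is zero, and the others are because the frame is
    free. *)
Lemma conormal_rank p x : U x -> dom p x -> \rank (conormal p (chart p x)) = (1 + r)%N.
Proof.
move=> Ux px; rewrite -mxrank_tr; apply/eqP; rewrite -/(row_free _).
apply: inj_row_free => a aN.
have [w wxi] := ptr_xi x.
(* the vector dual to the combination a of the forms *)
pose z := a 0 (lshift r 0) *: w + \sum_i a 0 (rshift 1 i) *: E i x.
have zE : tmap f x z = \sum_j a 0 j *: conormal_field j x.
  rewrite big_split_ord big_ord1 /= conormal_field_xi /=.
  rewrite (tmap_linear sf) wxi tmap_sum; congr (_ + _).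
  by apply: eq_bigr => i _; rewrite tmapZ conormal_field_frame.
have z0 : z = 0.
  apply: (inner_eq0 (ii x)); rewrite /induced_metric {2}zE (inner_sumr _ _ _ (ig _)).
  pose v := tchange x p x z.
  have vz : tchange p x x v = z.
    exact: etrans (tchange_comp z (dom_center x) px (dom_center x)) (tchange_id z (dom_center x)).
  have : (a *m (conormal p (chart p x))^T) *m v^T = 0 by rewrite aN mul0mx.
  rewrite -mulmxA -trmx_mul => /(congr1 (fun A : 'M[R]_1 => A 0 0)).
  rewrite mxE [RHS]mxE => H; rewrite -[RHS]H; apply: eq_bigr => j _.
  by rewrite mxE mulmx_conormal// vz (innerZr (ig _)).
have a0 : a 0 (lshift r 0) = 0.
  have : g (f x) (tmap f x z) (xi (f x)) = 0 by rewrite z0 (tmap0 f x) (inner0l (ig _)).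
  rewrite (tmap_linear sf) wxi (innerP (ig _)) !(g_xi sas) (eta_xi sas) mulr1.
  rewrite tmap_sum -(g_xi sas) (innerC (ig _)) (inner_sumr _ _ _ (ig _)) big1 ?addr0//.
  move=> i _; rewrite tmapZ (innerZr (ig _)) (innerC (ig _)) (g_xi sas).
  by rewrite (ptr_eta (frame_in i Ux)) mulr0.
have aE : \row_i a 0 (rshift 1 i) = 0.
  have [free _] := UE Ux; apply: (row_free_inj free); rewrite mul0mx mulmx_sum_row.
  move: z0; rewrite /z a0 scale0r add0r => {2}<-.
  by apply: eq_bigr => i _; rewrite mxE rowK.
apply/rowP => j; rewrite [RHS]mxE; case: (split_ordP j) => i ->.
  by rewrite (ord1 i).
by move/rowP : aE => /(_ i); rewrite !mxE.
Qed.

Lemma conormal_field_smooth p j : U p ->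
  smooth_on (chart p @` (U `&` chart_dom f p (f p)))
    (field_rep f (conormal_field j) p (f p)).
Proof.
move=> Up; case: (split_ordP j) => i ->.
  rewrite conormal_field_xi; set A := chart p @` _.
  have oA : open A.
    by apply: open_chart_image => [|x [_ []]//]; apply: openI => //; exact: open_chart_dom.
  have vxi : vector_field xi by have [[_ _ v _] _] := sas.
  pose c := chart (f p) \o f \o chart_inv p.
  apply: (@smooth_on_eq _ _ _ _ (fun y => field_rep idfun xi (f p) (f p) (c y))) => //.
    by move=> _ [x [Ux [px fx]] <-]; rewrite /field_rep /c /= !chartK.
  apply: (@smooth_on_comp_rV _ _ _ oA _ _ (chart (f p) @` dom (f p)) c).
  - exact: chart_image_open.
  - by apply: smooth_onW (@rep_smooth _ _ _ _ _ _ sf p (f p)) => _ [x [_ px] <-]; exists x.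
  - exact: vector_field_rep.
  - by move=> _ [x [Ux [px fx]] <-]; exists (f x) => //; rewrite /c /= chartK.
rewrite conormal_field_frame; exact: smooth_tmap_field.
Qed.

Lemma conormal_smooth p a j : U p ->
  smooth_on (chart p @` (U `&` chart_dom f p (f p))) (fun y => conormal p y a j).
Proof.
move=> Up; set A := chart p @` _.
have oA : open A.
  by apply: open_chart_image => [|x [_ []]//]; apply: openI => //; exact: open_chart_dom.
pose c := chart (f p) \o f \o chart_inv p.
have sc : smooth_on A c.
  by apply: smooth_onW (@rep_smooth _ _ _ _ _ _ sf p (f p)) => _ [x [_ px] <-]; exists x.
apply: (@smooth_on_eq _ _ _ _ (fun y => metric_rep g (f p) ('D_(delta_mx 0 a) c y)
  (field_rep f (conormal_field j) p (f p) y) (c y))) => //.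
  move=> _ [x [Ux [px fx]] <-].
  have Dc : 'D_(delta_mx 0 a) c (chart p x) =
      tchange (f x) (f p) (f x) (tmap f x (tchange p x x (delta_mx 0 a))).
    by rewrite (tchange_tmap_constant imf _ px fx).
  have cx : c (chart p x) = chart (f p) (f x) by rewrite /c /= chartK.
  rewrite Dc cx (field_rep_at f _ (f p) px) (metric_repE g _ _ fx).
  by rewrite mxE /form_rep (chartK px).
apply: (smooth_metric_rep rg) => //.
- exact: smooth_on_derive.
- exact: conormal_field_smooth.
- by move=> _ [x [Ux [px fx]] <-]; exists (f x) => //; rewrite /c /= chartK.
Qed.

Lemma conormal_field_diff x j : U x -> diff_along f (conormal_field j) x.
Proof.
move=> Ux; apply: (smooth_on_diff (conormal_field_smooth j Ux)).
by exists x => //; split => //; split; exact: dom_center.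
Qed.

End Conormal.
End PTR.

(** * The two conditions on vectors and on sections *)

Section KernelSection.
Context {R : realType}.

(** With the frame B normalised by B S = 1, the section through v is y |-> v S
    B y. *)
Lemma kernel_section n c (U : set 'rV[R]_n) (N : 'rV[R]_n -> 'M[R]_(n, c)) a v :
  open U -> U a -> (forall i j, smooth_on U (fun y => N y i j)) ->
  \rank (N a) = c -> v *m N a = 0 ->
  exists (U' : set 'rV[R]_n) (F : 'rV[R]_n -> 'rV[R]_n),
    [/\ open U', U' a, U' `<=` U, smooth_on U' F &
      F a = v /\ forall y, U' y -> F y *m N y = 0].
Proof.
move=> oU Ua sN rN vN.
have [k En] : exists k, n = (c + k)%N.
  exists (n - c)%N; rewrite subnKC// -rN; exact: rank_leq_row.
subst n; have [U' [S [B [oU' U'a U'U sB BP]]]] := kernel_frame oU Ua sN rN.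
exists U', (fun y => v *m S *m B y); split => //.
  apply/smooth_on_rVP => // j; apply: smooth_on_mulmx => // *.
  exact: smooth_on_cst.
split=> [|y /BP[BN _ _]]; last by rewrite -mulmxA BN mulmx0.
have [BN BS inj] := BP a U'a; apply: inj; rewrite -!mulmxA.
  by rewrite BN !mulmx0 vN.
by rewrite BS mulmx1.
Qed.

End KernelSection.

Section Pointwise.
Context {R : realType} {m n : nat} {Mbar : smoothManifold R (2 * m + 1)}.
Notation T := 'rV[R]_(2 * m + 1).
Variables (g : Mbar -> T -> T -> R) (phi : Mbar -> T -> T) (xi : Mbar -> T)
  (eta : Mbar -> T -> R).
Context {M : smoothManifold R n}.
Variables (f : M -> Mbar) (D : M -> set 'rV[R]_n).
Hypotheses (sas : sasakian g phi xi eta) (ptr : ptr_submanifold g phi xi eta f D).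

Let rg : riemannian g := sasakian_riemannian sas.
Let ig q : inner (g q) := riemannian_inner rg q.
Let imf : immersion f := ptr_immersion ptr.
Let sf : smooth_map f := imf.1.
Let ii q : inner (induced_metric g f q) := induced_inner rg imf q.

Notation Dt := (ambiguous_distribution g xi f D).
Notation df X := (fun x => tmap f x (X x)).
Notation ind := (induced_metric g f).

Lemma perp_frame p : exists r (U : set M) (E : 'I_r -> M -> 'rV[R]_n),
  [/\ open U, U p, forall i, smooth_field_on U idfun (E i) &
    forall q, U q -> row_free (\matrix_i E i q) /\
      D q = [set v | (v <= \matrix_i E i q)%MS]].
Proof.
have [_ _ [r _ dD] _ _] := ptr; have [U [E [oU Up sE UE]]] := dD p.
by exists r, U, E.
Qed.

Lemma perpZ q a u : D q u -> D q (a *: u).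
Proof.
have [r [U [E [_ Uq _ UE]]]] := perp_frame q.
by have [_ ->] := UE q Uq; exact: scalemx_sub.
Qed.

Lemma perp0 q : D q 0.
Proof.
have [r [U [E [_ Uq _ UE]]]] := perp_frame q.
by have [_ ->] := UE q Uq; exact: sub0mx.
Qed.

Lemma ambiguousZ q a v : Dt q v -> Dt q (a *: v).
Proof.
move=> [vD vxi]; split=> [u Du|]; first by rewrite (innerZl (ii q)) vD// mulr0.
by rewrite (tmapZ ptr) (innerZl (ig _)) vxi mulr0.
Qed.

Lemma ambiguous0 q : Dt q 0.
Proof.
split=> [u Du|]; first exact: inner0l (ii q) u.
by rewrite (tmap0 f q) (inner0l (ig _)).
Qed.

Lemma perp_ambiguous q u v : D q u -> Dt q v -> g (f q) (tmap f q v) (tmap f q u) = 0.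
Proof. by move=> Du [vD _]; exact: vD. Qed.

Lemma open_chart_preimage (p : M) (U : set 'rV[R]_n) : open U -> open (dom p `&` chart p @^-1` U).
Proof.
move=> oU; rewrite openE => x [px Ux]; apply: filterI.
  exact: near_dom px.
by apply: (chart_continuous px); exact: open_nbhs_nbhs.
Qed.

(** A local section through v is found in the kernel of the conormal matrix
    and multiplied by a cut-off function. *)
Lemma extend_ambiguous p v : Dt p v ->
  exists2 X : M -> 'rV[R]_n, section_of Dt X & X p = v.
Proof.
move=> Dv; have pp := dom_center p; have ff := dom_center (f p).
have [r [U [E [oU Up sE UE]]]] := perp_frame p.
pose A := chart p @` (U `&` chart_dom f p (f p)).
have oA : open A.
  apply: open_chart_image => [|x [_ []]//]; apply: openI => //; exact: open_chart_dom.
have Ap : A (chart p p) by exists p.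
have sN a j := @conormal_smooth _ _ _ _ _ _ _ _ _ _ _ sas ptr _ _ _ oU sE p a j Up.
have rN := conormal_rank sas ptr UE Up pp.
have vN : v *m conormal g xi f E p (chart p p) = 0.
  by apply/(conormal_ker sas ptr UE v Up pp); rewrite tchange_id.
have [U' [F [oU' U'p U'A sF [Fp FN]]]] := kernel_section oA Ap sN rN vN.
pose O := dom p `&` chart p @^-1` U'.
have oO : open O by exact: open_chart_preimage.
have OU x : O x -> U x.
  move=> [px /U'A[z [Uz [pz _]] zx]].
  by rewrite -(chartK px) -zx chartK.
have sX : smooth_field_on O idfun (fun x => tchange p x x (F (chart p x))).
  apply: coordinate_field_smooth => //; first by move=> x [].
  by apply: smooth_onW sF => _ [x [_ Ux] <-].
have [k [kp k0 _ _ kX]] := cutoff oO (conj pp U'p : O p).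
exists (fun x => k x *: tchange p x x (F (chart p x))); last first.
  by rewrite kp scale1r Fp tchange_id.
split=> [|x]; first exact: kX.
have [Ox|nOx] := pselect (O x); last by rewrite k0// scale0r; exact: ambiguous0.
apply: ambiguousZ; apply/(conormal_ker sas ptr UE _ (OU x Ox) Ox.1).
by apply: FN; exact: Ox.2.
Qed.

Lemma vector_field0 : vector_field (fun _ : M => 0 : 'rV[R]_n).
Proof.
move=> q p; set A := [set _ | _ in _].
have oA : open A.
  apply: open_chart_image => [|x [[]]//]; apply: openI; last exact: dom_open.
  by apply: openI; [exact: openT|exact: dom_open].
apply: (@smooth_on_eq _ _ _ _ (fun=> 0)) => //; last exact: smooth_on_cst.
by move=> y _; apply/esym; exact: derive0.
Qed.

(** The second condition for vectors at a point. *)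
Definition phi_isotropic := forall q v w, Dt q v -> Dt q w ->
  g (f q) (phi (f q) (tmap f q v)) (tmap f q w) = 0.

(** The first condition for vectors at a point, in terms of local sections F
    of the totally real distribution. *)
Definition perp_parallel := forall (U : set M) (F : M -> 'rV[R]_n) q v w,
  open U -> U q -> smooth_field_on U idfun F -> (forall x, U x -> D x (F x)) ->
  Dt q v -> Dt q w -> g (f q) (tmap f q w) (cov g f (df F) q v) = 0.

Definition ptr_condition := forall X Y Z : M -> 'rV[R]_n,
  section_of Dt X -> section_of Dt Y -> section_of D Z -> forall p : M,
  g (f p)
    (second_fundamental_form g f X (tensorP g phi f Y) p
     + normal_connection g f X (tensorF g phi f Y) p)
    (phi (f p) (tmap f p (Z p))) = 0
  /\ induced_metric g f p (tensorP g phi f X p) (Y p) = 0.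

(** The second condition does not involve Z, which may be taken to be zero. *)
Lemma condition_isotropic : ptr_condition -> phi_isotropic.
Proof.
move=> H q v w Dv Dw.
have [X sX Xq] := extend_ambiguous Dv; have [Y sY Yq] := extend_ambiguous Dw.
(* any Z will do *)
have s0 : section_of D (fun=> 0) by split; [exact: vector_field0|move=> x; exact: perp0].
have [_ H0] := H X Y _ sX sY s0 q; rewrite -Xq -Yq.
apply: (etrans _ H0); apply/esym.
exact: (tangent_partP rg imf q (phi (f q) (tmap f q (X q))) (Y q)).
Qed.

(** A local section F becomes a global one after multiplication by a cut-off
    function, which does not change its covariant derivative at q. *)
Lemma condition_parallel : ptr_condition -> perp_parallel.
Proof.
move=> H U F q v w oU Uq sF FD Dv Dw.
have [X sX Xq] := extend_ambiguous Dv; have [Y sY Yq] := extend_ambiguous Dw.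
have [k [kq k0 dk Dk kF]] := cutoff oU Uq.
have sZ : section_of D (fun x => k x *: F x).
  split=> [|x]; first exact: kF.
  have [Ux|nUx] := pselect (U x); first by apply: perpZ; exact: FD.
  by rewrite k0// scale0r; exact: perp0.
have [H1 _] := H X Y _ sX sY sZ q.
have H2 := etrans (esym (first_condition_eq sas ptr q sX sY sZ)) H1.
have dF : diff_along f (df F) q := diff_along_tmap imf oU Uq sF.
have [_ C] := cov_scale rg sf (X q) dk dF.
have kE : df (fun x => k x *: F x) = (fun x => k x *: tmap f x (F x)).
  by apply/funext => x; exact: tmapZ ptr _ _ _.
have C' : cov g f (df (fun x => k x *: F x)) q (X q) = cov g f (df F) q (X q).
  by rewrite kE; apply: (etrans C); rewrite kq scale1r Dk scale0r addr0.
move: H2; rewrite C' Xq Yq => /eqP; rewrite oppr_eq0 => /eqP; exact.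
Qed.

Lemma isotropic_parallel_condition : phi_isotropic -> perp_parallel -> ptr_condition.
Proof.
move=> iso par X Y Z sX sY sZ p; split.
  apply: (etrans (first_condition_eq sas ptr p sX sY sZ)); apply/eqP.
  rewrite oppr_eq0; apply/eqP.
  by apply: (par setT Z p (X p) (Y p)) => //; [exact: openT|case: sZ|move=> x _; case: sZ|case: sX|case: sY].
apply: (etrans (tangent_partP rg imf p (phi (f p) (tmap f p (X p))) (Y p))).
by apply: iso; [case: sX|case: sY].
Qed.

Section Closed.
Hypotheses (iso : phi_isotropic) (par : perp_parallel).
Context {r : nat} (U : set M) (E : 'I_r -> M -> 'rV[R]_n).
Hypotheses (oU : open U) (sE : forall i, smooth_field_on U idfun (E i)).
Hypothesis UE : forall q, U q -> row_free (\matrix_i E i q) /\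
  D q = [set v | (v <= \matrix_i E i q)%MS].

Notation N := (conormal g xi f E).
Notation omega j := (metric_form g f (conormal_field xi f E j)).

(** For the members of the frame this is perp_parallel; for xi the derivative
    is - phi v, to which phi_isotropic applies. *)
Lemma conormal_parallel x j v w : U x -> Dt x v -> Dt x w ->
  g (f x) (tmap f x w) (cov g f (conormal_field xi f E j) x v) = 0.
Proof.
move=> Ux Dv Dw; case: (split_ordP j) => i ->.
  rewrite conormal_field_xi; have [_ ->] := cov_xi_along sas sf x v.
  by rewrite (innerNr (ig _)) (innerC (ig _)) iso// oppr0.
rewrite conormal_field_frame; apply: (par oU Ux (sE i)) => // q Uq.
exact: (frame_in UE).
Qed.

(** At each point x the exterior derivative may be computed in the chart at x,
    where it is the skew part of the covariant derivative of the conormal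
    field. That part vanishes by conormal_parallel. *)
Lemma conormal_closed p y v w : U p ->
  (chart p @` (U `&` chart_dom f p (f p))) y -> v *m N p y = 0 -> w *m N p y = 0 ->
  w *m mxderiv (N p) y v = v *m mxderiv (N p) y w.
Proof.
move=> Up Ay; have [x [Ux [px fx]] xy] := Ay; have Up' := Ux.
set A := chart p @` _ in Ay.
have oA : open A.
  by apply: open_chart_image => [|z [_ []]//]; apply: openI => //; exact: open_chart_dom.
rewrite -xy => /(conormal_ker sas ptr UE v Ux px) Dv /(conormal_ker sas ptr UE w Ux px) Dw.
have Ap : A (chart p x) by rewrite xy.
have lo j z : scalar (omega j z) by exact: (metric_form_linear rg sf).
have dW j : diff_along f (conormal_field xi f E j) x.
  exact: (conormal_field_diff sas ptr oU sE j Ux).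
have dfo j u : differentiable (form_rep (omega j) x u) (chart x x).
  exact: (metric_form_differentiable rg sf u (dW j)).
have dN a j : differentiable (fun z => N p z a j) (chart p x).
  exact: (smooth_on_diff (conormal_smooth sas ptr oU sE a j Up) Ap).
have entry u1 u2 j : (u2 *m mxderiv (N p) (chart p x) u1) 0 j =
    'D_u1 (form_rep (omega j) p u2) (chart p x).
  rewrite -(mxderiv_mull u2 _ dN) mxE.
  have E0 : \forall z \near chart p x, (u2 *m N p z) 0 j = form_rep (omega j) p u2 z.
    apply: filterS (near_chart_image px) => _ [z pz <-].
    by apply: (etrans (mulmx_conormal sas ptr E u2 j pz)); rewrite /form_rep (chartK pz).
  exact: near_eq_derive u1 E0.
apply/rowP => j.
apply: (etrans (entry v w j)); apply: (etrans _ (esym (entry w v j))).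
have D1 := dform_chart (lo j) v w px (dfo j).
have D2 := dform_metric rg sf (tchange p x x v) (tchange p x x w) (dW j).
have z1 := conormal_parallel j Ux Dv Dw.
have z2 := conormal_parallel j Ux Dw Dv.
apply/eqP; rewrite -subr_eq0; apply/eqP.
apply: (etrans D1); apply: (etrans D2).
by apply: (etrans (congr2 (fun a b => a - b) z1 z2)); exact: subrr.
Qed.

End Closed.
End Pointwise.

(** * Leaves of the ambiguous distribution *)

Section Leaves.
Context {R : realType} {m n : nat} {Mbar : smoothManifold R (2 * m + 1)}.
Notation T := 'rV[R]_(2 * m + 1).
Variables (g : Mbar -> T -> T -> R) (phi : Mbar -> T -> T) (xi : Mbar -> T)
  (eta : Mbar -> T -> R).
Context {M : smoothManifold R n}.
Variables (f : M -> Mbar) (D : M -> set 'rV[R]_n).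
Hypotheses (sas : sasakian g phi xi eta) (ptr : ptr_submanifold g phi xi eta f D).

Let rg : riemannian g := sasakian_riemannian sas.
Let ig q : inner (g q) := riemannian_inner rg q.
Let imf : immersion f := ptr_immersion ptr.
Let sf : smooth_map f := imf.1.
Let ii q : inner (induced_metric g f q) := induced_inner rg imf q.
Let rind : riemannian (induced_metric g f) := riemannian_induced rg imf.

Notation Dt := (ambiguous_distribution g xi f D).
Notation df X := (fun x => tmap f x (X x)).
Notation ind := (induced_metric g f).

Section Leaf.
Context {l : nat} {L : smoothManifold R l} (i : L -> M).
Hypotheses (imi : immersion i) (il : forall x w, Dt (i x) (tmap i x w)).
Let si : smooth_map i := imi.1.
Let sfi : smooth_map (f \o i) := smooth_map_comp si sf.

Variables (V : L -> 'rV[R]_n) (q : L) (a : 'rV[R]_l).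
Hypotheses (dV : diff_along i V q) (VD : forall x, Dt (i x) (V x)).

(** Metricity of the connection, for two fields that are orthogonal near q. *)
Lemma orthogonal_cov (B : L -> T) : diff_along (f \o i) B q ->
  (\forall x \near q, g (f (i x)) (tmap f (i x) (V x)) (B x) = 0) ->
  g (f (i q)) (cov g (f \o i) (fun x => tmap f (i x) (V x)) q a) (B q) =
  - g (f (i q)) (tmap f (i q) (V q)) (cov g (f \o i) B q a).
Proof.
move=> dB VB; have [dA _] := cov_tmap g imf si a dV.
have [_ C] := cov_metric rg sfi a dA dB.
have E := near_eq_derive a (near_chart_inv (dom_center q) VB).
have Z := etrans (esym C) (etrans E (derive_cst _ _ _)).
by apply/eqP; rewrite -addr_eq0; apply/eqP; exact Z.
Qed.

(** By the Gauss formula for f the derivative of V in M may be replaced by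
    that of df (V), and the derivative is moved to F, which is orthogonal to
    V. *)
Lemma leaf_cov (U : set M) (F : M -> 'rV[R]_n) : open U -> U (i q) ->
  smooth_field_on U idfun F -> (forall x, U x -> D x (F x)) ->
  ind (i q) (cov ind i V q a) (F (i q)) =
  - g (f (i q)) (tmap f (i q) (V q)) (cov g f (df F) (i q) (tmap i q a)).
Proof.
move=> oU Uq sF FD.
have dF : diff_along f (df F) (i q) := diff_along_tmap imf oU Uq sF.
have [dB CB] := cov_pullback g sf si a dF.
apply: (etrans (esym (gauss rg imf si a (F (i q)) dV))).
have nU : \forall x \near q, U (i x).
  exact: (si.1 q U (open_nbhs_nbhs (conj oU Uq))).
have VB : \forall x \near q, g (f (i x)) (tmap f (i x) (V x)) (tmap f (i x) (F (i x))) = 0.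
  by apply: filterS nU => x Ux; exact: (perp_ambiguous (FD _ Ux) (VD x)).
apply: (etrans (orthogonal_cov dB VB)).
have C' := congr1 (fun z => - g (f (i q)) (tmap f (i q) (V q)) z) CB.
exact C'.
Qed.

(** As xi is tangent to M, the Gauss formula applies to it as well; then nabla
    xi = - phi. *)
Lemma leaf_cov_xi :
  g (f (i q)) (tmap f (i q) (cov ind i V q a)) (xi (f (i q))) =
  g (f (i q)) (tmap f (i q) (V q)) (phi (f (i q)) (tmap f (i q) (tmap i q a))).
Proof.
have [w wxi] := ptr_xi ptr (i q).
have [dB CB] := cov_xi_along sas sfi q a.
have VB : \forall x \near q, g (f (i x)) (tmap f (i x) (V x)) (xi (f (i x))) = 0.
  by apply: nearW => x; case: (VD x).
have G := esym (gauss rg imf si a w dV).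
apply: (etrans (congr1 (g _ _) (esym wxi))); apply: (etrans G).
apply: (etrans (congr1 (g _ _) wxi)); apply: (etrans (orthogonal_cov dB VB)).
have CB' := etrans CB (congr1 (fun z => - phi (f (i q)) z) (esym (tmap_comp sf si q a))).
apply: (etrans (congr1 (fun z => - g (f (i q)) (tmap f (i q) (V q)) z) CB')).
by rewrite (innerNr (ig _)) opprK.
Qed.

End Leaf.

(** The derivative c in M of a field tangent to the leaf is orthogonal to the
    frame of the totally real distribution and to xi, by the two conditions.
    Hence it lies in the ambiguous distribution, which is the tangent space of
    the leaf, and its normal part is zero. *)
Lemma leaves_geodesic : phi_isotropic g phi xi f D -> perp_parallel g xi f D ->
  leaves_totally_geodesic ind Dt.
Proof.
move=> iso par l L i [imi _ ri] X Y vX vY q.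
have il x w : Dt (i x) (tmap i x w) by rewrite -ri; exists w.
pose V x := tmap i x (Y x).
have dV : diff_along i V q := diff_along_tmap imi openT (I : [set: L] q) vY.
have VD x : Dt (i x) (V x) by exact: il.
pose c := cov ind i V q (X q).
(* a vector of the tangent space of the leaf has no normal part *)
suff : Dt (i q) c.
  rewrite -ri => -[u _ uc]; rewrite /second_fundamental_form -/V -/c -uc.
  exact: (normal_part_tmap rind imi).
split=> [u Du|]; last first.
  apply: (etrans (leaf_cov_xi imi (X q) dV VD)); rewrite (innerC (ig _)).
  by apply: iso.
have [r [U [E [oU Uq sE UE]]]] := perp_frame ptr (i q).
have [b ->] := frame_expand UE Uq Du.
rewrite (inner_sumr _ _ _ (ii _)) big1// => j _; rewrite (innerZr (ii _)).
have FD x : U x -> D x (E j x) by exact: (frame_in UE).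
have C := leaf_cov imi (X q) dV VD oU Uq (sE j) FD.
have P0 := par U (E j) (i q) (tmap i q (X q)) (V q) oU Uq (sE j) FD (il _ _) (VD q).
have C0 : ind (i q) c (E j (i q)) = 0.
  by apply: (etrans C); rewrite P0 oppr0.
by rewrite C0 mulr0.
Qed.

(** Vectors of the distribution at a point of a leaf are realised by vector
    fields of the leaf; vanishing of the second fundamental form says that the
    derivative in M is tangent to the leaf. *)
Lemma geodesic_leaf_cov l (L : smoothManifold R l) (i : L -> M) q v w :
  integral_manifold Dt i -> totally_geodesic ind i -> Dt (i q) v -> Dt (i q) w ->
  exists (V : L -> 'rV[R]_n) a, [/\ diff_along i V q, forall x, Dt (i x) (V x),
    V q = w, tmap i q a = v & Dt (i q) (cov ind i V q a)].
Proof.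
move=> [imi _ ri] tg; rewrite -!ri => -[a _ <-] [b _ <-].
have [X vX <-] := extend_vector q a; have [Y vY <-] := extend_vector q b.
exists (fun x => tmap i x (Y x)), (X q); split => //.
- exact: (diff_along_tmap imi openT (I : [set: L] q) vY).
- by move=> x; have := ri x => <-; exists (Y x).
have := tg X Y vX vY q; rewrite /second_fundamental_form /normal_part.
set c := cov _ _ _ _ _ => /eqP; rewrite subr_eq0 => /eqP cE.
have H : range (tmap i q) (tmap i q (tangent_part ind i q c)).
  by exists (tangent_part ind i q c).
rewrite -cE in H; exact H.
Qed.

Section Forward.
Hypotheses (itg : integrable_distribution Dt) (tg : leaves_totally_geodesic ind Dt).

Lemma geodesic_isotropic : phi_isotropic g phi xi f D.
Proof.
move=> p v w Dv Dw; have [l [L [i [iM [q _ qp]]]]] := itg p; subst p.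
have [V [a [dV VD Vq av [_ c0]]]] := geodesic_leaf_cov iM (tg iM) Dv Dw.
have [imi _ _] := iM.
have H := etrans (esym (leaf_cov_xi imi a dV VD)) c0.
by rewrite (innerC (ig _)) -Vq -av.
Qed.

Lemma geodesic_parallel : perp_parallel g xi f D.
Proof.
move=> U F p v w oU Up sF FD Dv Dw.
have [l [L [i [iM [q _ qp]]]]] := itg p; subst p.
have [V [a [dV VD Vq av [c0 _]]]] := geodesic_leaf_cov iM (tg iM) Dv Dw.
have [imi _ _] := iM.
have H := etrans (esym (leaf_cov imi a dV VD oU Up sF FD)) (c0 _ (FD _ Up)).
by apply/eqP; rewrite -oppr_eq0 -Vq -av; apply/eqP; exact H.
Qed.

End Forward.
End Leaves.

(** * Integral manifolds *)

Section BallManifold.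
Context {R : realType} {k : nat}.

(** The balls with rational centre and radius 1 / (n + 1) form a basis. *)
Lemma second_countable_rV : @second_countable 'rV[R]_k.
Proof.
pose b (c : 'rV[rat]_k * nat) := ball (map_mx ratr c.1 : 'rV[R]_k) c.2.+1%:R^-1.
exists (b @` setT); first by apply: sub_countable (card_image_le _ _) _.
split=> [_ [c _ <-]|x A]; first exact: ball_open.
move=> /nbhs_ballP[e e0 eA].
have [n ne] : exists n, n.+1%:R^-1 + n.+1%:R^-1 < e.
  (* x is at distance less than 1 / (n + 1) from the centre of a ball of that
     radius, so two radii have to be smaller than e *)
  have e20 : 0 < e / 2 by rewrite divr_gt0.
  have [n] := ltr_add_invr e20; rewrite add0r => ne; exists n.
  by rewrite [e]splitr; apply: ltrD.
have n0 : (0 : R) < n.+1%:R^-1 by [].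
set a : R := n.+1%:R^-1 in n0 ne.
have qx j : exists q : rat, `|x 0 j - ratr q| < a / 2.
  have xx : x 0 j - a / 2 < x 0 j + a / 2 by move: n0; lra.
  have [q] := rat_in_itvoo xx; rewrite in_itv/= => /andP[q1 q2]; exists q.
  by rewrite ltr_norml; move: q1 q2; lra.
pose q := \row_j projT1 (cid (qx j)).
have bx : b (q, n) x.
  rewrite /b -ball_normE /ball_ /= distrC.
  have a2 : a / 2 < a by move: n0; lra.
  apply: le_lt_trans a2; apply: normr_rV_le => [|j]; first by rewrite divr_ge0// ltW.
  by rewrite !mxE ltW//; exact: projT2 (cid (qx j)).
exists (b (q, n)) => [|y by_]; first by split => //; exists (q, n).
apply: eA; apply: le_ball (ltW ne) _ _; apply: ball_triangle by_.
exact: ball_sym.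
Qed.

Variable d : R.
Hypothesis d0 : 0 < d.

(** A homeomorphism from the whole space onto the open ball of radius d, with
    inverse stretch. It serves as a chart, so it need not be smooth. *)
Definition shrink (x : 'rV[R]_k) : 'rV[R]_k := (d / (1 + `|x|)) *: x.
Definition stretch (y : 'rV[R]_k) : 'rV[R]_k := (d - `|y|)^-1 *: y.

Let den0 (x : 'rV[R]_k) : 0 < 1 + `|x|.
Proof. by rewrite ltr_pwDl. Qed.

Lemma norm_shrink x : `|shrink x| = d * `|x| / (1 + `|x|).
Proof.
by rewrite normrZ ger0_norm ?divr_ge0 ?ltW// mulrAC.
Qed.

Lemma shrink_lt x : `|shrink x| < d.
Proof.
rewrite norm_shrink ltr_pdivrMr// ltr_pM2l// ltrDr//.
Qed.

Lemma shrinkK : cancel shrink stretch.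
Proof.
move=> x; rewrite /stretch norm_shrink /shrink scalerA.
have := den0 x; have := d0; move: `|x| => t d1 t1.
rewrite -[RHS]scale1r; congr (_ *: _); field.
by apply/andP; split; rewrite gt_eqF//; move: d1 t1; nra.
Qed.

Lemma stretchK y : `|y| < d -> shrink (stretch y) = y.
Proof.
move=> yd; have h : 0 < d - `|y| by rewrite subr_gt0.
rewrite /shrink /stretch normrZ ger0_norm ?invr_ge0 ?ltW// scalerA.
move: h; move: (`|y|) {yd} => t h.
rewrite -[RHS]scale1r; congr (_ *: _); field.
by apply/andP; split; rewrite gt_eqF//; move: h d0; lra.
Qed.

Lemma shrink_image : shrink @` setT = [set y | `|y| < d].
Proof.
apply/seteqP; split=> [_ [x _ <-]|y yd]; first exact: shrink_lt.
by exists (stretch y) => //; exact: stretchK.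
Qed.

Lemma shrink_continuous : continuous shrink.
Proof.
move=> x; apply: (@cvgZ _ _ _ _ _ (fun x => d / (1 + `|x|)) id _ _ _ cvg_id).
apply: cvgM; first exact: cvg_cst.
apply: cvgV; first by rewrite gt_eqF.
apply: cvgD; first exact: cvg_cst.
exact: norm_continuous.
Qed.

Lemma stretch_continuous y : `|y| < d -> {for y, continuous stretch}.
Proof.
move=> yd; apply: (@cvgZ _ _ _ _ _ (fun x => (d - `|x|)^-1) id _ _ _ cvg_id).
apply: cvgV; first by rewrite subr_eq0 gt_eqF.
apply: cvgB; first exact: cvg_cst.
exact: norm_continuous.
Qed.

(** The open ball of radius d as a manifold. The underlying space is the whole
    space of row vectors, which is homeomorphic to the ball; since shrink is
    the only chart, the transition map is the identity and the smooth
    structure is that of the ball. *)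
Definition ball_manifold : smoothManifold R k.
Proof.
refine (@SmoothManifold R k 'rV[R]_k (fun=> setT) (fun=> shrink) (fun=> stretch)
  (@norm_hausdorff _ _) second_countable_rV _ _ _ _ _ _ _).
- by move=> _; exact: openT.
- by [].
- by move=> _; rewrite shrink_image; exact: open_norm_lt.
- by move=> _ x _; exact: shrinkK.
- by move=> _ x _; exact: shrink_continuous.
- by move=> _ y; rewrite shrink_image; exact: stretch_continuous.
- move=> _ _; rewrite setTI shrink_image.
  apply: (@smooth_on_eq _ _ _ _ id).
  + exact: open_norm_lt.
  + by move=> y yd; apply/esym; exact: stretchK.
  + apply: smooth_on_id; exact: open_norm_lt.
Defined.

End BallManifold.

Section IntegralManifold.
Context {R : realType}.

(** The rank of N at a bounds its number c of columns by n. *)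
Lemma frobenius_kernel n c (U : set 'rV[R]_n) (N : 'rV[R]_n -> 'M[R]_(n, c)) a :
  open U -> U a -> (forall i j, smooth_on U (fun y => N y i j)) ->
  \rank (N a) = c ->
  (forall y v w, U y -> v *m N y = 0 -> w *m N y = 0 ->
     w *m mxderiv N y v = v *m mxderiv N y w) ->
  exists k (d : R) (Phi : 'rV[R]_k -> 'rV[R]_n) (S : 'M[R]_(n, k)),
    [/\ 0 < d, Phi 0 = a, smooth_on [set x | `|x| < d] Phi,
      forall x, `|x| < d -> Phi x *m S = x + a *m S &
      forall x, `|x| < d -> [/\ U (Phi x), forall v, 'D_v Phi x *m S = v &
        range (fun v => 'D_v Phi x) = [set u | u *m N (Phi x) = 0]]].
Proof.
move=> oU Ua sN rN clN.
have [k En] : exists k, n = (c + k)%N.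
  exists (n - c)%N; rewrite subnKC// -rN; exact: rank_leq_row.
by subst n; exists k; exact: frobenius oU Ua sN rN clN.
Qed.

Context {n : nat} {M : smoothManifold R n}.

Section Ball.
Context {k : nat} (d : R) (d0 : 0 < d) (p : M) (Phi : 'rV[R]_k -> 'rV[R]_n).
Hypotheses (sP : smooth_on [set x | `|x| < d] Phi)
  (PU : forall x, `|x| < d -> (chart p @` dom p) (Phi x)).

Notation L := (ball_manifold (k := k) d0).

(** The parametrisation Phi of the integral manifold in the chart at p, seen
    as a map from the ball to M. *)
Definition ball_map (q : L) : M := chart_inv p (Phi (shrink d q)).

Lemma ball_map_chart q : dom p (ball_map q) /\ chart p (ball_map q) = Phi (shrink d q).
Proof. by apply: chart_image_invK; apply: PU; exact: shrink_lt. Qed.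

Lemma ball_map_continuous : continuous ball_map.
Proof.
move=> q; have h := shrink_lt d0 q.
have c1 : {for q, continuous (shrink d : 'rV[R]_k -> 'rV[R]_k)} by exact: shrink_continuous.
have c2 : {for shrink d q, continuous Phi}.
  exact: differentiable_continuous (smooth_on_diff sP h).
have c3 : {for Phi (shrink d q), continuous (chart_inv p)}.
  exact: chart_inv_continuous (PU h).
exact: (continuous_comp (continuous_comp c1 c2) c3).
Qed.

Lemma ball_map_smooth : smooth_map ball_map.
Proof.
split=> [|q r]; first exact: ball_map_continuous.
set W := _ `&` _.
have oW : open W.
  apply: openI; first exact: openT.
  by apply: open_comp; [move=> x _; exact: ball_map_continuous|exact: dom_open].
have oA : open (chart q @` W) by apply: open_chart_image => // x [].
apply: (@smooth_on_eq _ _ _ _ ((chart r \o chart_inv p) \o Phi)) => //.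
  move=> _ [x _ <-].
  exact: (congr1 ((chart r \o chart_inv p) \o Phi) (esym (congr1 (shrink d) (shrinkK d0 x)))).
apply: (@smooth_on_comp_rV _ _ _ oA _ _ (chart p @` (dom p `&` dom r))).
- by apply: open_chart_image => [|x []//]; apply: openI; exact: dom_open.
- by apply: smooth_onW sP => _ [x _ <-]; exact: shrink_lt.
- exact: transition_smooth.
- move=> _ [x [_ rx] <-]; have [px xE] := ball_map_chart x.
  by exists (ball_map x).
Qed.

Lemma ball_map_tmap q u : tmap ball_map q u =
  tchange p (ball_map q) (ball_map q) ('D_u Phi (shrink d q)).
Proof.
have h := shrink_lt d0 q; have [pq qE] := ball_map_chart q.
have dP : differentiable Phi (shrink d q) by exact: (smooth_on_diff sP h).
have dT : differentiable (chart (ball_map q) \o chart_inv p) (Phi (shrink d q)).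
  rewrite -qE; apply: (smooth_on_diff (@transition_smooth _ _ M p (ball_map q))).
  by exists (ball_map q) => //; split => //; exact: dom_center.
have D := derive_comp u dP dT.
have E : \forall y \near shrink d q, (chart (ball_map q) \o ball_map \o stretch d) y =
    ((chart (ball_map q) \o chart_inv p) \o Phi) y.
  have : \forall y \near shrink d q, `|y| < d.
    by apply: open_nbhs_nbhs; split; [exact: open_norm_lt|].
  by apply: filterS => y yd; rewrite /= /ball_map (stretchK d0 yd).
apply: (etrans (near_eq_derive u E)); apply: (etrans D).
exact: (congr1 ('D_('D_u Phi (shrink d q)) (chart (ball_map q) \o chart_inv p)) (esym qE)).
Qed.

End Ball.

(** The solution Phi of the Frobenius problem in the chart at p gives a map i
    from a ball to M. It is injective, and an immersion, because Phi is a
    graph; its tangent spaces are the kernels of N, which represent the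
    distribution in that chart. *)
Lemma integral_manifold_kernel (p : M) (Dt : M -> set 'rV[R]_n) c (U : set 'rV[R]_n)
    (N : 'rV[R]_n -> 'M[R]_(n, c)) :
  open U -> U (chart p p) -> U `<=` chart p @` dom p ->
  (forall i j, smooth_on U (fun y => N y i j)) ->
  \rank (N (chart p p)) = c ->
  (forall y v w, U y -> v *m N y = 0 -> w *m N y = 0 ->
     w *m mxderiv N y v = v *m mxderiv N y w) ->
  (forall x v, dom p x -> U (chart p x) ->
     v *m N (chart p x) = 0 <-> Dt x (tchange p x x v)) ->
  exists (k : nat) (L : smoothManifold R k) (i : L -> M),
    integral_manifold Dt i /\ range i p.
Proof.
move=> oU Up Udom sN rN clN NDt.
have [k [d [Phi [S [d0 P0 sP PS PD]]]]] := frobenius_kernel oU Up sN rN clN.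
have PU x : `|x| < d -> (chart p @` dom p) (Phi x) by move=> /PD[Ux _ _]; exact: Udom.
pose i := ball_map (d0 := d0) p Phi.
have si : smooth_map i by exact: (ball_map_smooth d0 sP PU).
have ti q u : tmap i q u = tchange p (i q) (i q) ('D_u Phi (shrink d q)).
  exact: (ball_map_tmap (d0 := d0) sP PU).
(* tchange p (i q) (i q) is bijective, being the identification of two
   coordinates of the tangent space *)
have back q w : dom p (i q) -> tchange (i q) p (i q) (tchange p (i q) (i q) w) = w.
  move=> pq; exact: (etrans (tchange_comp w pq (dom_center (i q)) pq) (tchange_id w pq)).
have forth q w : dom p (i q) -> tchange p (i q) (i q) (tchange (i q) p (i q) w) = w.
  move=> pq; have qq := dom_center (i q).
  exact: (etrans (tchange_comp w qq pq qq) (tchange_id w qq)).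
exists k, (ball_manifold d0), i; split; last first.
  exists 0 => //; rewrite /i /ball_map /shrink scaler0 P0 chartK//; exact: dom_center.
split.
- split=> [|q u1 u2 E0]; first exact: si.
  have E := etrans (esym (ti q u1)) (etrans E0 (ti q u2)).
  have [pq _] := ball_map_chart (d0 := d0) PU q.
  have [_ DS _] := PD _ (shrink_lt d0 q).
  have E2 := etrans (esym (back q _ pq)) (etrans (congr1 (tchange (i q) p (i q)) E) (back q _ pq)).
  exact: (etrans (esym (DS u1)) (etrans (congr1 (mulmx^~ S) E2) (DS u2))).
- move=> q1 q2 iq; have [p1 E1] := ball_map_chart (d0 := d0) PU q1.
  have [p2 E2] := ball_map_chart (d0 := d0) PU q2.
  have EP : Phi (shrink d q1) = Phi (shrink d q2).
    exact: (etrans (esym E1) (etrans (congr1 (chart p) iq) E2)).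
  apply: (can_inj (shrinkK d0)); apply: (addIr (chart p p *m S)).
  by rewrite -!PS ?EP//; exact: shrink_lt.
- move=> q; have [pq qE] := ball_map_chart (d0 := d0) PU q.
  have [Uq _ rD] := PD _ (shrink_lt d0 q); rewrite -qE in Uq rD.
  apply/seteqP; split=> [_ [u _ <-]|w Dw].
    rewrite (ti q u); apply/(NDt _ _ pq Uq).
    have : range (fun v => 'D_v Phi (shrink d q)) ('D_u Phi (shrink d q)) by exists u.
    by rewrite rD.
  have : [set u | u *m N (chart p (i q)) = 0] (tchange (i q) p (i q) w).
    by apply/(NDt _ _ pq Uq); rewrite forth.
  rewrite -rD => -[u _ uE]; exists u => //.
  exact: (etrans (ti q u) (etrans (congr1 (tchange p (i q) (i q)) uE) (forth q w pq))).
Qed.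

End IntegralManifold.

(** * The equivalence *)

Lemma isotropic_parallel_integrable (R : realType) (m n : nat)
    (Mbar : smoothManifold R (2 * m + 1))
    (g : Mbar -> 'rV[R]_(2 * m + 1) -> 'rV[R]_(2 * m + 1) -> R)
    (phi : Mbar -> 'rV[R]_(2 * m + 1) -> 'rV[R]_(2 * m + 1))
    (xi : Mbar -> 'rV[R]_(2 * m + 1))
    (eta : Mbar -> 'rV[R]_(2 * m + 1) -> R)
    (M : smoothManifold R n) (f : M -> Mbar) (D : M -> set 'rV[R]_n) :
  sasakian g phi xi eta -> ptr_submanifold g phi xi eta f D ->
  phi_isotropic g phi xi f D -> perp_parallel g xi f D ->
  integrable_distribution (ambiguous_distribution g xi f D).
Proof.
move=> sas ptr iso par p; have pp := dom_center p.
have sf : smooth_map f := (ptr_immersion ptr).1.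
have [r [U [E [oU Up sE UE]]]] := perp_frame ptr p.
pose A := chart p @` (U `&` chart_dom f p (f p)).
have oA : open A.
  apply: open_chart_image => [|x [_ []]//]; apply: openI => //; exact: open_chart_dom.
have Ap : A (chart p p) by exists p => //; split => //; split => //; exact: dom_center.
have sN a j := @conormal_smooth _ _ _ _ _ _ _ _ _ _ _ sas ptr _ _ _ oU sE p a j Up.
have rN := conormal_rank sas ptr UE Up pp.
have clN y v w : A y -> v *m conormal g xi f E p y = 0 -> w *m conormal g xi f E p y = 0 ->
    w *m mxderiv (conormal g xi f E p) y v = v *m mxderiv (conormal g xi f E p) y w.
  exact: (conormal_closed sas ptr iso par oU sE UE Up).
apply: (integral_manifold_kernel oA Ap _ sN rN clN).
  by move=> _ [x [_ [px _]] <-]; exists x.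
move=> x v px [z [Uz [pz _]] zx].
have Ux : U x by rewrite -(chartK px) -zx chartK.
exact: (conormal_ker sas ptr UE v Ux px).
Qed.

Theorem lemma5p3 (R : realType) (m n : nat)
    (Mbar : smoothManifold R (2 * m + 1))
    (g : Mbar -> 'rV[R]_(2 * m + 1) -> 'rV[R]_(2 * m + 1) -> R)
    (phi : Mbar -> 'rV[R]_(2 * m + 1) -> 'rV[R]_(2 * m + 1))
    (xi : Mbar -> 'rV[R]_(2 * m + 1))
    (eta : Mbar -> 'rV[R]_(2 * m + 1) -> R)
    (M : smoothManifold R n) (f : M -> Mbar)
    (Dperp : M -> set 'rV[R]_n) :
  sasakian g phi xi eta ->
  ptr_submanifold g phi xi eta f Dperp ->
  let Dtilde := ambiguous_distribution g xi f Dperp in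
  (integrable_distribution Dtilde /\
   leaves_totally_geodesic (induced_metric g f) Dtilde)
  <->
  (forall X Y Z : M -> 'rV[R]_n,
     section_of Dtilde X -> section_of Dtilde Y -> section_of Dperp Z ->
     forall p : M,
       g (f p)
         (second_fundamental_form g f X (tensorP g phi f Y) p
          + normal_connection g f X (tensorF g phi f Y) p)
         (phi (f p) (tmap f p (Z p))) = 0
       /\ induced_metric g f p (tensorP g phi f X p) (Y p) = 0).
Proof.
move=> sas ptr Dtilde; split=> [[itg tg]|H].
  exact: (isotropic_parallel_condition sas ptr (geodesic_isotropic sas ptr itg tg)
    (geodesic_parallel sas ptr itg tg)).
have iso := condition_isotropic sas ptr H.
have par := condition_parallel sas ptr H.
split; first exact: (isotropic_parallel_integrable sas ptr iso par).
exact: (leaves_geodesic sas ptr iso par).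
Qed.
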